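(* There is a canonical one-to-one correspondence between the set of admissible transformations of the class of equations $\mathcal L$: $u_t=Au_{xx}+Bu_x+Cu$ and the set of admissible transformations of the class of the associated equations ${\rm DE}_0(\mathcal L)$. Namely, each point transformation $$\tilde t=T(t),\quad \tilde x=X(t,x),\quad \tilde u=U^1(t,x)u+U^0(t,x)$$ between equations $\mathcal L$ and $\tilde{\mathcal L}$ of the first class is extended to a point transformation, in the space of the variables $(t,x,u,\eta)$, between the associated equations ${\rm DE}_0(\mathcal L)$ and ${\rm DE}_0(\tilde{\mathcal L})$ by the formula $$\tilde\eta=\frac{U^1}{X_x}\eta+\frac{U^1_x}{X_x}u+\frac{U^0_x}{X_x}.$$ In both transformations the variables $(t,x,u)$ and the arbitrary elements $A,B,C$ are transformed in the same way. The extended transformations exhaust the set of admissible transformations in the class of equations ${\rm DE}_0(\mathcal L)$.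
   Context: All considerations are local. The class of equations considered consists of all $\mathcal L$: $u_t-A(t,x)u_{xx}-B(t,x)u_x-C(t,x)u=0$ with analytic arbitrary elements $A,B,C$, $A\ne0$. With each $\mathcal L$ one associates the equation ${\rm DE}_0(\mathcal L)$ for a function $\eta=\eta(t,x,u)$ of three independent variables (the determining equation for reduction operators $\partial_x+\eta\partial_u$ of $\mathcal L$): $$\eta_t=A(\eta_{xx}+2\eta\eta_{xu}+\eta^2\eta_{uu})+A_x(\eta_x+\eta\eta_u)+(B\eta)_x+C(\eta-u\eta_u)+C_xu.$$ The class of these equations is obtained as $\mathcal L$ varies; $\mathcal L\mapsto{\rm DE}_0(\mathcal L)$ is one-to-one. An admissible transformation in a class is a triple consisting of an initial equation, a target equation of the class, and a point transformation (invertible change of all independent and dependent variables, with nonvanishing Jacobian) mapping the former to the latter. For the class of equations $\mathcal L$, it is known that a point transformation of $(t,x,u)$ connects two equations of the class iff it has the form $\tilde t=T(t)$, $\tilde x=X(t,x)$, $\tilde u=U^1(t,x)u+U^0(t,x)$ with $T_tX_xU^1\neq0$ and $U^0/U^1$ a solution of the initial equation; the arbitrary elements are then transformed by $$\tilde A=\frac{X_x^2}{T_t}A,\quad \tilde B=\frac{X_x}{T_t}\Bigl(B-2\frac{U^1_x}{U^1}A\Bigr)-\frac{X_t-AX_{xx}}{T_t},\quad \tilde C=-\frac{U^1}{T_t}L\frac1{U^1},$$ where $L=\partial_t-A\partial_{xx}-B\partial_x-C$. *)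

(* Defs.v *)
From HB Require Import structures.
From mathcomp Require Import all_boot all_order all_algebra.
From mathcomp Require Import all_classical all_reals all_analysis.

Set Implicit Arguments.
Unset Strict Implicit.
Unset Printing Implicit Defensive.

Import Order.TTheory GRing.Theory Num.Theory.
Import numFieldNormedType.Exports.

Local Open Scope classical_set_scope.
Local Open Scope ring_scope.

Section Calculus.
Context {R : realType}.

Definition pd {n} (i : 'I_n) (f : 'rV[R]_n -> R) : 'rV[R]_n -> R :=
  fun z => 'D_(delta_mx 0 i) f z.

(* The partial sum, over the multi-indices with all entries < N, of the power
   series with coefficients c. *)
Definition mpsum {n} (c : {ffun 'I_n -> nat} -> R) (h : 'rV[R]_n) (N : nat) : R :=
  \sum_(m : {ffun 'I_n -> 'I_N})
    c [ffun i => nat_of_ord (m i)] * \prod_(i < n) h 0 i ^+ m i.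

(* f is the sum of an absolutely convergent power series on a cube around a;
   `|h| is the sup norm. *)
Definition analytic_at {n} (f : 'rV[R]_n -> R) (a : 'rV[R]_n) : Prop :=
  exists c (r : R),
    [/\ 0 < r,
        cvgn (mpsum (fun m => `|c m|) (const_mx r)) &
        forall h : 'rV[R]_n, `|h| < r -> mpsum c h @ \oo --> f (a + h)].

Definition analytic_near {n} (f : 'rV[R]_n -> R) (a : 'rV[R]_n) : Prop :=
  \forall z \near a, analytic_at f z.

End Calculus.

(* For one dependent variable w depending on z = (z_0, ..., z_(n-1)), a point
   of the space of variables is a row of length n.+1 whose last entry is w. *)
Section Rows.
Context {R : realType}.

Definition base {n} (y : 'rV[R]_n.+1) : 'rV[R]_n :=
  \row_i y 0 (lift ord_max i).

Definition fiber {n} (y : 'rV[R]_n.+1) : R := y 0 ord_max.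

Definition adjoin {n} (z : 'rV[R]_n) (w : R) : 'rV[R]_n.+1 :=
  \row_i if unlift ord_max i is Some k then z 0 k else w.

End Rows.

Section Jets.
Context {R : realType}.

(* A second-order jet of w = w(z): the point (z, w), the first-order
   derivatives w_i and the (symmetric) matrix of derivatives w_ik. *)
Record jet (n : nat) := Jet {
  jpt : 'rV[R]_n.+1;
  jd1 : 'rV[R]_n;
  jd2 : 'M[R]_n;
  _   : jd2^T = jd2 }.

(* A second-order differential equation is a subset of the jet space. *)
Definition diffeq (n : nat) := set (jet n).

Definition tder1 {n} (f : 'rV[R]_n.+1 -> R) (j : jet n) (i : 'I_n) : R :=
  pd (lift ord_max i) f (jpt j) + jd1 j 0 i * pd ord_max f (jpt j).

(* The second-order total derivative D_k D_i f. *)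
Definition tder2 {n} (f : 'rV[R]_n.+1 -> R) (j : jet n) (i k : 'I_n) : R :=
  let y := jpt j in
  let d i := pd (lift ord_max i) in
  let dw := pd ord_max in
  d k (d i f) y + jd1 j 0 k * dw (d i f) y + jd1 j 0 i * d k (dw f) y
  + jd1 j 0 i * jd1 j 0 k * dw (dw f) y + jd2 j i k * dw f y.

(* The second prolongation of phi maps j to j'.  The last two conditions are
   the chain rule for the identity  w'(z'(z, w(z))) = phi^w(z, w(z)),
   differentiated once and twice; the determinant condition says that the
   image of a graph with jet j is locally the graph of a function of z'. *)
Definition prolong {n} (phi : 'rV[R]_n.+1 -> 'rV[R]_n.+1) (j j' : jet n) : Prop :=
  let zeta (k : 'I_n) := fun y => phi y 0 (lift ord_max k) in
  let omega := fun y => phi y 0 ord_max in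
  [/\ jpt j' = phi (jpt j),
      \det (\matrix_(i, k) tder1 (zeta k) j i) != 0,
      forall i, tder1 omega j i = \sum_k jd1 j' 0 k * tder1 (zeta k) j i &
      forall i l, tder2 omega j i l =
        \sum_k jd1 j' 0 k * tder2 (zeta k) j i l
        + \sum_k \sum_m jd2 j' k m * tder1 (zeta k) j i * tder1 (zeta m) j l].

(* phi, considered locally at y0, maps the equation E to the equation E'. *)
Definition maps_diffeq {n} (phi : 'rV[R]_n.+1 -> 'rV[R]_n.+1)
    (y0 : 'rV[R]_n.+1) (E E' : diffeq n) : Prop :=
  \forall y \near y0, forall j j' : jet n,
    jpt j = y -> prolong phi j j' -> (E j <-> E' j').

(* Nondegeneracy at y0 means local invertibility. *)
Definition point_transformation {n} (phi : 'rV[R]_n.+1 -> 'rV[R]_n.+1)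
    (y0 : 'rV[R]_n.+1) : Prop :=
  (forall i, analytic_near (fun y => phi y 0 i) y0) /\ \det ('J phi y0) != 0.

(* A germ is represented by the set of all its representatives. *)
Definition map_germ {n} (y0 : 'rV[R]_n.+1) (phi : 'rV[R]_n.+1 -> 'rV[R]_n.+1)
    : set ('rV[R]_n.+1 -> 'rV[R]_n.+1) :=
  [set psi | \forall y \near y0, psi y = phi y].

Definition diffeq_germ {n} (y0 : 'rV[R]_n.+1) (E : diffeq n) : set (diffeq n) :=
  [set E' | \forall y \near y0, forall j, jpt j = y -> (E' j <-> E j)].

End Jets.
Arguments jet R n : clear implicits.
Arguments diffeq R n : clear implicits.

(* The independent variables are (t, x), with indices 0 and 1. *)
Record coefs (R : realType) := Coefs {
  cA : 'rV[R]_2 -> R;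
  cB : 'rV[R]_2 -> R;
  cC : 'rV[R]_2 -> R }.

Section Equations.
Context {R : realType}.

Definition admissible_coefs (th : coefs R) (p : 'rV[R]_2) : Prop :=
  [/\ analytic_near (cA th) p, analytic_near (cB th) p,
      analytic_near (cC th) p & cA th p != 0].

(* u_t = A u_xx + B u_x + C u, for u = u(t, x). *)
Definition eqL (th : coefs R) : diffeq R 2 := [set j |
  let p := base (jpt j) in let u := fiber (jpt j) in
  jd1 j 0 0 = cA th p * jd2 j 1 1 + cB th p * jd1 j 0 1 + cC th p * u].

(* The determining equation for eta = eta(t, x, u); the independent variables
   (t, x, u) have indices 0, 1 and ord_max. *)
Definition eqDE0 (th : coefs R) : diffeq R 3 := [set j |
  let z := base (jpt j) in let eta := fiber (jpt j) in
  let p := base z in let u := fiber z in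
  let eta_t := jd1 j 0 0 in
  let eta_x := jd1 j 0 1 in
  let eta_u := jd1 j 0 ord_max in
  let eta_xx := jd2 j 1 1 in
  let eta_xu := jd2 j 1 ord_max in
  let eta_uu := jd2 j ord_max ord_max in
  let A := cA th in let B := cB th in let C := cC th in
  eta_t = A p * (eta_xx + 2 * eta * eta_xu + eta ^+ 2 * eta_uu)
          + pd 1 A p * (eta_x + eta * eta_u)
          + (pd 1 B p * eta + B p * eta_x)
          + C p * (eta - u * eta_u)
          + pd 1 C p * u].

End Equations.

(* Germs of admissible transformations at y0 in a class of equations th |-> E th;
   tx extracts (t, x) from a point of the space of variables. *)
Section Admissible.
Context {R : realType} {n : nat}.
Variables (tx : 'rV[R]_n.+1 -> 'rV[R]_2) (E : coefs R -> diffeq R n).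

Definition connects (y0 : 'rV[R]_n.+1) (th th' : coefs R)
    (phi : 'rV[R]_n.+1 -> 'rV[R]_n.+1) : Prop :=
  [/\ admissible_coefs th (tx y0), admissible_coefs th' (tx (phi y0)),
      point_transformation phi y0 & maps_diffeq phi y0 (E th) (E th')].

(* The triple (initial equation, target equation, transformation). *)
Definition triple (y0 : 'rV[R]_n.+1) (th th' : coefs R)
    (phi : 'rV[R]_n.+1 -> 'rV[R]_n.+1) :=
  (diffeq_germ y0 (E th), diffeq_germ (phi y0) (E th'), map_germ y0 phi).

Definition admissible (y0 : 'rV[R]_n.+1) :
    set (set (diffeq R n) * set (diffeq R n) * set ('rV[R]_n.+1 -> 'rV[R]_n.+1)) :=
  [set s | exists th th' phi, connects y0 th th' phi /\ s = triple y0 th th' phi].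

End Admissible.

Section Classes.
Context {R : realType}.

Definition connectsL := connects (@base R 2) eqL.
Definition tripleL := triple (@eqL R).
Definition admissibleL := admissible (@base R 2) eqL.

Definition connectsDE0 := connects (@base R 2 \o @base R 3) eqDE0.
Definition tripleDE0 := triple (@eqDE0 R).
Definition admissibleDE0 := admissible (@base R 2 \o @base R 3) eqDE0.

Definition trL (T : R -> R) (X U1 U0 : 'rV[R]_2 -> R)
    : 'rV[R]_3 -> 'rV[R]_3 := fun y =>
  let p := base y in
  adjoin (\row_(i < 2) [:: T (p 0 0); X p]`_i) (U1 p * fiber y + U0 p).

Definition trDE0 (T : R -> R) (X U1 U0 : 'rV[R]_2 -> R)
    : 'rV[R]_4 -> 'rV[R]_4 := fun y =>
  let z := base y in let p := base z in
  adjoin (trL T X U1 U0 z)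
    (U1 p / pd 1 X p * fiber y + pd 1 U1 p / pd 1 X p * fiber z
     + pd 1 U0 p / pd 1 X p).

(* T, X, U1, U0 are germs of analytic functions at p with T_t X_x U1 <> 0. *)
Definition tr_params (T : R -> R) (X U1 U0 : 'rV[R]_2 -> R)
    (p : 'rV[R]_2) : Prop :=
  [/\ analytic_near (fun s : 'rV[R]_1 => T (s 0 0)) (const_mx (p 0 0)),
      analytic_near X p, analytic_near U1 p, analytic_near U0 p &
      (T^`())%classic (p 0 0) * pd 1 X p * U1 p != 0].

End Classes.

(* Main.v *)
(** The second prolongation of a transformation acts on second-order jets, and
   both classes consist of quasilinear equations solved for the time derivative
   whose principal part is a rank-one quadratic form: [u_xx], respectively
   [eta_xx + 2 eta eta_xu + eta^2 eta_uu].  Comparing the coefficients of the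
   second derivatives shows that a transformation between two equations
   preserves the corresponding directions [d/dx] and [d/dx + eta d/du].  For
   DE_0 this forces [T] to depend on [t] alone, since the direction annihilates
   [T] at every value of [eta].  The jets over one point differing only in their
   time derivative then give [A (D_x X)^2 = T_t A'], and as the right-hand side
   does not depend on the quantities on which [D_x X] depends affinely, [X]
   depends on [(t, x)] only.  The new [u] is independent of [eta], by the
   contact condition [D_x U = X_x eta'], which also determines the new [eta].
   Finally the part of the equation linear in [eta_x] yields [U_uu = 0].

   For transformations of this form, equating the coefficients of the free jet
   coordinates gives the same rules for A, B, C in both classes; for DE_0 one
   also needs their x-derivatives.  Two equations, or two transformations of the
   stated form, have equal germs in one class iff they have in the other, which
   makes the extension well defined and injective on triples of germs. *)

(* In matrix form the prolongation relates second-order parts by a congruence [N + L q = Z q' Z^T]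
   with [L != 0], so the second-order part of an image jet can be prescribed. This eliminates second
   derivatives of the unknown: what remains is [par_cond], a condition on first-order parts only. It
   is available where [\det Z != 0], in general only on an open set of slopes, so coefficients are
   compared by finite differences over two or three nearby points instead of as polynomials.

   The two classes meet in [formulas], the rules for the coefficients with denominators cleared. The
   delicate direction starts from DE_0, whose condition at a point mixes the coefficients with their
   x-derivatives: the rule for [A] must hold on a neighbourhood and be differentiated before the
   rules for [B] and [C] can be extracted. This is why admissibility is shown to be open in the base
   point.

   A triple of germs has no distinguished representatives, so the bijection is obtained by choice.
   The power series at the beginning supply closure under reciprocals and derivatives, and the
   symmetry of mixed derivatives. *)
Require Import Defs.
From HB Require Import structures.
From mathcomp Require Import all_boot all_order all_algebra.
From mathcomp Require Import all_classical all_reals all_analysis.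
From mathcomp Require Import ring lra zify.
Import Order.TTheory GRing.Theory Num.Theory.
Import numFieldNormedType.Exports.
Local Open Scope classical_set_scope.
Local Open Scope ring_scope.

Set Implicit Arguments.
Unset Strict Implicit.
Unset Printing Implicit Defensive.

(** * Convergent power series *)

Section MultiIndex.
Context {R : realType} {n : nat}.
Notation mi := {ffun 'I_n -> nat}.
Implicit Types (m k l : mi) (N : nat) (h : 'rV[R]_n) (u c : mi -> R).

(** A duplicate-free list rather than a finite type, so that boxes of different sizes and other
    finite families of multi-indices can be compared. *)
Definition box N : seq mi :=
  [seq [ffun i => nat_of_ord (m i)] | m : {ffun 'I_n -> 'I_N}].

Lemma box_uniq N : uniq (box N).
Proof.
rewrite map_inj_uniq ?enum_uniq // => m1 m2 /ffunP e.
by apply/ffunP => i; apply: val_inj; have := e i; rewrite !ffunE.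
Qed.

Lemma mem_box N m : (m \in box N) = [forall i, (m i < N)%N].
Proof.
apply/mapP/forallP => [[m' _ ->] i | H]; first by rewrite ffunE ltn_ord.
exists [ffun i => Ordinal (H i)]; first by rewrite mem_enum.
by apply/ffunP => i; rewrite !ffunE.
Qed.

Lemma box_sub N1 N2 : (N1 <= N2)%N -> {subset box N1 <= box N2}.
Proof.
move=> le12 m; rewrite !mem_box => /forallP H; apply/forallP => i.
exact: leq_trans (H i) le12.
Qed.

Definition mon h m : R := \prod_(i < n) h 0 i ^+ m i.

Lemma mpsumE c h N : mpsum c h N = \sum_(m <- box N) c m * mon h m.
Proof.
rewrite /mpsum /box big_map big_enum /=; apply: eq_bigr => m _.
by congr (_ * _); apply: eq_bigr => i _; rewrite ffunE.
Qed.

Definition deg m : nat := (\sum_(i < n) m i)%N.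

Lemma mi_le_deg m i : (m i <= deg m)%N.
Proof. by rewrite /deg (bigD1 i) //= leq_addr. Qed.

Lemma mem_box_deg m N : (deg m < N)%N -> m \in box N.
Proof.
move=> ltmN; rewrite mem_box; apply/forallP => i.
exact: leq_ltn_trans (mi_le_deg m i) ltmN.
Qed.

Lemma sub_box (s : seq mi) : exists N, {subset s <= box N}.
Proof.
elim: s => [|m s [N sN]]; first by exists 0%N.
exists (maxn N (deg m).+1) => k; rewrite inE => /orP[/eqP->|/sN].
  by apply: mem_box_deg; rewrite leq_maxr.
by apply: box_sub; rewrite leq_maxl.
Qed.

Lemma mon_const (r : R) m : mon (const_mx r) m = r ^+ deg m.
Proof.
rewrite /mon /deg; elim/big_rec2: _ => [|i x y _ ->]; first by rewrite expr0.
by rewrite mxE exprD.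
Qed.

Lemma normr_mon h m : `|mon h m| = \prod_(i < n) `|h 0 i| ^+ m i.
Proof. by rewrite /mon normr_prod; apply: eq_bigr => i _; rewrite normrX. Qed.

Lemma mx_norm_coord h i : `|h 0 i| <= `|h|.
Proof.
by rewrite /Num.norm/= mx_normrE; exact: (le_bigmax _ (fun ij => `|h ij.1 ij.2|) (0, i)).
Qed.

Lemma rV_norm_lt h (r : R) : 0 < r -> (forall i, `|h 0 i| < r) -> `|h| < r.
Proof.
move=> r0 hr; rewrite /Num.norm/= mx_normrE; apply: bigmax_lt => // -[i j] _ /=.
by rewrite (ord1 i).
Qed.

Lemma mon_le h m (r : R) : `|h| <= r -> `|mon h m| <= r ^+ deg m.
Proof.
move=> hr; rewrite normr_mon -mon_const /mon; apply: ler_prod => i _.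
rewrite exprn_ge0 //= mxE lerXn2r ?nnegrE //.
- exact: le_trans (normr_ge0 _) hr.
- exact: le_trans (mx_norm_coord h i) hr.
Qed.

Lemma big_uniq_sub (s t : seq mi) u : uniq s -> uniq t -> {subset s <= t} ->
  \sum_(m <- t) u m = \sum_(m <- s) u m + \sum_(m <- t | m \notin s) u m.
Proof.
move=> us ut st; rewrite (bigID (mem s)) /=; congr (_ + _).
rewrite -big_filter; apply: perm_big; apply: uniq_perm => //.
  exact: filter_uniq.
by move=> m; rewrite mem_filter andb_idr // => /st.
Qed.

Lemma ler_sum_sub (s t : seq mi) u : (forall m, 0 <= u m) ->
  uniq s -> uniq t -> {subset s <= t} ->
  \sum_(m <- s) u m <= \sum_(m <- t) u m.
Proof.
by move=> u0 us ut st; rewrite (big_uniq_sub u us ut st) lerDl sumr_ge0.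
Qed.

(** For nonnegative terms this is equivalent to convergence, and it passes to subfamilies and
    smaller terms without any limit. *)
Definition sum_bounded u (M : R) := forall N, \sum_(m <- box N) u m <= M.

Lemma sum_bounded_seq u M (s : seq mi) : (forall m, 0 <= u m) ->
  sum_bounded u M -> uniq s -> \sum_(m <- s) u m <= M.
Proof.
move=> u0 uM us; have [N sN] := sub_box s.
exact: le_trans (ler_sum_sub u0 us (box_uniq N) sN) (uM N).
Qed.

Lemma sum_boundedW u v M : (forall m, u m <= v m) -> sum_bounded v M -> sum_bounded u M.
Proof. by move=> uv vM N; apply: le_trans (vM N); apply: ler_sum. Qed.

Lemma box_sum_mono u : (forall m, 0 <= u m) ->
  {homo (fun N => \sum_(m <- box N) u m) : i j / (i <= j)%N >-> i <= j}.
Proof.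
by move=> u0 i j ij; apply: ler_sum_sub; rewrite ?box_uniq //; apply: box_sub.
Qed.

Lemma sum_bounded_cvg u M : (forall m, 0 <= u m) -> sum_bounded u M ->
  cvgn (fun N => \sum_(m <- box N) u m).
Proof.
move=> u0 uM; apply: nondecreasing_is_cvgn; first exact: box_sum_mono.
by exists M => _ [N _ <-].
Qed.

Lemma cvg_sum_bounded u : (forall m, 0 <= u m) ->
  cvgn (fun N => \sum_(m <- box N) u m) -> exists M, sum_bounded u M.
Proof.
move=> u0 uc; exists (limn (fun N => \sum_(m <- box N) u m)) => N.
exact: nondecreasing_cvgn_le (box_sum_mono u0) uc N.
Qed.

(** A finite family disjoint from [box K] fits, together with [box K], into a larger box, so its sum
    is bounded by the distance of the K-th partial sum from the limit. *)
Lemma sum_tail u M (e : R) : (forall m, 0 <= u m) -> sum_bounded u M -> 0 < e ->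
  exists K, forall s : seq mi, uniq s -> {in s, forall m, m \notin box K} ->
    \sum_(m <- s) u m < e.
Proof.
move=> u0 uM e0; pose T N := \sum_(m <- box N) u m.
have Tc : cvgn T := sum_bounded_cvg u0 uM.
have /cvgrPdist_lt /(_ _ e0) [K _ HK] := Tc.
exists K => s us sK; have [N sN] := sub_box s.
have NK : (K <= maxn N K)%N by rewrite leq_maxr.
have bd : T K + \sum_(m <- s) u m <= T (maxn N K).
  rewrite /T -big_cat; apply: ler_sum_sub; rewrite ?box_uniq //.
    rewrite cat_uniq box_uniq us /= andbT; apply/hasPn => m /sK; exact.
  move=> m; rewrite mem_cat => /orP[|/sN]; apply: box_sub => //.
  by rewrite leq_maxl.
have := nondecreasing_cvgn_le (box_sum_mono u0) Tc (maxn N K).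
have /= := HK K (leqnn K); rewrite -/(T _) ltr_norml => /andP[_].
by move: bd; rewrite /T; lra.
Qed.

(** What lies outside a large box is small in absolute value, so any exhausting sequence of finite
    sets gives the same sum. Termwise differentiation shifts multi-indices, and its partial sums do
    not run over boxes. *)
Lemma cvg_exhaust u M (l : R) (s : nat -> seq mi) :
  sum_bounded (fun m => `|u m|) M ->
  (fun N => \sum_(m <- box N) u m) @ \oo --> l ->
  (forall N, uniq (s N)) ->
  (forall K, \forall N \near \oo, {subset box K <= s N}) ->
  (fun N => \sum_(m <- s N) u m) @ \oo --> l.
Proof.
move=> uM ul us sK; apply/cvgrPdist_lt => e e0.
have [K HK] := sum_tail (fun m => normr_ge0 (u m)) uM (divr_gt0 e0 (ltr0n R 2)).
move/cvgrPdist_lt: ul => /(_ _ (divr_gt0 e0 (ltr0n R 2))) [N0 _ HN0].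
pose K' := maxn K N0.
near=> N.
have sub : {subset box K' <= s N} by near: N; exact: sK.
rewrite (big_uniq_sub u (box_uniq K') (us N) sub) opprD addrA.
have h1 : `|l - \sum_(m <- box K') u m| < e / 2 by apply: HN0; rewrite /= leq_maxr.
have h2 : `|\sum_(m <- s N | m \notin box K') u m| < e / 2.
  apply: le_lt_trans (ler_norm_sum _ _ _) _; rewrite -big_filter; apply: HK.
    exact: filter_uniq.
  move=> m; rewrite mem_filter => /andP[mK _]; apply: contra mK.
  by apply: box_sub; rewrite leq_maxl.
by apply: le_lt_trans (ler_normB _ _) _; lra.
Unshelve. all: by end_near. Qed.

(** Write [u] as [(u + |u|) - |u|], a difference of two nonnegative families with bounded sums. *)
Lemma sum_abs_cvg u M : sum_bounded (fun m => `|u m|) M ->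
  cvgn (fun N => \sum_(m <- box N) u m).
Proof.
move=> uM; have c1 := sum_bounded_cvg (fun m => normr_ge0 (u m)) uM.
have c2 : cvgn (fun N => \sum_(m <- box N) (u m + `|u m|)).
  apply: (@sum_bounded_cvg _ (M + M)) => [m|N].
    by rewrite -lerBlDr sub0r lerNl -normrN ler_norm.
  rewrite big_split; apply: lerD; last exact: uM.
  by apply: le_trans (uM N); apply: ler_sum => m _; exact: ler_norm.
have -> : (fun N => \sum_(m <- box N) u m) =
  (fun N => \sum_(m <- box N) (u m + `|u m|)) \- (fun N => \sum_(m <- box N) `|u m|).
  by apply/funext => N /=; rewrite big_split /= addrK.
exact: is_cvgB.
Qed.

End MultiIndex.

(** * Analyticity through weighted sums of coefficients *)

Section PowerSeries.
Context {R : realType} {n : nat}.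
Notation mi := {ffun 'I_n -> nat}.
Implicit Types (m k l : mi) (N : nat) (h a : 'rV[R]_n) (c d : mi -> R)
  (f g : 'rV[R]_n -> R) (r M : R).

(** A bound for the weighted l^1 norm of the coefficients at radius [r]. This norm is
    submultiplicative for the Cauchy product, which is what products and reciprocals rely on. *)
Definition norm_bounded c r M := sum_bounded (fun m => `|c m| * r ^+ deg m) M.

Lemma norm_boundedW c r r' M : 0 <= r' -> r' <= r ->
  norm_bounded c r M -> norm_bounded c r' M.
Proof.
move=> r0 rr; apply: sum_boundedW => m; apply: ler_wpM2l => //.
by rewrite lerXn2r // nnegrE // (le_trans r0).
Qed.

Lemma norm_bounded_mon c r M h : `|h| <= r -> norm_bounded c r M ->
  sum_bounded (fun m => `|c m * mon h m|) M.
Proof.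
move=> hr; apply: sum_boundedW => m; rewrite normrM; apply: ler_wpM2l => //.
exact: mon_le.
Qed.

Lemma mpsum_const_norm c r : 0 <= r ->
  mpsum (fun m => `|c m|) (const_mx r) = fun N => \sum_(m <- box N) `|c m| * r ^+ deg m.
Proof.
by move=> r0; apply/funext => N; rewrite mpsumE; under eq_bigr do rewrite mon_const.
Qed.

Lemma analytic_atP f a : analytic_at f a <-> exists c r M,
  [/\ 0 < r, norm_bounded c r M &
      forall h, `|h| < r -> mpsum c h @ \oo --> f (a + h)].
Proof.
split=> [[c [r [r0 cc H]]]|[c [r [M [r0 cM H]]]]].
  rewrite mpsum_const_norm ?ltW // in cc.
  have [|M cM] := cvg_sum_bounded _ cc; first by move=> m; rewrite mulr_ge0 // exprn_ge0 // ltW.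
  by exists c, r, M.
exists c, r; split => //; rewrite mpsum_const_norm ?ltW //.
by apply: sum_bounded_cvg cM => m; rewrite mulr_ge0 // exprn_ge0 // ltW.
Qed.

Lemma analytic_at_supp c (s : seq mi) f a : uniq s ->
  (forall m, m \notin s -> c m = 0) ->
  (forall h, f (a + h) = \sum_(m <- s) c m * mon h m) -> analytic_at f a.
Proof.
move=> us cs fE; have [K sK] := sub_box s.
have E v N : (K <= N)%N -> (forall m, m \notin s -> v m = 0) ->
    \sum_(m <- box N) v m = \sum_(m <- s) v m :> R.
  move=> KN v0; rewrite (big_uniq_sub v us (box_uniq N)).
    by rewrite [X in _ + X]big1 ?addr0 // => m /v0 ->.
  by move=> m /sK; apply: box_sub.
apply/analytic_atP; exists c, 1, (\sum_(m <- s) `|c m| * 1 ^+ deg m); split => //.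
  move=> N; rewrite -(@E _ (maxn N K)) ?leq_maxr //.
    by apply: box_sum_mono; rewrite ?leq_maxl // => m; rewrite mulr_ge0 // exprn_ge0.
  by move=> m /cs ->; rewrite normr0 mul0r.
move=> h _; rewrite fE; apply: cvg_near_cst.
exists K => // N /= KN; rewrite mpsumE E // => m /cs ->; by rewrite mul0r.
Qed.

Definition mi0 : mi := [ffun=> 0%N].
Definition mi1 (i : 'I_n) : mi := [ffun j => nat_of_bool (j == i)].

Lemma mi1_neq0 i : mi1 i != mi0.
Proof. by apply/eqP => /ffunP/(_ i); rewrite !ffunE eqxx. Qed.

Lemma mon0 h : mon h mi0 = 1.
Proof. by rewrite /mon big1 // => i _; rewrite ffunE. Qed.

Lemma mon1 h i : mon h (mi1 i) = h 0 i.
Proof.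
rewrite /mon (bigD1 i) //= ffunE eqxx expr1 big1 ?mulr1 // => j /negPf ji.
by rewrite ffunE ji.
Qed.

Lemma analytic_cst (x : R) a : analytic_at (fun=> x) a.
Proof.
apply: (@analytic_at_supp (fun m => if m == mi0 then x else 0) [:: mi0]) => //.
  by move=> m; rewrite inE => /negPf ->.
by move=> h; rewrite big_seq1 eqxx mon0 mulr1.
Qed.

Lemma analytic_coord i a : analytic_at (fun z => z 0 i) a.
Proof.
apply: (@analytic_at_supp (fun m => if m == mi0 then a 0 i else (m == mi1 i)%:R) [:: mi0; mi1 i]).
- by rewrite /= inE eq_sym mi1_neq0.
- by move=> m; rewrite !inE negb_or => /andP[/negPf -> /negPf ->].
move=> h; rewrite big_cons big_seq1 eqxx (negPf (mi1_neq0 i)) eqxx mon0 mon1.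
by rewrite mxE mulr1 mul1r.
Qed.

Lemma analytic_add f g a : analytic_at f a -> analytic_at g a ->
  analytic_at (fun z => f z + g z) a.
Proof.
move=> /analytic_atP[c [r [M [r0 cM H]]]] /analytic_atP[d [r' [M' [r0' dM H']]]].
apply/analytic_atP; exists (fun m => c m + d m), (Num.min r r'), (M + M').
have m0 : 0 <= Num.min r r' by rewrite le_min !ltW.
split; first by rewrite lt_min r0.
  have cM1 : norm_bounded c (Num.min r r') M.
    by apply: norm_boundedW cM => //; rewrite ge_min lexx.
  have dM1 : norm_bounded d (Num.min r r') M'.
    by apply: norm_boundedW dM => //; rewrite ge_min lexx orbT.
  move=> N; apply: le_trans (lerD (cM1 N) (dM1 N)); rewrite -big_split /=.
  apply: ler_sum => m _; rewrite -mulrDl ler_wpM2r ?exprn_ge0 //.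
  exact: ler_normD.
move=> h; rewrite lt_min => /andP[hr hr'].
rewrite (_ : mpsum _ h = mpsum c h \+ mpsum d h); first exact: cvgD (H h hr) (H' h hr').
apply/funext => N /=; rewrite !mpsumE -big_split /=.
by apply: eq_bigr => m _; rewrite mulrDl.
Qed.

Lemma analytic_scale (x : R) f a : analytic_at f a -> analytic_at (fun z => x * f z) a.
Proof.
move=> /analytic_atP[c [r [M [r0 cM H]]]].
apply/analytic_atP; exists (fun m => x * c m), r, (`|x| * M); split => //.
  move=> N; apply: le_trans (ler_wpM2l (normr_ge0 x) (cM N)).
  by rewrite mulr_sumr; apply: ler_sum => m _; rewrite normrM mulrA.
move=> h hr; rewrite (_ : mpsum _ h = (fun N => x * mpsum c h N)).
  exact: cvgM (cvg_cst x) (H h hr).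
apply/funext => N; rewrite !mpsumE mulr_sumr.
by apply: eq_bigr => m _; rewrite mulrA.
Qed.

Definition madd k l : mi := [ffun i => (k i + l i)%N].
Definition msub k l : mi := [ffun i => (k i - l i)%N].
Definition mle k l := [forall i, (k i <= l i)%N].

Lemma maddK k l : msub (madd k l) k = l.
Proof. by apply/ffunP => i; rewrite !ffunE addKn. Qed.

Lemma msubK k m : mle k m -> madd k (msub m k) = m.
Proof. by move=> /forallP H; apply/ffunP => i; rewrite !ffunE subnKC. Qed.

Lemma mle_addr k l : mle k (madd k l).
Proof. by apply/forallP => i; rewrite ffunE leq_addr. Qed.

Lemma madd_inj k : injective (madd k).
Proof. by move=> l l' /(congr1 (msub^~ k)); rewrite !maddK. Qed.

Lemma deg_madd k l : deg (madd k l) = (deg k + deg l)%N.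
Proof. by rewrite /deg -big_split; apply: eq_bigr => i _; rewrite ffunE. Qed.

Lemma mon_madd h k l : mon h (madd k l) = mon h k * mon h l.
Proof.
by rewrite /mon -big_split; apply: eq_bigr => i _; rewrite ffunE exprD.
Qed.

Lemma box_down k m N : mle k m -> m \in box N -> k \in box N.
Proof.
move=> /forallP km; rewrite !mem_box => /forallP mN; apply/forallP => i.
exact: leq_ltn_trans (km i) (mN i).
Qed.

(** Every box containing [m] contains all [k <= m] and gives the same sum; the box of side
    [deg m + 1] is one that depends on [m] alone. *)
Definition cauchy c d m : R :=
  \sum_(k <- box (deg m).+1 | mle k m) c k * d (msub m k).

Lemma cauchyE c d m N : m \in box N ->
  cauchy c d m = \sum_(k <- box N | mle k m) c k * d (msub m k).
Proof.
move=> mN; rewrite /cauchy -big_filter -[RHS]big_filter; apply: perm_big.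
apply: uniq_perm; rewrite ?filter_uniq ?box_uniq // => k.
rewrite !mem_filter; case: (boolP (mle k m)) => //= km.
by rewrite (box_down km mN) (box_down km) // mem_box_deg.
Qed.

(** Substitute [m = k + l]. The weight [v] is [mon h] when values are multiplied and [r ^+ deg] when
    norms are estimated. *)
Lemma sum_cauchy c d N (v : mi -> R) :
  (forall k l, v (madd k l) = v k * v l) ->
  \sum_(m <- box N) cauchy c d m * v m =
  \sum_(k <- box N) \sum_(l <- box N | madd k l \in box N) (c k * v k) * (d l * v l).
Proof.
move=> vM.
transitivity (\sum_(m <- box N) \sum_(k <- box N | mle k m)
   (c k * v k) * (d (msub m k) * v (msub m k))).
  rewrite big_seq [RHS]big_seq; apply: eq_bigr => m mN.
  rewrite (cauchyE _ _ mN) mulr_suml; apply: eq_bigr => k km.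
  by rewrite -{2}(msubK km) vM; ring.
rewrite (exchange_big_dep xpredT) //=; apply: eq_bigr => k _.
rewrite -big_filter -[RHS]big_filter.
transitivity (\sum_(m <- [seq madd k l | l <- box N & madd k l \in box N])
   c k * v k * (d (msub m k) * v (msub m k))); last first.
  by rewrite big_map; apply: eq_bigr => l _; rewrite maddK.
apply: perm_big; apply: uniq_perm.
- by rewrite filter_uniq ?box_uniq.
- by rewrite map_inj_uniq ?filter_uniq ?box_uniq //; exact: madd_inj.
move=> m; rewrite mem_filter; apply/andP/mapP => [[km mN]|[l]].
  exists (msub m k); rewrite ?msubK // mem_filter msubK // mN /=.
  by apply: box_down mN; apply/forallP => i; rewrite ffunE leq_subr.
by rewrite mem_filter => /andP[klN _] ->; rewrite klN mle_addr.
Qed.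
End PowerSeries.

(** * Products and reciprocals of power series *)

Section Products.
Context {R : realType} {n : nat}.
Notation mi := {ffun 'I_n -> nat}.
Implicit Types (m k l : mi) (N : nat) (h a : 'rV[R]_n) (c d : mi -> R)
  (f g : 'rV[R]_n -> R) (r M : R).

Lemma norm_bounded_cauchy c d r M M' : 0 <= r -> 0 <= M ->
  norm_bounded c r M -> norm_bounded d r M' -> norm_bounded (cauchy c d) r (M * M').
Proof.
move=> r0 M0 cM dM N.
have re m : 0 <= r ^+ deg m by rewrite exprn_ge0.
have le1 : \sum_(m <- box N) `|cauchy c d m| * r ^+ deg m <=
    \sum_(m <- box N) cauchy (fun m => `|c m|) (fun m => `|d m|) m * r ^+ deg m.
  apply: ler_sum => m _; rewrite ler_wpM2r //.
  apply: le_trans (ler_norm_sum _ _ _) _.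
  by apply: ler_sum => k _; rewrite normrM.
apply: le_trans le1 _; rewrite sum_cauchy; last by move=> k l; rewrite deg_madd exprD.
apply: (@le_trans _ _ ((\sum_(k <- box N) `|c k| * r ^+ deg k) * \sum_(l <- box N) `|d l| * r ^+ deg l)).
  rewrite mulr_suml; apply: ler_sum => k _; rewrite -mulr_sumr.
  apply: ler_wpM2l; first by rewrite mulr_ge0.
  rewrite -big_filter; apply: ler_sum_sub; rewrite ?filter_uniq ?box_uniq //.
    by move=> m; rewrite mulr_ge0.
  by move=> m; rewrite mem_filter => /andP[].
apply: ler_pM (cM N) (dM N); by apply: sumr_ge0 => m _; rewrite mulr_ge0.
Qed.

Lemma box_madd k l N : k \in box N./2 -> l \in box N./2 -> madd k l \in box N.
Proof.
rewrite !mem_box => /forallP kN /forallP lN; apply/forallP => i; rewrite ffunE.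
by have := kN i; have := lN i; lia.
Qed.

(** The product of partial sums differs from the partial sum of the product by the pairs with
    [k + l] outside the box. None of them lies in the square of the box of half size, so the
    difference is dominated by [tu N * tv N - tu N./2 * tv N./2], which tends to 0. *)
Lemma mpsum_cauchy c d r M M' h (x y : R) : `|h| <= r ->
  norm_bounded c r M -> norm_bounded d r M' ->
  mpsum c h @ \oo --> x -> mpsum d h @ \oo --> y ->
  mpsum (cauchy c d) h @ \oo --> x * y.
Proof.
move=> hr cM dM cx dy.
pose u m := c m * mon h m; pose v m := d m * mon h m.
pose tu N := \sum_(m <- box N) `|u m|; pose tv N := \sum_(m <- box N) `|v m|.
have cu : cvgn tu by apply: sum_bounded_cvg (norm_bounded_mon hr cM).
have cv : cvgn tv by apply: sum_bounded_cvg (norm_bounded_mon hr dM).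
have half : (fun N : nat => N./2) @ \oo --> \oo.
  apply/cvgnyPge => A; exists A.*2 => // N /= AN.
  by rewrite -(doubleK A) half_leq.
have t0 : (fun N => tu N * tv N - tu N./2 * tv N./2) @ \oo --> 0.
  rewrite -(subrr (limn tu * limn tv)); apply: cvgB; first exact: cvgM.
  by apply: cvgM; [exact: cvg_comp half cu | exact: cvg_comp half cv].
have E N : mpsum c h N * mpsum d h N - mpsum (cauchy c d) h N =
    \sum_(k <- box N) \sum_(l <- box N | madd k l \notin box N) u k * v l.
  rewrite !mpsumE sum_cauchy; last exact: mon_madd.
  rewrite mulr_suml -sumrB; apply: eq_bigr => k _.
  rewrite mulr_sumr (bigID (fun l => madd k l \in box N)) /=.
  by rewrite addrAC subrr add0r.
suff e0 : (fun N => mpsum c h N * mpsum d h N - mpsum (cauchy c d) h N) @ \oo --> 0.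
  have -> : mpsum (cauchy c d) h = (fun N => mpsum c h N * mpsum d h N
     - (mpsum c h N * mpsum d h N - mpsum (cauchy c d) h N)).
    by apply/funext => N; rewrite opprB addrC subrK.
  by rewrite -[x * y]subr0; apply: cvgB e0; apply: cvgM.
apply/cvgr0Pnorm_le => e e0; move/cvgr0Pnorm_le: t0 => /(_ _ e0).
apply: filterS => N /=; apply: le_trans; apply: le_trans (ler_norm _).
rewrite E; apply: le_trans (ler_norm_sum _ _ _) _.
pose D := \sum_(k <- box N) \sum_(l <- box N | madd k l \in box N) `|u k| * `|v l|.
apply: (@le_trans _ _ (tu N * tv N - D)).
  rewrite /D /tu mulr_suml -sumrB; apply: ler_sum => k _.
  rewrite /tv mulr_sumr [X in X - _](bigID (fun l => madd k l \in box N)) /=.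
  rewrite addrAC subrr add0r; apply: le_trans (ler_norm_sum _ _ _) _.
  by apply: ler_sum => l _; rewrite normrM.
apply: lerB => //; rewrite /tu mulr_suml.
apply: (@le_trans _ _ (\sum_(k <- box N./2) \sum_(l <- box N | madd k l \in box N) `|u k| * `|v l|)).
  rewrite big_seq [leRHS]big_seq; apply: ler_sum => k kN.
  rewrite -mulr_sumr; apply: ler_wpM2l => //; rewrite -big_filter.
  apply: ler_sum_sub; rewrite ?filter_uniq ?box_uniq // => l lN.
  rewrite mem_filter (box_madd kN lN) /=; apply: box_sub lN.
  by rewrite -divn2 leq_div.
apply: ler_sum_sub; rewrite ?box_uniq //.
  by move=> k; apply: sumr_ge0 => l _; rewrite mulr_ge0.
by apply: box_sub; rewrite -divn2 leq_div.
Qed.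

Lemma norm_bounded_ge0 c r M : norm_bounded c r M -> 0 <= r -> 0 <= M.
Proof.
by move=> cM r0; apply: le_trans (cM 0%N); apply: sumr_ge0 => m _; rewrite mulr_ge0 // exprn_ge0.
Qed.

Lemma analytic_mul f g a : analytic_at f a -> analytic_at g a ->
  analytic_at (fun z => f z * g z) a.
Proof.
move=> /analytic_atP[c [r [M [r0 cM H]]]] /analytic_atP[d [r' [M' [r0' dM H']]]].
have m0 : 0 <= Num.min r r' by rewrite le_min !ltW.
have cM1 : norm_bounded c (Num.min r r') M.
  by apply: norm_boundedW cM => //; rewrite ge_min lexx.
have dM1 : norm_bounded d (Num.min r r') M'.
  by apply: norm_boundedW dM => //; rewrite ge_min lexx orbT.
apply/analytic_atP; exists (cauchy c d), (Num.min r r'), (M * M'); split.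
- by rewrite lt_min r0.
- by apply: norm_bounded_cauchy => //; apply: norm_bounded_ge0 cM1 m0.
move=> h hm; move: (hm); rewrite lt_min => /andP[hr hr'].
exact: mpsum_cauchy (ltW hm) cM1 dM1 (H h hr) (H' h hr').
Qed.

(* Coefficients of [1 / (1 - e)] for a series [e] without constant term, from
   the recursion [d = 1 + e d]; the first argument is the recursion fuel. *)
Fixpoint geom_rec c K m : R :=
  if K is K'.+1 then
    (m == mi0)%:R + \sum_(k <- box (deg m).+1 | mle k m && (k != mi0))
                       c k * geom_rec c K' (msub m k)
  else 0.

Definition geom c m := geom_rec c (deg m).+1 m.

Lemma deg_msub k m : mle k m -> (deg (msub m k) = deg m - deg k)%N.
Proof. by move=> km; rewrite -{2}(msubK km) deg_madd addKn. Qed.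

Lemma deg_gt0 k : k != mi0 -> (0 < deg k)%N.
Proof.
move=> k0; rewrite lt0n; apply: contra k0 => /eqP d0; apply/eqP/ffunP => i.
by apply/eqP; rewrite ffunE -leqn0 -d0 mi_le_deg.
Qed.

(** Each unfolding lowers the degree because [k != mi0], so all fuel above [deg m] is equivalent. *)
Lemma geom_rec_stable c K m : (deg m < K)%N -> geom_rec c K m = geom c m.
Proof.
suff H K' : (deg m < K')%N -> (deg m < K)%N -> geom_rec c K m = geom_rec c K' m.
  exact: H (ltnSn _).
elim: K K' m => [|K IH] [|K'] m //= dK' dK; congr (_ + _).
rewrite big_seq_cond [RHS]big_seq_cond; apply: eq_bigr => k /and3P[_ km k0].
have := deg_gt0 k0; have := deg_msub km; move=> e1 e2.
have ltm : (0 < deg m)%N by apply: leq_trans e2 _; rewrite -(msubK km) deg_madd leq_addr.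
by congr (_ * _); apply: IH; lia.
Qed.

Lemma geomE c m : c mi0 = 0 -> geom c m = (m == mi0)%:R + cauchy c (geom c) m.
Proof.
move=> c0; rewrite {1}/geom /=; congr (_ + _).
rewrite /cauchy [RHS](bigID (fun k => k != mi0)) /= [X in _ + X]big1 ?addr0; last first.
  by move=> k /andP[_ /negbNE /eqP ->]; rewrite c0 mul0r.
apply: eq_bigr => k /andP[km k0]; congr (_ * _); apply: geom_rec_stable.
have := deg_gt0 k0; have := deg_msub km; move=> e1 e2.
have : (0 < deg m)%N by apply: leq_trans e2 _; rewrite -(msubK km) deg_madd leq_addr.
by lia.
Qed.

Lemma norm_bounded_geom c r q : 0 <= r -> q < 1 -> c mi0 = 0 ->
  norm_bounded c r q -> norm_bounded (geom c) r (1 - q)^-1.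
Proof.
move=> r0 q1 c0 cq; have q0 := norm_bounded_ge0 cq r0.
have re m : 0 <= r ^+ deg m by rewrite exprn_ge0.
move=> N; set S := \sum_(m <- _) _.
(* The finite sum [S] is a real number in any case, so a self-estimate obtained by summing the
   recursion can be solved for it, thanks to [q < 1]. *)
suff : S <= 1 + q * S by rewrite -[_^-1]mul1r ler_pdivlMr ?subr_gt0 //; lra.
apply: (@le_trans _ _ (\sum_(m <- box N) ((m == mi0)%:R + cauchy (fun m => `|c m|) (fun m => `|geom c m|) m) * r ^+ deg m)).
  apply: ler_sum => m _; rewrite ler_wpM2r // {1}geomE //.
  apply: le_trans (ler_normD _ _) _; rewrite normr_nat lerD2l.
  apply: le_trans (ler_norm_sum _ _ _) _.
  by apply: ler_sum => k _; rewrite normrM.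
under eq_bigr do rewrite mulrDl; rewrite big_split /=; apply: lerD.
  apply: (@le_trans _ _ (\sum_(m <- box N | m == mi0) 1)).
    rewrite [leRHS]big_mkcond; apply: ler_sum => m _; case: eqP => [->|_].
      rewrite (_ : deg mi0 = 0%N) ?mul1r //.
      by rewrite /deg big1 // => i _; rewrite ffunE.
    by rewrite mul0r.
  rewrite -big_filter big_const_seq count_predT iter_addr_0.
  by rewrite size_filter (count_uniq_mem _ (box_uniq N)); case: (_ \in _).
rewrite sum_cauchy; last by move=> k l; rewrite deg_madd exprD.
apply: (@le_trans _ _ ((\sum_(k <- box N) `|c k| * r ^+ deg k) * S)).
  rewrite mulr_suml; apply: ler_sum => k _; rewrite -mulr_sumr.
  apply: ler_wpM2l; first by rewrite mulr_ge0.
  rewrite -big_filter; apply: ler_sum_sub; rewrite ?filter_uniq ?box_uniq //.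
    by move=> m; rewrite mulr_ge0.
  by move=> m; rewrite mem_filter => /andP[].
apply: ler_wpM2r (cq N); apply: sumr_ge0 => m _; by rewrite mulr_ge0.
Qed.

(** Without a constant term every monomial has degree at least 1, so shrinking the radius by [t]
    gains at least one factor [t]. *)
Lemma norm_bounded_shrink c r M (t : R) : 0 <= r -> 0 <= t -> t <= 1 -> c mi0 = 0 ->
  norm_bounded c r M -> norm_bounded c (t * r) (t * M).
Proof.
move=> r0 t0 t1 c0 cM N; apply: le_trans (ler_wpM2l t0 (cM N)).
rewrite mulr_sumr; apply: ler_sum => m _; case: (eqVneq m mi0) => [->|m0].
  by rewrite c0 normr0 !(mul0r, mulr0).
rewrite exprMn mulrA [t * _]mulrA [t * _]mulrC ler_wpM2r ?exprn_ge0 //.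
rewrite ler_wpM2l //; case: (deg m) (deg_gt0 m0) => // k _.
by rewrite exprS ler_piMr // exprn_ile1.
Qed.

Lemma mpsum_at0 c N : mpsum c 0 N.+1 = c mi0.
Proof.
rewrite mpsumE (bigD1_seq mi0) ?box_uniq ?mem_box_deg //=; last first.
  by rewrite /deg big1 // => i _; rewrite ffunE.
rewrite mon0 mulr1 big1 ?addr0 // => m m0.
have : (0 < deg m)%N := deg_gt0 m0.
rewrite lt0n /deg sum_nat_eq0 negb_forall => /existsP[i /= mi].
by rewrite /mon (bigD1 i) //= mxE expr0n (negPf mi) mul0r mulr0.
Qed.

Lemma cvgn_uniq (u : nat -> R) (x y : R) : u @ \oo --> x -> u @ \oo --> y -> x = y.
Proof.
move=> ux uy.
by rewrite -(cvg_lim (@Rhausdorff R) ux) -(cvg_lim (@Rhausdorff R) uy).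
Qed.

Lemma mpsum_center c (x : R) : mpsum c 0 @ \oo --> x -> c mi0 = x.
Proof.
move=> H; have : mpsum c 0 @ \oo --> c mi0.
  by apply: cvg_near_cst; exists 1%N => // -[//|N] _; rewrite mpsum_at0.
by move=> H'; exact: cvgn_uniq H' H.
Qed.

Lemma analytic_inv f a : analytic_at f a -> f a != 0 -> analytic_at (fun z => (f z)^-1) a.
Proof.
move=> /analytic_atP[c [r [M [r0 cM H]]]] fa0.
have c0 : c mi0 = f a.
  by rewrite -[a in RHS]addr0; apply: mpsum_center; apply: H; rewrite normr0.
(* The normalization [f (a + h) = f a * (1 - e h)], which reduces the reciprocal to a geometric
   series in [e]. *)
pose e m := if m == mi0 then 0 else - (f a)^-1 * c m.
have e0 : e mi0 = 0 by rewrite /e eqxx.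
have eM : norm_bounded e r (`|f a|^-1 * M).
  move=> N; apply: le_trans (ler_wpM2l _ (cM N)); last by rewrite invr_ge0.
  rewrite mulr_sumr; apply: ler_sum => m _; rewrite mulrA ler_wpM2r //; first by rewrite exprn_ge0 // ltW.
  rewrite /e; case: eqP => _.
    by rewrite normr0 mulr_ge0 ?invr_ge0.
  by rewrite normrM normrN normfV.
set M' := `|f a|^-1 * M in eM.
have M'0 := norm_bounded_ge0 eM (ltW r0).
(* Chosen so that the norm of [e] at radius [t * r] is at most [t * M' < 1], with [t <= 1]. *)
pose t : R := (2 * (M' + 1))^-1.
have t0 : 0 < t by rewrite invr_gt0; lra.
have t1 : t <= 1 by rewrite invf_le1; lra.
have eq := norm_bounded_shrink (ltW r0) (ltW t0) t1 e0 eM.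
have q1 : t * M' < 1 by rewrite mulrC /t ltr_pdivrMr; lra.
have tr0 : 0 < t * r by rewrite mulr_gt0.
have gM := norm_bounded_geom (ltW tr0) q1 e0 eq.
apply/analytic_atP; exists (fun m => (f a)^-1 * geom e m), (t * r), (`|f a|^-1 * (1 - t * M')^-1).
split=> // [N|h hr].
  apply: le_trans (ler_wpM2l _ (gM N)); last by rewrite invr_ge0.
  by rewrite mulr_sumr; apply: ler_sum => m _; rewrite normrM normfV mulrA.
have hr' : `|h| < r by apply: lt_le_trans hr _; rewrite ler_piMl // ltW.
have cvgg : cvgn (mpsum (geom e) h).
  have := sum_abs_cvg (norm_bounded_mon (ltW hr) gM).
  by congr (cvgn _); apply/funext => N; rewrite mpsumE.
have [x gx] : exists x : R, mpsum (geom e) h @ \oo --> x.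
  by move/cvg_ex: cvgg.
have ey : mpsum e h @ \oo --> 1 - (f a)^-1 * f (a + h).
  have : (fun N => 1 - (f a)^-1 * mpsum c h N) @ \oo --> 1 - (f a)^-1 * f (a + h).
    by apply: cvgB; [exact: cvg_cst | apply: cvgM (H h hr'); exact: cvg_cst].
  apply: cvg_trans; apply: near_eq_cvg; exists 1%N => // -[//|N] _ /=.
  have m0N : mi0 \in @box n N.+1 by apply: mem_box_deg; rewrite /deg big1 // => i _; rewrite ffunE.
  rewrite !mpsumE !(bigD1_seq mi0) ?box_uniq //= e0 c0 mon0 mul0r add0r mulr1.
  rewrite mulrDr mulVf // opprD addrA subrr add0r mulr_sumr -sumrN.
  by apply: eq_bigr => m /negPf m0; rewrite /e m0 !mulNr mulrA.
have gxy := mpsum_cauchy (ltW hr) eq gM ey gx.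
(* The recursion for [geom], summed at [h]. It gives [f (a + h) * x = f a], and in particular
   [f (a + h) != 0]. *)
have xE : x = 1 + (1 - (f a)^-1 * f (a + h)) * x.
  apply: (cvgn_uniq gx).
  have : (fun N => 1 + mpsum (cauchy e (geom e)) h N) @ \oo --> 1 + (1 - (f a)^-1 * f (a + h)) * x.
    by apply: cvgD => //; exact: cvg_cst.
  apply: cvg_trans; apply: near_eq_cvg; exists 1%N => // -[//|N] _ /=.
  have m0N : mi0 \in @box n N.+1 by apply: mem_box_deg; rewrite /deg big1 // => i _; rewrite ffunE.
  rewrite !mpsumE [RHS](eq_bigr _ (fun m _ => congr1 (fun t => t * _) (geomE m e0))).
  under [RHS]eq_bigr do rewrite mulrDl; rewrite big_split /=; congr (_ + _).
  rewrite (bigD1_seq mi0) ?box_uniq //= eqxx mon0 mul1r big1 ?addr0 //.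
  by move=> m /negPf ->; rewrite mul0r.
have fx : (f a)^-1 * f (a + h) * x = 1.
  by move: xE; set y := _ * f _ => xE; lra.
have fah0 : f (a + h) != 0.
  by apply/eqP => f0; move: fx; rewrite f0 mulr0 mul0r => /esym/eqP; rewrite oner_eq0.
have -> : (f (a + h))^-1 = (f a)^-1 * x.
  by apply: (mulIf fah0); rewrite mulVf // -fx; ring.
rewrite (_ : mpsum _ h = (fun N => (f a)^-1 * mpsum (geom e) h N)).
  by apply: cvgM => //; exact: cvg_cst.
by apply/funext => N; rewrite !mpsumE mulr_sumr; apply: eq_bigr => m _; rewrite mulrA.
Qed.

End Products.

(** * Termwise differentiation *)

Section Derivatives.
Context {R : realType} {n : nat}.
Notation mi := {ffun 'I_n -> nat}.
Implicit Types (m k l : mi) (N : nat) (h a : 'rV[R]_n) (c d : mi -> R)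
  (f g : 'rV[R]_n -> R) (r M : R) (i j : 'I_n).

Definition expands f a c r M :=
  [/\ 0 < r, norm_bounded c r M &
      forall h, `|h| < r -> mpsum c h @ \oo --> f (a + h)].

Lemma expands_center f a c r M : expands f a c r M -> c mi0 = f a.
Proof.
move=> [r0 cM H]; rewrite -[a in RHS]addr0; apply: mpsum_center; apply: H.
by rewrite normr0.
Qed.

Lemma differentiable_quadratic f a r M (df : 'cV[R]_n) : 0 < r ->
  (forall h, `|h| < r -> `|f (a + h) - f a - (h *m df) 0 0| <= M * `|h| ^+ 2) ->
  differentiable f a /\ forall i, pd i f a = df i 0.
Proof.
move=> r0 H; pose F h := (h *m df) 0 0.
have Flin : linear F.
  by move=> x u v; rewrite /F mulmxDl -scalemxAl !mxE.
pose Flin' := GRing.isLinear.Build _ _ _ _ _ Flin.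
pose FL : {linear 'rV[R]_n -> R} := HB.pack F Flin'.
have Fcont : continuous FL.
  move=> x; rewrite (_ : (FL : _ -> _) = (\sum_(i < n) (fun h : 'rV[R]_n => h 0 i * df i 0))); last first.
    by apply/funext => h; rewrite /FL /= /F mxE fct_sumE.
  apply: differentiable_continuous; apply: differentiable_sum => i.
  apply: differentiableM; last exact: differentiable_cst.
  exact: differentiable_coord.
have FE : (f \o shift a : 'rV[R]_n -> R^o) = (cst (f a) : 'rV[R]_n -> R^o) + (F : 'rV[R]_n -> R^o) +o_ (0 : 'rV[R]_n) id.
  apply/eqaddoP => _/posnumP[e].
  suff : \forall x \near (0 : 'rV[R]_n), `|f (x + a) - (f a + F x)| <= e%:num * `|x| by [].
  apply/nbhs_norm0P.
  have M1 : 0 < `|M| + 1 by rewrite ltr_wpDl.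
  exists (Num.min r (e%:num / (`|M| + 1))); first by rewrite /= lt_min r0 divr_gt0.
  move=> h /=; rewrite lt_min => /andP[hr]; rewrite ltr_pdivlMr // => he.
  rewrite opprD addrA [h + a]addrC.
  apply: le_trans (H h hr) _; rewrite expr2 mulrA ler_wpM2r //.
  have : `|M| * `|h| <= e%:num.
    by apply: le_trans (ltW he); rewrite mulrC ler_wpM2l // lerDl.
  by apply: le_trans; rewrite ler_wpM2r // ler_norm.
have dE := diff_unique Fcont FE.
have df' : differentiable f a.
  by apply/diff_locallyP; split; rewrite dE // FE.
split=> // i; rewrite /pd deriveE // dE /= /F.
by rewrite -rowE mxE.
Qed.

Lemma mi_case m : [\/ m = mi0, exists i, m = mi1 i | (2 <= deg m)%N].
Proof.
case: (eqVneq m mi0) => [->|m0]; first by constructor 1.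
have := deg_gt0 m0; rewrite lt0n {1}/deg sum_nat_eq0 negb_forall => /existsP[i /= mi].
case: (eqVneq m (mi1 i)) => [->|mi']; first by constructor 2; exists i.
constructor 3; have le1m : mle (mi1 i) m.
  by apply/forallP => j; rewrite ffunE; case: eqP => // ->; rewrite lt0n.
have d1 : deg (mi1 i) = 1%N.
  rewrite /deg (bigD1 i) //= ffunE eqxx big1 // => j /negPf ji.
  by rewrite ffunE ji.
rewrite -(msubK le1m) deg_madd d1 -[2%N]/(1 + 1)%N leq_add2l; apply: deg_gt0.
by apply: contra mi' => /eqP e; rewrite -(msubK le1m) e; apply/eqP/ffunP => j; rewrite !ffunE addn0.
Qed.

Lemma mi1_inj : injective (@mi1 n).
Proof. by move=> i j /ffunP/(_ i); rewrite !ffunE eqxx; case: eqP. Qed.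

Lemma expands_diff f a c r M : expands f a c r M ->
  differentiable f a /\ forall i, pd i f a = c (mi1 i).
Proof.
move=> ef; have [r0 cM H] := ef; have c0 := expands_center ef.
have M0 := norm_bounded_ge0 cM (ltW r0).
have [|dfa E] := @differentiable_quadratic f a r (M / r ^+ 2) (\col_i c (mi1 i)) r0; last first.
- by split=> // i; rewrite E mxE.
(* The multi-indices of degree at most 1: the value and the linear part. All others have degree at
   least 2. *)
move=> h hr; pose s := mi0 :: [seq mi1 i | i : 'I_n].
have us : uniq s.
  rewrite /= map_inj_uniq ?enum_uniq ?andbT; last exact: mi1_inj.
  by apply/mapP => -[i _ /esym/eqP]; rewrite (negPf (mi1_neq0 i)).
have ss : {subset s <= box 2}.
  move=> m; rewrite inE => /orP[/eqP->|/mapP[i _ ->]]; rewrite mem_box;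
    apply/forallP => j; rewrite ffunE //; by case: eqP.
suff key : forall N, (2 <= N)%N -> `|mpsum c h N - f a - (h *m \col_i c (mi1 i)) 0 0| <= M / r ^+ 2 * `|h| ^+ 2.
  have cv : (fun N => `|mpsum c h N - f a - (h *m \col_i c (mi1 i)) 0 0|) @ \oo -->
     `|f (a + h) - f a - (h *m \col_i c (mi1 i)) 0 0|.
    apply: cvg_norm; apply: cvgB; last exact: cvg_cst.
    by apply: cvgB (H h hr) _; exact: cvg_cst.
  rewrite -(cvg_lim (@Rhausdorff R) cv); apply: limr_le; first by apply/cvg_ex; eexists; exact: cv.
  by exists 2%N => // N /= /key.
move=> N N2; rewrite mpsumE (big_uniq_sub _ us (box_uniq N)); last first.
  by move=> m /ss; apply: box_sub.
rewrite big_cons c0 mon0 mulr1 big_map big_enum /=.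
rewrite (_ : \sum_i _ = (h *m \col_i c (mi1 i)) 0 0); last first.
  by rewrite mxE; apply: eq_bigr => i _; rewrite mxE mon1 mulrC.
have e5 (x y z : R) : x + y + z - x - y = z by ring.
rewrite e5.
apply: le_trans (ler_norm_sum _ _ _) _.
(* By homogeneity a term of degree at least 2 is at most [t ^+ 2] times its bound at radius [r],
   since [t <= 1]. *)
pose t := `|h| / r; have tE : M / r ^+ 2 * `|h| ^+ 2 = t ^+ 2 * M by rewrite /t expr_div_n; ring.
rewrite tE; have t0 : 0 <= t by rewrite divr_ge0 // ltW.
have t1 : t <= 1 by rewrite ler_pdivrMr // mul1r ltW.
apply: (@le_trans _ _ (t ^+ 2 * \sum_(m <- box N) `|c m| * r ^+ deg m)); last first.
  by rewrite ler_wpM2l ?exprn_ge0.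
rewrite mulr_sumr big_mkcond; apply: ler_sum => m _; case: ifPn => [ms|_]; last first.
  by rewrite mulr_ge0 ?exprn_ge0 // mulr_ge0 // exprn_ge0 // ltW.
have dm : (2 <= deg m)%N.
  case: (mi_case m) => // [m0|[i mi]]; case/negP: ms; rewrite inE ?m0 ?eqxx //.
  by apply/orP; right; rewrite mi; apply: map_f; rewrite mem_enum.
rewrite normrM mulrCA ler_wpM2l //; apply: le_trans (mon_le m (lexx _)) _.
have -> : `|h| = t * r by rewrite mulfVK // gt_eqF.
rewrite exprMn ler_wpM2r ?exprn_ge0 ?(ltW r0) //.
by rewrite ler_wiXn2l.
Qed.

(** The factor [rho ^+ 2] on the left replaces the exponent [p - 2] on the right, which would be
    truncated for small [p]. The induction splits off one factor [x + s]. *)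
Lemma power_taylor2 (rho x s : R) (p : nat) : `|x| <= rho -> `|x + s| <= rho ->
  rho ^+ 2 * `|(x + s) ^+ p - x ^+ p - s * (p%:R * x ^+ p.-1)| <= s ^+ 2 * p%:R ^+ 2 * rho ^+ p.
Proof.
move=> xr xsr; have r0 : 0 <= rho by apply: le_trans xr.
elim: p => [|p IH]; first by rewrite !expr0 subrr mul0r mulr0 subrr normr0 mulr0 mulr1 mulr_ge0 ?sqr_ge0.
have -> : (x + s) ^+ p.+1 - x ^+ p.+1 - s * (p.+1%:R * x ^+ p.+1.-1) =
  (x + s) * ((x + s) ^+ p - x ^+ p - s * (p%:R * x ^+ p.-1)) + s ^+ 2 * (p%:R * x ^+ p.-1).
  by case: p {IH} => [|p]; rewrite /= ?expr0 ?exprS -?natr1; ring.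
apply: le_trans (ler_wpM2l _ (ler_normD _ _)) _; first by rewrite exprn_ge0.
rewrite mulrDr.
have h1 : rho ^+ 2 * `|(x + s) * ((x + s) ^+ p - x ^+ p - s * (p%:R * x ^+ p.-1))| <=
    rho * (s ^+ 2 * p%:R ^+ 2 * rho ^+ p).
  by rewrite normrM mulrCA ler_pM // mulr_ge0 ?exprn_ge0.
have h2 : rho ^+ 2 * `|s ^+ 2 * (p%:R * x ^+ p.-1)| <= s ^+ 2 * p%:R * rho ^+ p.+1.
  rewrite normrM (ger0_norm (sqr_ge0 s)) [`|_ * _|]normrM normr_nat mulrCA -mulrA ler_wpM2l ?sqr_ge0 //.
  case: p {IH h1} => [|p]; first by rewrite !mul0r mulr0.
  rewrite mulrCA ler_wpM2l // normrX /= [leRHS]exprS [rho ^+ p.+1]exprS mulrA -expr2.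
  by rewrite ler_wpM2l ?exprn_ge0 // lerXn2r // nnegrE.
apply: le_trans (lerD h1 h2) _; rewrite -subr_ge0 -natr1.
have -> : s ^+ 2 * (p%:R + 1) ^+ 2 * rho ^+ p.+1 - (rho * (s ^+ 2 * p%:R ^+ 2 * rho ^+ p) +
  s ^+ 2 * p%:R * rho ^+ p.+1) = s ^+ 2 * (p%:R + 1) * rho ^+ p.+1 by rewrite [rho ^+ p.+1]exprS; ring.
by rewrite mulr_ge0 ?exprn_ge0 // mulr_ge0 ?sqr_ge0 // addr_ge0.
Qed.

Definition monx h i m : R := \prod_(j < n | j != i) h 0 j ^+ m j.

Lemma mon_split h i m : mon h m = h 0 i ^+ m i * monx h i m.
Proof. by rewrite /mon (bigD1 i). Qed.

Lemma mon_sub1 h i m : mon h (msub m (mi1 i)) = h 0 i ^+ (m i).-1 * monx h i m.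
Proof.
rewrite (mon_split _ i) !ffunE eqxx subn1; congr (_ * _).
by apply: eq_bigr => j /negPf ji; rewrite !ffunE ji subn0.
Qed.

Lemma monx_shift h i m (s : R) : monx (h + s *: delta_mx 0 i) i m = monx h i m.
Proof. by apply: eq_bigr => j /negPf ji; rewrite !mxE ji andbF mulr0 addr0. Qed.

Lemma monx_le h i m (rho : R) : `|h| <= rho -> rho ^+ m i * `|monx h i m| <= rho ^+ deg m.
Proof.
move=> hr; have r0 : 0 <= rho by apply: le_trans hr.
rewrite -mon_const (mon_split _ i) mxE ler_wpM2l ?exprn_ge0 // normr_prod.
apply: ler_prod => j _; rewrite normr_ge0 /= normrX mxE lerXn2r ?nnegrE //.
exact: le_trans (mx_norm_coord h j) hr.
Qed.

Lemma natr_mi_le m i : (m i)%:R <= 2 ^+ deg m :> R.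
Proof.
rewrite -natrX ler_nat; apply: leq_trans (ltnW (ltn_expl _ (ltnSn 1))) _.
by rewrite leq_exp2l // mi_le_deg.
Qed.

Lemma derive_quadratic f a (v : 'rV[R]_n) (y r M : R) : 0 < r ->
  (forall s : R, `|s| < r -> `|f (a + s *: v) - f a - s * y| <= s ^+ 2 * M) ->
  'D_v f a = y.
Proof.
move=> r0 H; rewrite /derive; apply: (cvg_lim (@Rhausdorff R)).
apply/cvgrPdist_le => e e0; near=> s.
have s0 : s != 0 by near: s; exact: nbhs_dnbhs_neq.
have sr : `|s| < r by near: s; exact: dnbhs0_lt.
have := H s sr; have -> : s ^+ 2 * M = `|s| * (`|s| * M).
  by rewrite mulrA -normrM -expr2 ger0_norm ?sqr_ge0.
have -> : f (a + s *: v) - f a - s * y = - s * (y - s^-1 *: (f (s *: v + a) - f a)).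
  by rewrite [s *: v + a]addrC -[s^-1 *: _]/(s^-1 * _) mulNr mulrBr mulrA divff // mul1r opprB.
rewrite normrM normrN ler_pM2l ?normr_gt0 // => /le_trans; apply.
have : `|s| * `|M| <= e.
  have : `|s| < e / (`|M| + 1).
    by near: s; apply: dnbhs0_lt; rewrite divr_gt0 // ltr_wpDl.
  rewrite ltr_pdivlMr ?ltr_wpDl // => h2; apply: le_trans (ltW h2).
  by rewrite ler_wpM2l // lerDl.
by apply: le_trans; rewrite ler_wpM2l // ler_norm.
Unshelve. all: by end_near. Qed.

Lemma expands_pd f a c r M i : expands f a c r M ->
  exists r' M', expands (pd i f) a (fun m => (m i).+1%:R * c (madd m (mi1 i))) r' M'.
Proof.
move=> [r0 cM H]; have M0 := norm_bounded_ge0 cM (ltW r0).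
(* Since [m i <= 2 ^+ deg m], the factor [m i] from differentiation and [(m i) ^ 2] from the Taylor
   remainder cost at most [4 ^+ deg m], which passing from [r] to [r / 4] compensates. *)
have [rho rho0 rE] : exists2 rho : R, 0 < rho & r = 4 * rho.
  by exists (r / 4); [rewrite divr_gt0 | lra].
pose w m := (m i)%:R * `|c m| * rho ^+ deg (msub m (mi1 i)).
have w_ge0 m : 0 <= w m by rewrite !mulr_ge0 // exprn_ge0 // ltW.
have wM : sum_bounded w (rho^-1 * M).
  move=> N; apply: le_trans (ler_wpM2l _ (cM N)); last by rewrite invr_ge0 ltW.
  rewrite mulr_sumr; apply: ler_sum => m _; rewrite /w.
  have [->|mi] := posnP (m i); first by rewrite !mul0r !mulr_ge0 ?invr_ge0 ?exprn_ge0 // ltW.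
  rewrite deg_msub; last by apply/forallP => j; rewrite ffunE; case: eqP => // ->.
  have -> : deg (mi1 i) = 1%N.
    by rewrite /deg (bigD1 i) //= ffunE eqxx big1 // => j /negPf ji; rewrite ffunE ji.
  have dm : (0 < deg m)%N by apply: leq_trans mi (mi_le_deg m i).
  have -> : rho^-1 * (`|c m| * r ^+ deg m) = 4 ^+ deg m * `|c m| * rho ^+ (deg m - 1).
    rewrite rE exprMn (_ : rho ^+ deg m = rho * rho ^+ (deg m - 1)); last first.
      by rewrite -exprS; congr (_ ^+ _); lia.
    by field; rewrite gt_eqF.
  rewrite ler_wpM2r ?exprn_ge0 ?(ltW rho0) // ler_wpM2r //.
  apply: le_trans (natr_mi_le m i) _.
  by rewrite lerXn2r // ?nnegrE // ler_nat.
pose g h m := (m i)%:R * c m * mon h (msub m (mi1 i)).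
have gM h : `|h| <= rho -> sum_bounded (fun m => `|g h m|) (rho^-1 * M).
  move=> hr; apply: sum_boundedW wM => m.
  by rewrite /g /w !normrM normr_nat ler_wpM2l ?mulr_ge0 //; exact: mon_le.
(* Half the radius leaves room for the increment: a point and its displacement along the i-th axis,
   both below [rr], add up to less than [rho]. *)
pose rr := rho / 2; have rr0 : 0 < rr by rewrite divr_gt0.
have drv h (y : R) : `|h| < rr -> (fun N => \sum_(m <- box N) g h m) @ \oo --> y ->
    pd i f (a + h) = y.
  move=> hr gy; apply: (@derive_quadratic f (a + h) _ y rr (M / rho ^+ 2)) => // s sr.
  have hs : `|h + s *: delta_mx 0 i| < rho.
    apply: rV_norm_lt => // j; rewrite !mxE.
    apply: le_lt_trans (ler_normD _ _) _; rewrite normrM.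
    have := mx_norm_coord h j; rewrite /= -[`|_%:R|]/(`|_%:R|) normr_nat.
    have : `|s| * (true && (j == i))%:R <= `|s| by rewrite ler_piMr //; case: (_ == _).
    by move: hr sr; rewrite /rr; lra.
  have hrho : `|h| < rho by apply: lt_trans hr _; rewrite /rr; lra.
  have ltr x : x < rho -> x < r by rewrite rE; lra.
  rewrite -[a + h + _]addrA; set A := f _; set B := f _.
  have cv : (fun N => `|mpsum c (h + s *: delta_mx 0 i) N - mpsum c h N - s * \sum_(m <- box N) g h m|)
     @ \oo --> `|A - B - s * y|.
    apply: cvg_norm; apply: cvgB; first by apply: cvgB; [exact: (H _ (ltr _ hs)) | exact: (H _ (ltr _ hrho))].
    by apply: cvgM gy; exact: cvg_cst.
  rewrite -(cvg_lim (@Rhausdorff R) cv); apply: limr_le; first by apply/cvg_ex; eexists; exact: cv.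
  near=> N; rewrite !mpsumE mulr_sumr -!sumrB.
  apply: le_trans (ler_norm_sum _ _ _) _.
  apply: (@le_trans _ _ (s ^+ 2 / rho ^+ 2 * \sum_(m <- box N) `|c m| * r ^+ deg m)); last first.
    rewrite mulrAC -mulrA ler_wpM2l ?sqr_ge0 // ler_wpM2r ?invr_ge0 ?exprn_ge0 ?(ltW rho0) //.
  rewrite mulr_sumr; apply: ler_sum => m _.
  rewrite /g mon_sub1 !(mon_split _ i m) monx_shift !mxE !eqxx mulr1.
  have -> : c m * ((h 0 i + s) ^+ m i * monx h i m) - c m * (h 0 i ^+ m i * monx h i m) -
     s * ((m i)%:R * c m * (h 0 i ^+ (m i).-1 * monx h i m)) =
     c m * (((h 0 i + s) ^+ m i - h 0 i ^+ m i - s * ((m i)%:R * h 0 i ^+ (m i).-1)) * monx h i m) by ring.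
  rewrite normrM [leRHS]mulrCA ler_wpM2l // normrM.
  rewrite mulrAC ler_pdivlMr ?exprn_gt0 // mulrAC [_ * rho ^+ 2]mulrC.
  have hi : `|h 0 i| <= rho by apply: le_trans (mx_norm_coord h i) (ltW hrho).
  have his : `|h 0 i + s| <= rho.
    apply: le_trans (ltW hs); apply: le_trans (mx_norm_coord _ i).
    by rewrite !mxE !eqxx mulr1.
  apply: le_trans (ler_wpM2r _ (power_taylor2 _ hi his)) _ => //.
  rewrite -[s ^+ 2 * _ * _ * _]mulrA -[s ^+ 2 * _ * _]mulrA ler_wpM2l ?sqr_ge0 // rE exprMn.
  apply: ler_pM; rewrite ?sqr_ge0 ?mulr_ge0 ?exprn_ge0 ?(ltW rho0) //; last exact: monx_le (ltW hrho).
  have -> : (4 : R) ^+ deg m = (2 ^+ deg m) ^+ 2 by rewrite exprAC; congr (_ ^+ _); lra.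
  by rewrite lerXn2r ?nnegrE ?exprn_ge0 // natr_mi_le.
have shift_sum (v : mi -> R) N :
  \sum_(m <- box N) v (madd m (mi1 i)) = \sum_(m <- [seq madd (mi1 i) m | m <- box N]) v m.
  rewrite [RHS]big_map; apply: eq_bigr => m _; congr v.
  by apply/ffunP => j; rewrite !ffunE addnC.
have map_uniq N : uniq [seq madd (mi1 i) m | m <- @box n N].
  by rewrite map_inj_uniq ?box_uniq //; exact: madd_inj.
have madd1 m : madd m (mi1 i) i = (m i).+1 by rewrite !ffunE eqxx addn1.
have msub1 m : msub (madd m (mi1 i)) (mi1 i) = m.
  by apply/ffunP => j; rewrite !ffunE addnK.
exists rr, (rho^-1 * M); split => // [N|h hr].
  apply: (@le_trans _ _ (\sum_(m <- box N) w (madd m (mi1 i)))).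
    apply: ler_sum => m _; rewrite /w madd1 msub1 normrM normr_nat ler_wpM2l ?mulr_ge0 //.
    by rewrite lerXn2r ?nnegrE ?ltW // /rr; lra.
  by rewrite shift_sum; apply: sum_bounded_seq.
have hrho : `|h| <= rho by apply: le_trans (ltW hr) _; rewrite /rr; lra.
have gM' := gM h hrho.
have [y gy] : exists y : R, (fun N => \sum_(m <- box N) g h m) @ \oo --> y.
  by have /cvg_ex := sum_abs_cvg gM'.
rewrite (drv h y hr gy).
(* Shifted boxes miss the multi-indices with [m i = 0]. Adding these makes the sets exhaust
   everything, and costs nothing because [g] vanishes there. *)
pose s N := [seq madd (mi1 i) m | m <- @box n N] ++ [seq m : mi <- @box n N | m i == 0%N].
rewrite (_ : mpsum _ h = (fun N => \sum_(m <- s N) g h m)).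
  apply: cvg_exhaust gM' gy _ _ => [N|K].
    rewrite cat_uniq map_uniq filter_uniq ?box_uniq // andbT /=.
    apply/hasPn => m; rewrite mem_filter => /andP[/eqP mi _]; apply/mapP => -[k _ mk].
    by move: mi; rewrite mk !ffunE eqxx.
  exists K => // N /= KN m mK; rewrite mem_cat mem_filter /= (box_sub KN mK) andbT.
  have [mi|mi] := posnP (m i); first by apply/orP; right; apply/eqP.
  have le1 : mle (mi1 i) m by apply/forallP => j; rewrite ffunE; case: eqP => // ->.
  apply/orP; left; apply/mapP; exists (msub m (mi1 i)); last by rewrite msubK.
  apply: box_down (box_sub KN mK).
  by apply/forallP => j; rewrite ffunE leq_subr.
apply/funext => N; rewrite mpsumE /s big_cat /= -shift_sum [X in _ + X]big1_seq ?addr0.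
  by apply: eq_bigr => m _; rewrite /g madd1 msub1.
by move=> m /andP[_]; rewrite mem_filter => /andP[/eqP mi _]; rewrite /g mi !mul0r.
Unshelve. all: by end_near. Qed.

End Derivatives.

(** * Analytic functions under differentiation, restriction and pullback *)

Section AnalyticCalculus.
Context {R : realType}.
Implicit Types (n : nat) (r M : R).

Lemma nbhs_shiftP n (a : 'rV[R]_n) (P : 'rV[R]_n -> Prop) :
  (\forall z \near a, P z) <-> exists2 r, 0 < r & forall h, `|h| < r -> P (a + h).
Proof.
split=> [/nbhs_normP[r r0 H]|[r r0 H]].
  by exists r => // h hr; apply: H; rewrite /ball_ /= opprD addNKr normrN.
apply/nbhs_normP; exists r => // z /=; rewrite distrC => zr.
by rewrite -[z](subrK a) addrC; apply: H.
Qed.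

Lemma analytic_at_near_eq n (f g : 'rV[R]_n -> R) a :
  (\forall z \near a, f z = g z) -> analytic_at f a -> analytic_at g a.
Proof.
move=> /nbhs_shiftP[r' r0' E] /analytic_atP[c [r [M [r0 cM H]]]].
apply/analytic_atP; exists c, (Num.min r r'), M; split.
- by rewrite lt_min r0.
- by apply: norm_boundedW cM; rewrite ?le_min ?ge_min ?lexx // !ltW.
by move=> h; rewrite lt_min => /andP[hr hr']; rewrite -E //; apply: H.
Qed.

Lemma analytic_near_eq n (f g : 'rV[R]_n -> R) a :
  (\forall z \near a, f z = g z) -> analytic_near f a -> analytic_near g a.
Proof.
move=> /near_join E fa; apply: filterS2 E fa => z; exact: analytic_at_near_eq.
Qed.

Lemma analytic_near_at n (f : 'rV[R]_n -> R) a : analytic_near f a -> analytic_at f a.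
Proof. exact: nbhs_singleton. Qed.

Lemma analytic_differentiable n (f : 'rV[R]_n -> R) a :
  analytic_at f a -> differentiable f a.
Proof. by move=> /analytic_atP[c [r [M /expands_diff[]]]]. Qed.

Lemma analytic_pd n (f : 'rV[R]_n -> R) a i : analytic_at f a -> analytic_at (pd i f) a.
Proof.
move=> /analytic_atP[c [r [M /(expands_pd i)[r' [M' e]]]]].
by apply/analytic_atP; eexists; exists r', M'; exact: e.
Qed.

(** Both sides are the same multiple of the same coefficient of the power series at [a]. *)
Lemma analytic_pdC n (f : 'rV[R]_n -> R) a i j :
  analytic_at f a -> pd i (pd j f) a = pd j (pd i f) a.
Proof.
move=> /analytic_atP[c [r [M e]]].
have [ri [Mi /expands_diff[_ ->]]] := expands_pd j e.
have [rj [Mj /expands_diff[_ ->]]] := expands_pd i e.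
rewrite !ffunE [i == j]eq_sym; congr (_ * c _).
by apply/ffunP => k; rewrite !ffunE addnC.
Qed.

Lemma pd_near_eq n (f g : 'rV[R]_n -> R) a i :
  (\forall z \near a, f z = g z) -> pd i f a = pd i g a.
Proof. exact: near_eq_derive. Qed.

Lemma base_adjoin n (z : 'rV[R]_n) (w : R) : base (adjoin z w) = z.
Proof. by apply/rowP => i; rewrite !mxE liftK. Qed.

Lemma fiber_adjoin n (z : 'rV[R]_n) (w : R) : fiber (adjoin z w) = w.
Proof. by rewrite /fiber mxE unlift_none. Qed.

Lemma adjoin_base n (y : 'rV[R]_n.+1) : adjoin (base y) (fiber y) = y.
Proof.
by apply/rowP => i; rewrite !mxE; case: unliftP => [j ->|->]; rewrite ?mxE.
Qed.

Lemma adjoin_lift n (z : 'rV[R]_n) (w : R) j : adjoin z w 0 (lift ord_max j) = z 0 j.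
Proof. by rewrite mxE liftK. Qed.

Lemma adjoin_max n (z : 'rV[R]_n) (w : R) : adjoin z w 0 ord_max = w.
Proof. by rewrite mxE unlift_none. Qed.

Lemma adjoinD n (z h : 'rV[R]_n) (w v : R) : adjoin (z + h) (w + v) = adjoin z w + adjoin h v.
Proof. by apply/rowP => i; rewrite !mxE; case: unliftP => [j|] _; rewrite ?mxE. Qed.

Lemma baseD n (y h : 'rV[R]_n.+1) : base (y + h) = base y + base h.
Proof. by apply/rowP => i; rewrite !mxE. Qed.

Lemma norm_base_lt n (h : 'rV[R]_n.+1) r : `|h| < r -> `|base h| < r.
Proof.
move=> hr; apply: rV_norm_lt => [|i]; first exact: le_lt_trans hr.
by rewrite mxE; apply: le_lt_trans (mx_norm_coord _ _) hr.
Qed.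

Lemma norm_adjoin_lt n (h : 'rV[R]_n) (v : R) r :
  `|h| < r -> `|v| < r -> `|adjoin h v| < r.
Proof.
move=> hr vr; apply: rV_norm_lt => [|i]; first exact: le_lt_trans vr.
by rewrite mxE; case: unliftP => [j|] _ //; apply: le_lt_trans (mx_norm_coord _ _) hr.
Qed.

Section Extension.
Context {n : nat}.

(** Multi-indices in which the last variable does not occur; the series of a function pulled back by
    [base] is supported on them. *)
Definition mext (k : {ffun 'I_n -> nat}) : {ffun 'I_n.+1 -> nat} :=
  [ffun i => if unlift ord_max i is Some j then k j else 0%N].

Definition mres (m : {ffun 'I_n.+1 -> nat}) : {ffun 'I_n -> nat} :=
  [ffun j => m (lift ord_max j)].

Lemma mextK : cancel mext mres.
Proof. by move=> k; apply/ffunP => j; rewrite !ffunE liftK. Qed.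

Lemma mresK (m : {ffun 'I_n.+1 -> nat}) : m ord_max = 0%N -> mext (mres m) = m.
Proof.
by move=> m0; apply/ffunP => i; rewrite !ffunE; case: unliftP => [j|] ->; rewrite ?ffunE.
Qed.

Lemma mext_max k : mext k ord_max = 0%N.
Proof. by rewrite ffunE unlift_none. Qed.

Lemma perm_box_mext N : (0 < N)%N ->
  perm_eq [seq m : {ffun 'I_n.+1 -> nat} <- box N | m ord_max == 0%N] (map mext (box N)).
Proof.
move=> N0; apply: uniq_perm.
- by rewrite filter_uniq ?box_uniq.
- by rewrite map_inj_uniq ?box_uniq //; exact: can_inj mextK.
move=> m; rewrite mem_filter; apply/andP/mapP => [[/eqP m0 mN]|[k kN ->]].
  exists (mres m); last by rewrite mresK.
  move: mN; rewrite !mem_box => /forallP H; apply/forallP => j.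
  by rewrite ffunE.
rewrite mext_max eqxx; split=> //; move: kN; rewrite !mem_box => /forallP H.
by apply/forallP => i; rewrite ffunE; case: unliftP.
Qed.

Lemma sum_box_mext (v : {ffun 'I_n.+1 -> nat} -> R) N : (0 < N)%N ->
  \sum_(m <- box N | m ord_max == 0%N) v m = \sum_(k <- box N) v (mext k).
Proof.
by move=> N0; rewrite -big_filter (perm_big _ (perm_box_mext N0)) big_map.
Qed.

Lemma deg_mext k : deg (mext k) = deg k.
Proof.
rewrite /deg (bigD1_ord ord_max) //= mext_max add0n.
by apply: eq_bigr => j _; rewrite ffunE liftK.
Qed.

Lemma mon_mext (h : 'rV[R]_n.+1) k : mon h (mext k) = mon (base h) k.
Proof.
rewrite /mon (bigD1_ord ord_max) //= mext_max expr0 mul1r.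
by apply: eq_bigr => j _; rewrite ffunE liftK !mxE.
Qed.

Lemma mon_adjoin0 (h : 'rV[R]_n) (m : {ffun 'I_n.+1 -> nat}) :
  m ord_max != 0%N -> mon (adjoin h 0) m = 0.
Proof.
by move=> m0; rewrite /mon (bigD1_ord ord_max) //= adjoin_max expr0n (negPf m0) mul0r.
Qed.

Lemma analytic_slice (f : 'rV[R]_n.+1 -> R) (z : 'rV[R]_n) (w : R) :
  analytic_at f (adjoin z w) -> analytic_at (fun z => f (adjoin z w)) z.
Proof.
move=> /analytic_atP[c [r [M [r0 cM H]]]].
apply/analytic_atP; exists (c \o mext), r, M; split=> // [N|h hr].
  have -> : \sum_(k <- box N) `|(c \o mext) k| * r ^+ deg k =
      \sum_(m <- map mext (box N)) `|c m| * r ^+ deg m.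
    by rewrite [RHS]big_map; apply: eq_bigr => k _; rewrite /= deg_mext.
  apply: sum_bounded_seq cM _; first by move=> m; rewrite mulr_ge0 // exprn_ge0 // ltW.
  by rewrite map_inj_uniq ?box_uniq //; exact: can_inj mextK.
have : mpsum c (adjoin h 0) @ \oo --> f (adjoin (z + h) w).
  by rewrite -[w]addr0 adjoinD; apply: H; apply: norm_adjoin_lt; rewrite ?normr0.
apply: cvg_trans; apply: near_eq_cvg; exists 1%N => // N /= N0.
rewrite !mpsumE [LHS](bigID (fun m : {ffun 'I_n.+1 -> nat} => m ord_max == 0%N)) /=.
rewrite [X in _ + X]big1 ?addr0; last by move=> m m0; rewrite mon_adjoin0 // mulr0.
by rewrite sum_box_mext //; apply: eq_bigr => k _; rewrite mon_mext base_adjoin.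
Qed.

Lemma analytic_base (f : 'rV[R]_n -> R) (y : 'rV[R]_n.+1) :
  analytic_at f (base y) -> analytic_at (f \o base) y.
Proof.
move=> /analytic_atP[c [r [M [r0 cM H]]]].
pose c' (m : {ffun 'I_n.+1 -> nat}) := if m ord_max == 0%N then c (mres m) else 0.
have E (v : {ffun 'I_n.+1 -> nat} -> R) N : (0 < N)%N -> (forall m : {ffun 'I_n.+1 -> nat}, m ord_max != 0%N -> v m = 0) ->
    \sum_(m <- box N) v m = \sum_(k <- box N) v (mext k).
  move=> N0 v0; rewrite -sum_box_mext // (bigID (fun m : {ffun 'I_n.+1 -> nat} => m ord_max == 0%N)) /=.
  by rewrite [X in _ + X]big1 ?addr0.
have c'E k : c' (mext k) = c k by rewrite /c' mext_max eqxx mextK.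
have c'0 (m : {ffun 'I_n.+1 -> nat}) : m ord_max != 0%N -> c' m = 0 by rewrite /c' => /negPf ->.
apply/analytic_atP; exists c', r, M; split=> // [N|h hr].
  apply: (@le_trans _ _ (\sum_(m <- box N.+1) `|c' m| * r ^+ deg m)).
    by apply: box_sum_mono => // m; rewrite mulr_ge0 // exprn_ge0 // ltW.
  rewrite E //; last by move=> m m0; rewrite c'0 // normr0 mul0r.
  by under eq_bigr do rewrite c'E deg_mext; exact: cM.
have : mpsum c (base h) @ \oo --> (f \o base) (y + h).
  by rewrite /= baseD; apply: H; exact: norm_base_lt.
apply: cvg_trans; apply: near_eq_cvg; exists 1%N => // N /= N0.
rewrite !mpsumE [RHS]E //; last by move=> m m0; rewrite c'0 // mul0r.
by apply: eq_bigr => k _; rewrite c'E mon_mext.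
Qed.
End Extension.

Lemma near_base n (y : 'rV[R]_n.+1) (P : 'rV[R]_n -> Prop) :
  (\forall z \near base y, P z) -> \forall y' \near y, P (base y').
Proof.
move=> /nbhs_shiftP[r r0 H]; apply/nbhs_shiftP; exists r => // h hr.
by rewrite baseD; apply: H; exact: norm_base_lt.
Qed.

Lemma near_adjoin n (z : 'rV[R]_n) (w : R) (P : 'rV[R]_n.+1 -> Prop) :
  (\forall y \near adjoin z w, P y) -> \forall z' \near z, P (adjoin z' w).
Proof.
move=> /nbhs_shiftP[r r0 H]; apply/nbhs_shiftP; exists r => // h hr.
rewrite -[w]addr0 adjoinD; apply: H; apply: norm_adjoin_lt => //.
by rewrite normr0.
Qed.

End AnalyticCalculus.

(** * Partial derivatives *)

Section Calculus.
Context {R : realType}.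
Implicit Types (n : nat).

Lemma differentiable_row n m (phi : 'rV[R]_n -> 'rV[R]_m) z :
  (forall k, differentiable (fun y => phi y 0 k) z) -> differentiable phi z.
Proof.
move=> H.
have -> : phi = \sum_(k < m) (fun y => phi y 0 k *: (delta_mx 0 k : 'rV[R]_m)).
  by apply/funext => y; rewrite fct_sumE {1}[phi y]row_sum_delta.
by apply: differentiable_sum => k; exact: differentiableZl.
Qed.

Lemma derive_row n m (phi : 'rV[R]_n -> 'rV[R]_m) z v :
  differentiable phi z -> 'D_v phi z = \row_k 'D_v (fun y => phi y 0 k) z.
Proof.
move=> H; rewrite derive_mx; last exact: diff_derivable.
by apply/rowP => k; rewrite !mxE.
Qed.

Lemma jacobian_pd n m (phi : 'rV[R]_n -> 'rV[R]_m) z i k :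
  (forall k, differentiable (fun y => phi y 0 k) z) ->
  'J phi z i k = pd i (fun y => phi y 0 k) z.
Proof.
move=> H; have := deriveEjacobian (delta_mx 0 i) (differentiable_row H).
rewrite -rowE derive_row; last exact: differentiable_row.
by move/rowP/(_ k); rewrite !mxE.
Qed.

Lemma diff_pd n (f : 'rV[R]_n -> R) z (v : 'rV[R]_n) :
  differentiable f z -> 'd f z v = \sum_k v 0 k * pd k f z.
Proof.
move=> df; rewrite [v in LHS]row_sum_delta linear_sum; apply: eq_bigr => k _.
by rewrite linearZ /= /pd deriveE.
Qed.

Lemma pd_comp n m (f : 'rV[R]_m -> R) (phi : 'rV[R]_n -> 'rV[R]_m) z i :
  (forall k, differentiable (fun y => phi y 0 k) z) -> differentiable f (phi z) ->
  differentiable (f \o phi) z /\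
  pd i (f \o phi) z = \sum_k pd i (fun y => phi y 0 k) z * pd k f (phi z).
Proof.
move=> H df; have dphi := differentiable_row H.
have dc : differentiable (f \o phi) z by exact: differentiable_comp.
split=> //; rewrite /pd deriveE // diff_comp //= diff_pd //.
by rewrite -deriveE // derive_row //; apply: eq_bigr => k _; rewrite mxE.
Qed.

Lemma pd_add n (f g : 'rV[R]_n -> R) z i : differentiable f z -> differentiable g z ->
  pd i (fun y => f y + g y) z = pd i f z + pd i g z.
Proof. by move=> df dg; rewrite /pd -deriveD //; apply: diff_derivable. Qed.

Lemma pd_opp n (f : 'rV[R]_n -> R) z i : differentiable f z ->
  pd i (fun y => - f y) z = - pd i f z.
Proof. by move=> df; rewrite /pd -deriveN //; apply: diff_derivable. Qed.

Lemma pd_mul n (f g : 'rV[R]_n -> R) z i : differentiable f z -> differentiable g z ->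
  pd i (fun y => f y * g y) z = pd i f z * g z + f z * pd i g z.
Proof.
move=> df dg; rewrite /pd -[LHS]/('D_(delta_mx 0 i) (f * g) z).
by rewrite deriveM; [rewrite addrC mulrC [X in X + _]mulrC| exact: diff_derivable..].
Qed.

Lemma pd_cst n (c : R) (z : 'rV[R]_n) i : pd i (fun=> c) z = 0.
Proof. exact: derive_cst. Qed.

Lemma base_line n (y : 'rV[R]_n.+1) k (h : R) :
  base (h *: delta_mx 0 (lift ord_max k) + y) = h *: delta_mx 0 k + base y.
Proof. by apply/rowP => i; rewrite !mxE (inj_eq lift_inj). Qed.

Lemma base_line_max n (y : 'rV[R]_n.+1) (h : R) :
  base (h *: delta_mx 0 ord_max + y) = base y.
Proof.
by apply/rowP => i; rewrite !mxE eq_sym (negPf (neq_lift _ _)) andbF mulr0 add0r.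
Qed.

Lemma adjoin_line n (z : 'rV[R]_n) (w h : R) k :
  adjoin (h *: delta_mx 0 k + z) w = h *: delta_mx 0 (lift ord_max k) + adjoin z w.
Proof.
apply/rowP => i; rewrite !mxE; case: unliftP => [j ->|->].
  by rewrite !mxE (inj_eq lift_inj).
by rewrite (negPf (neq_lift _ _)) andbF mulr0 add0r.
Qed.

Lemma adjoin_line_max n (z : 'rV[R]_n) (w h : R) :
  adjoin z (h + w) = h *: delta_mx 0 ord_max + adjoin z w.
Proof.
apply/rowP => i; rewrite !mxE; case: unliftP => [j ->|->].
  by rewrite eq_sym (negPf (neq_lift _ _)) andbF mulr0 add0r.
by rewrite !eqxx mulr1.
Qed.

(** A directional derivative sees only the restriction to one line. Hence derivatives of functions
    composed with [base] or [adjoin] are computed without any differentiability assumption. *)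
Lemma derive_line n m (f : 'rV[R]_n -> R) (g : 'rV[R]_m -> R) a b v w :
  (forall h : R, f (h *: v + a) = g (h *: w + b)) -> 'D_v f a = 'D_w g b.
Proof.
move=> H; have fg : f a = g b by have := H 0; rewrite !scale0r !add0r.
have -> : 'D_v f a = lim ((fun h : R => h^-1 *: (f (h *: v + a) - f a)) @ 0^') by [].
by under eq_fun do rewrite H fg.
Qed.

Lemma pd_lift_base n (f : 'rV[R]_n -> R) (y : 'rV[R]_n.+1) k :
  pd (lift ord_max k) (f \o base) y = pd k f (base y).
Proof.
by apply: derive_line => h /=; rewrite base_line.
Qed.

Lemma pd_max_base n (f : 'rV[R]_n -> R) (y : 'rV[R]_n.+1) :
  pd ord_max (f \o base) y = 0.
Proof.
rewrite -[RHS](@pd_cst n.+1 (f (base y)) y ord_max).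
by apply: derive_line => h /=; rewrite base_line_max.
Qed.

Lemma pd_slice n (f : 'rV[R]_n.+1 -> R) (z : 'rV[R]_n) w k :
  pd k (fun z => f (adjoin z w)) z = pd (lift ord_max k) f (adjoin z w).
Proof.
by apply: derive_line => h; rewrite adjoin_line.
Qed.

Lemma pd_coord n (y : 'rV[R]_n) i k :
  pd i (fun y => y 0 k) y = (i == k)%:R.
Proof.
apply: (@derive_quadratic _ _ _ _ _ _ 1 0) => // s _.
rewrite !mxE eqxx [k == i]eq_sym /= (_ : _ - _ = 0) ?normr0 ?mulr0 //.
by ring.
Qed.

Lemma differentiable_fiber n (y : 'rV[R]_n.+1) : differentiable (@fiber R n) y.
Proof. exact: differentiable_coord. Qed.

Lemma pd_max_fiber n (y : 'rV[R]_n.+1) : pd ord_max (@fiber R n) y = 1.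
Proof. by rewrite pd_coord eqxx. Qed.

Lemma pd_lift_fiber n (y : 'rV[R]_n.+1) k : pd (lift ord_max k) (@fiber R n) y = 0.
Proof. by rewrite pd_coord eq_sym (negPf (neq_lift _ _)). Qed.

Lemma is_derive_fiber n (f : 'rV[R]_n.+1 -> R) z (w : R) : differentiable f (adjoin z w) ->
  is_derive w 1 (fun s => f (adjoin z s)) (pd ord_max f (adjoin z w)).
Proof.
move=> df.
have E : (fun h : R => h^-1 *: (f (adjoin z (h *: 1 + w)) - f (adjoin z w))) =
  (fun h : R => h^-1 *: (f (h *: delta_mx 0 ord_max + adjoin z w) - f (adjoin z w))).
  by apply/funext => h; rewrite [h *: 1]mulr1 adjoin_line_max.
have df' : derivable (fun s => f (adjoin z s)) w 1.
  by rewrite /derivable E; exact: diff_derivable.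
by apply: DeriveDef => //; rewrite /derive E.
Qed.

(** The mean value theorem on the vertical segment from [y] to height [w0], which stays in a cube
    around the centre. *)
Lemma pd_max_const n (f : 'rV[R]_n.+1 -> R) z0 (w0 : R) :
  (\forall y \near adjoin z0 w0, differentiable f y /\ pd ord_max f y = 0) ->
  \forall y \near adjoin z0 w0, f y = f (adjoin (base y) w0).
Proof.
move=> /nbhs_shiftP[r r0 H]; apply/nbhs_shiftP; exists r => // h hr.
have hb := norm_base_lt hr; have hf : `|fiber h| < r by apply: le_lt_trans (mx_norm_coord _ _) hr.
have H' s : `|s| < r -> is_derive (w0 + s) 1 (fun s => f (adjoin (z0 + base h) s)) 0.
  move=> sr; have [df <-] := H _ (norm_adjoin_lt hb sr); rewrite -adjoinD in df *.
  exact: is_derive_fiber.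
rewrite baseD base_adjoin -[h in LHS]adjoin_base -adjoinD.
have cvx x a b : `|a| < r -> `|b| < r -> w0 + a <= x <= w0 + b ->
    exists2 s, `|s| < r & x = w0 + s.
  move=> ar br /andP[ax xb]; exists (x - w0); last by rewrite addrC subrK.
  by move: ar br; rewrite !ltr_norml => /andP[a1 a2] /andP[b1 b2]; apply/andP; split; lra.
have key a b : `|a| < r -> `|b| < r -> w0 + a < w0 + b ->
    f (adjoin (z0 + base h) (w0 + a)) = f (adjoin (z0 + base h) (w0 + b)).
  move=> ar br ab.
  have [x xab|//|c _] := @MVT R (fun s => f (adjoin (z0 + base h) s)) (fun=> 0) _ _ ab.
  - have [|s sr ->] := cvx x a b ar br; last exact: H'.
    by move: xab; rewrite in_itv /= => /andP[/ltW -> /ltW ->].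
  - apply: derivable_within_continuous => x xab.
    have [|s sr ->] := cvx x a b ar br; first by move: xab; rewrite in_itv.
    by have [] := H' s sr.
  by rewrite mul0r => /eqP; rewrite subr_eq0 => /eqP.
have rr : `|0 : R| < r by rewrite normr0.
case: (ltgtP 0 (fiber h)) => [h0|h0|<-].
- by rewrite -[w0 in RHS]addr0; apply/esym/key => //; rewrite ltrD2l.
- by rewrite -[w0 in RHS]addr0; apply/key => //; rewrite ltrD2l.
- by rewrite addr0.
Qed.

Lemma near_continuous_neq0 n (f : 'rV[R]_n -> R) a : differentiable f a -> f a != 0 ->
  \forall z \near a, f z != 0.
Proof.
move=> df fa.
have c : {for a, continuous f} by exact: differentiable_continuous.
exact: (@cvgr_neq0 R R^o _ (nbhs a) _ f (f a) c fa).
Qed.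

Lemma continuous_row n m (phi : 'rV[R]_n -> 'rV[R]_m) z :
  (forall k, differentiable (fun y => phi y 0 k) z) -> {for z, continuous phi}.
Proof. by move=> H; apply: differentiable_continuous; exact: differentiable_row. Qed.

Definition pdJ n m (phi : 'rV[R]_n -> 'rV[R]_m) z : 'M[R]_(n, m) :=
  \matrix_(i, k) pd i (fun y => phi y 0 k) z.

Lemma jacobianE n m (phi : 'rV[R]_n -> 'rV[R]_m) z :
  (forall k, analytic_at (fun y => phi y 0 k) z) -> 'J phi z = pdJ phi z.
Proof.
move=> H; apply/matrixP => i k; rewrite jacobian_pd ?mxE //.
by move=> l; exact: analytic_differentiable.
Qed.

Lemma analytic_sum n (I : Type) (s : seq I) (P : pred I) (F : I -> 'rV[R]_n -> R) a :
  (forall i, analytic_at (F i) a) -> analytic_at (fun z => \sum_(i <- s | P i) F i z) a.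
Proof.
move=> H; elim: s => [|x s IH].
  by under eq_fun do rewrite big_nil; exact: analytic_cst.
under eq_fun do rewrite big_cons; case: (P x) => //.
exact: analytic_add.
Qed.

Lemma analytic_prod n (I : Type) (s : seq I) (P : pred I) (F : I -> 'rV[R]_n -> R) a :
  (forall i, analytic_at (F i) a) -> analytic_at (fun z => \prod_(i <- s | P i) F i z) a.
Proof.
move=> H; elim: s => [|x s IH].
  by under eq_fun do rewrite big_nil; exact: analytic_cst.
under eq_fun do rewrite big_cons; case: (P x) => //.
exact: analytic_mul.
Qed.

Lemma analytic_det n m (M : 'rV[R]_n -> 'M[R]_m) a :
  (forall i k, analytic_at (fun z => M z i k) a) -> analytic_at (fun z => \det (M z)) a.
Proof.
move=> H; apply: analytic_sum => s; apply: analytic_mul; first exact: analytic_cst.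
exact: analytic_prod.
Qed.

Lemma near_det_pdJ n (phi : 'rV[R]_n -> 'rV[R]_n) a :
  (forall k, analytic_at (fun y => phi y 0 k) a) -> \det (pdJ phi a) != 0 ->
  \forall z \near a, \det (pdJ phi z) != 0.
Proof.
move=> H; apply: near_continuous_neq0; apply: analytic_differentiable.
apply: analytic_det => i k; under eq_fun do rewrite mxE.
exact: analytic_pd.
Qed.

End Calculus.

(* Hides partial derivatives from [ring] and [field], which otherwise unfold
   them when comparing atoms. *)
Ltac gen_pd := repeat match goal with
  | |- context [@pd ?R ?n ?i ?f ?y] => generalize (@pd R n i f y); intro
  end.

(** * Prolongation to jets *)

Section JetMatrices.
Context {R : realType} {n : nat}.
Implicit Types (phi : 'rV[R]_n.+1 -> 'rV[R]_n.+1) (y : 'rV[R]_n.+1)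
  (f : 'rV[R]_n.+1 -> R) (p : 'rV[R]_n) (j : jet R n).

Definition zc phi (k : 'I_n) : 'rV[R]_n.+1 -> R := fun y => phi y 0 (lift ord_max k).
Definition oc phi : 'rV[R]_n.+1 -> R := fun y => phi y 0 ord_max.

Definition td1 f y p (i : 'I_n) : R :=
  pd (lift ord_max i) f y + p 0 i * pd ord_max f y.

(* [tder2] without its last term, the only one containing second derivatives
   of the dependent variable. *)
Definition td2 f y p (i k : 'I_n) : R :=
  pd (lift ord_max k) (pd (lift ord_max i) f) y
  + p 0 k * pd ord_max (pd (lift ord_max i) f) y
  + p 0 i * pd (lift ord_max k) (pd ord_max f) y
  + p 0 i * p 0 k * pd ord_max (pd ord_max f) y.

Definition tdZ phi y p : 'M[R]_n := \matrix_(i, k) td1 (zc phi k) y p i.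
Definition tdW phi y p : 'rV[R]_n := \row_i td1 (oc phi) y p i.
(** The value of the pulled back contact form [dw' - p' dz'] on the vertical direction; it is also
    the factor of the second derivatives in the prolongation. *)
Definition tdL phi y (p' : 'rV[R]_n) : R :=
  pd ord_max (oc phi) y - \sum_k p' 0 k * pd ord_max (zc phi k) y.
Definition tdN phi y p (p' : 'rV[R]_n) : 'M[R]_n :=
  \matrix_(i, l) (td2 (oc phi) y p i l - \sum_k p' 0 k * td2 (zc phi k) y p i l).

(** As a congruence of symmetric matrices, the second-order condition transports values of a
    quadratic form from one jet to the other. *)
Lemma prolongP phi j j' :
  prolong phi j j' <->
  [/\ jpt j' = phi (jpt j), \det (tdZ phi (jpt j) (jd1 j)) != 0,
      tdW phi (jpt j) (jd1 j) = jd1 j' *m (tdZ phi (jpt j) (jd1 j))^T &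
      tdN phi (jpt j) (jd1 j) (jd1 j') + tdL phi (jpt j) (jd1 j') *: jd2 j =
      tdZ phi (jpt j) (jd1 j) *m jd2 j' *m (tdZ phi (jpt j) (jd1 j))^T].
Proof.
set Z := tdZ _ _ _.
have E i l : (Z *m jd2 j' *m Z^T) i l =
    \sum_k \sum_m jd2 j' k m * tder1 (zc phi k) j i * tder1 (zc phi m) j l.
  rewrite mxE; under eq_bigr do rewrite mxE mulr_suml.
  rewrite exchange_big; apply: eq_bigr => k _; apply: eq_bigr => m _.
  by rewrite !mxE [td1 _ _ _ i * _]mulrC.
have E2 i l : (tdN phi (jpt j) (jd1 j) (jd1 j') + tdL phi (jpt j) (jd1 j') *: jd2 j) i l =
    tder2 (oc phi) j i l - \sum_k jd1 j' 0 k * tder2 (zc phi k) j i l.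
  rewrite !mxE /tdL mulrBl addrACA -opprD; congr (_ + - _); first by rewrite [_ * jd2 j i l]mulrC.
  rewrite mulr_suml -big_split.
  by apply: eq_bigr => k _ /=; rewrite -mulrA -mulrDr [_ * jd2 j i l]mulrC.
have E1 i : (jd1 j' *m Z^T) 0 i = \sum_k jd1 j' 0 k * tder1 (zc phi k) j i.
  by rewrite mxE; apply: eq_bigr => k _; rewrite !mxE.
rewrite /prolong -[\matrix_(i, k) _]/Z; split=> [[e0 e1 e2 e3]|[e0 e1 e2 e3]]; split=> //.
- by apply/rowP => i; rewrite E1 mxE; exact: e2.
- by apply/matrixP => i l; rewrite E2 E; apply/eqP; rewrite subr_eq addrC; apply/eqP; exact: e3.
- by move=> i; move/rowP/(_ i): e2; rewrite E1 mxE.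
- by move=> i l; move/matrixP/(_ i l): e3; rewrite E2 E => /eqP; rewrite subr_eq addrC => /eqP.
Qed.

Lemma pdJ_mulE phi y (V : 'rV[R]_n.+1) k :
  (V *m pdJ phi y) 0 k = \sum_i V 0 (lift ord_max i) * pd (lift ord_max i) (fun z => phi z 0 k) y
    + V 0 ord_max * pd ord_max (fun z => phi z 0 k) y.
Proof.
rewrite mxE (bigD1_ord ord_max) //= addrC mxE; congr (_ + _).
by apply: eq_bigr => i _; rewrite mxE.
Qed.

(** The row [(-p', 1)] is the contact form of the target. By hypothesis its pullback kills the total
    derivatives; if it killed the vertical direction too, the Jacobian would be singular. *)
Lemma tdL_neq0 phi y p (p' : 'rV[R]_n) : \det (pdJ phi y) != 0 ->
  tdW phi y p = p' *m (tdZ phi y p)^T -> tdL phi y p' != 0.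
Proof.
move=> J0 WZ; apply/eqP => L0.
pose v : 'rV[R]_n.+1 := adjoin (- p') 1.
have Jv : v *m (pdJ phi y)^T = 0.
  have vE (i : 'I_n.+1) : (v *m (pdJ phi y)^T) 0 i =
      pd i (oc phi) y - \sum_k p' 0 k * pd i (zc phi k) y.
    rewrite mxE (bigD1_ord ord_max) //= /v adjoin_max mul1r !mxE; congr (_ + _).
    by rewrite -sumrN; apply: eq_bigr => k _; rewrite adjoin_lift !mxE mulNr.
  apply/rowP => i; rewrite vE [RHS]mxE.
  case: (unliftP ord_max i) => [l ->|->]; last exact: L0.
  apply/eqP; rewrite subr_eq0; apply/eqP.
  apply: (@addIr _ (p 0 l * pd ord_max (oc phi) y)).
  have := congr1 (fun A : 'rV_n => A 0 l) WZ; rewrite !mxE /td1 => ->.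
  rewrite [X in p 0 l * X](subr0_eq L0) mulr_sumr -big_split; apply: eq_bigr => k _.
  by rewrite !mxE /td1 /=; ring.
have : v = 0.
  have uJ : (pdJ phi y)^T \in unitmx by rewrite unitmx_tr unitmxE unitfE.
  by rewrite -[v](mulmxK uJ) Jv mul0mx.
by move/rowP/(_ ord_max); rewrite /v adjoin_max mxE => /eqP; rewrite oner_eq0.
Qed.

(** Let [r] be the direction that the Jacobian sends to the vertical one. If [\det Z] vanishes at
    slope [q], then [r] is tangent to the graph of slope [q], that is, [c q = 0]. As [r != 0], the
    affine function [c] is not identically zero, and it stays nonzero near a point where it is. *)
Lemma det_tdZ_near phi y : \det (pdJ phi y) != 0 ->
  exists p, \forall q \near p, \det (tdZ phi y q) != 0.
Proof.
move=> J0; have Ju : pdJ phi y \in unitmx by rewrite unitmxE unitfE.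
pose r : 'rV[R]_n.+1 := delta_mx 0 ord_max *m invmx (pdJ phi y).
have r0 : r != 0.
  apply: contraTneq isT => rE; have : r *m pdJ phi y = delta_mx 0 ord_max by rewrite /r mulmxKV.
  by rewrite rE mul0mx => /rowP/(_ ord_max); rewrite !mxE !eqxx => /eqP; rewrite eq_sym oner_eq0.
pose c (q : 'rV[R]_n) : R := fiber r - \sum_i base r 0 i * q 0 i.
have cZ q : c q != 0 -> \det (tdZ phi y q) != 0.
  move=> cq; apply/negP => /det0P[v v0 vZ].
  pose V := adjoin v (\sum_i v 0 i * q 0 i).
  have VJ : V *m pdJ phi y = (V *m pdJ phi y) 0 ord_max *: delta_mx 0 ord_max.
    apply/rowP => k; rewrite [RHS]mxE [X in _ * X]mxE eqxx /=.
    case: (unliftP ord_max k) => [l ->|->]; last by rewrite eqxx mulr1.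
    rewrite eq_sym (negPf (neq_lift _ _)) mulr0 pdJ_mulE.
    have := congr1 (fun A : 'rV_n => A 0 l) vZ; rewrite !mxE => vZl; rewrite -[RHS]vZl.
    rewrite unlift_none mulr_suml -big_split; apply: eq_bigr => i _ /=.
    by rewrite /V adjoin_lift mxE /td1 /zc; ring.
  set x := (V *m pdJ phi y) 0 ord_max in VJ.
  have Vr : V = x *: r by rewrite -[V](mulmxK Ju) VJ -scalemxAl.
  have vr i : v 0 i = x * base r 0 i.
    by have := congr1 (fun A : 'rV_n.+1 => base A 0 i) Vr; rewrite /V base_adjoin !mxE.
  have : x * c q = 0.
    have := congr1 (@fiber R n) Vr; rewrite /V fiber_adjoin (_ : fiber (x *: r) = x * fiber r); last by rewrite /fiber mxE.
    move=> H; rewrite /c mulrBr -H; rewrite mulr_sumr -sumrB big1 // => i _.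
    by rewrite vr; ring.
  move/eqP; rewrite mulf_eq0 (negPf cq) orbF => /eqP x0.
  by case/negP: v0; apply/eqP/rowP => i; rewrite vr x0 mul0r mxE.
suff [p cp] : exists p, c p != 0.
  exists p; apply: filterS cZ _; apply: near_continuous_neq0 cp.
  apply: analytic_differentiable; apply: analytic_add; first exact: analytic_cst.
  under eq_fun do rewrite -sumrN; apply: analytic_sum => i.
  under eq_fun do rewrite -mulNr; apply: analytic_mul; first exact: analytic_cst.
  exact: analytic_coord.
have c0 : c 0 = fiber r by rewrite /c big1 ?subr0 // => i _; rewrite [X in _ * X]mxE mulr0.
have [fr0|fr0] := eqVneq (fiber r) 0; last by exists 0; rewrite c0.
have [i ri] : exists i, base r 0 i != 0.
  apply/existsP; apply: contraNT r0; rewrite negb_exists => /forallP H.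
  rewrite -[r]adjoin_base; apply/eqP/rowP => k; rewrite !mxE.
  by case: unliftP => [l _|_] //; apply/eqP; have := H l; rewrite negbK.
exists (delta_mx 0 i); rewrite /c fr0 sub0r oppr_eq0 (bigD1 i) //= [delta_mx _ _ _ _]mxE !eqxx mulr1.
by rewrite big1 ?addr0 // => k /negPf ki; rewrite [delta_mx _ _ _ _]mxE ki andbF mulr0.
Qed.

Lemma td2C f y p i l : analytic_at f y -> td2 f y p i l = td2 f y p l i.
Proof.
move=> af; rewrite /td2 (analytic_pdC _ _ af) (analytic_pdC ord_max (lift ord_max i) af).
by rewrite (analytic_pdC (lift ord_max l) ord_max af); gen_pd; ring.
Qed.

(** Since [tdL] is nonzero, the congruence can be solved for the second-order part of the source,
    for every symmetric [q']. *)
Lemma jet_exists phi y p (q' : 'M[R]_n) :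
  (forall k, analytic_at (fun z => phi z 0 k) y) ->
  \det (pdJ phi y) != 0 -> \det (tdZ phi y p) != 0 -> q'^T = q' ->
  forall p', tdW phi y p = p' *m (tdZ phi y p)^T ->
  exists j j', [/\ jpt j = y, jd1 j = p, jd1 j' = p', jd2 j' = q' & prolong phi j j'].
Proof.
move=> an J0 Z0 qs p' WZ; have L0 := tdL_neq0 J0 WZ.
pose Z := tdZ phi y p.
pose q := (tdL phi y p')^-1 *: (Z *m q' *m Z^T - tdN phi y p p').
have Ns : (tdN phi y p p')^T = tdN phi y p p'.
  apply/matrixP => i l; rewrite !mxE; congr (_ - _); first exact: td2C (an ord_max).
  by apply: eq_bigr => k _; congr (_ * _); exact: td2C (an _).
have qs' : q^T = q.
  by rewrite /q linearZ linearB /= !trmx_mul trmxK qs Ns mulmxA.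
exists (Jet y p qs'), (Jet (phi y) p' qs); split=> //; apply/prolongP; split=> //=.
by rewrite /q scalerA divff // scale1r addrC subrK.
Qed.

Lemma tdW_solve phi y p : \det (tdZ phi y p) != 0 ->
  exists p', tdW phi y p = p' *m (tdZ phi y p)^T.
Proof.
move=> Z0; exists (tdW phi y p *m invmx (tdZ phi y p)^T).
by rewrite mulmxKV // unitmx_tr unitmxE unitfE.
Qed.

End JetMatrices.

(** * Transformations of quasilinear equations with rank-one principal part *)

Section Parabolic.
Context {R : realType} {n : nat}.
(** Two independent variables at least, so that the time index 0 and the space index 1 are
    distinct. *)
Let N := n.+2.
Implicit Types (phi : 'rV[R]_N.+1 -> 'rV[R]_N.+1) (y : 'rV[R]_N.+1)
  (v c p : 'rV[R]_N) (j : jet R N) (M : 'M[R]_N).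

Definition qf v M : R := (v *m M *m v^T) 0 0.

Lemma qfE v M : qf v M = \sum_i \sum_l v 0 i * v 0 l * M i l.
Proof.
rewrite /qf mxE; under eq_bigr do rewrite !mxE mulr_suml.
rewrite exchange_big; apply: eq_bigr => i _; apply: eq_bigr => l _.
by rewrite mulrAC.
Qed.

Lemma qfD v M M' : qf v (M + M') = qf v M + qf v M'.
Proof. by rewrite /qf mulmxDr mulmxDl mxE. Qed.

Lemma qfZ v (x : R) M : qf v (x *: M) = x * qf v M.
Proof. by rewrite /qf -scalemxAr -scalemxAl mxE. Qed.

Lemma qf_mul v (Z : 'M[R]_N) M : qf v (Z *m M *m Z^T) = qf (v *m Z) M.
Proof. by rewrite /qf trmx_mul !mulmxA. Qed.

Lemma qf_scale (x : R) v M : qf (x *: v) M = x ^+ 2 * qf v M.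
Proof. by rewrite /qf linearZ /= -scalemxAr -!scalemxAl !mxE mulrA. Qed.

Lemma qf_rank1 v c : qf v (c^T *m c) = (v *m c^T) 0 0 ^+ 2.
Proof.
rewrite /qf !mulmxA -mulmxA mxE big_ord1 expr2; congr (_ * _).
by rewrite -[c *m v^T]trmxK trmx_mul trmxK mxE.
Qed.

Lemma qf_delta v i : qf v (delta_mx i i) = v 0 i ^+ 2.
Proof.
rewrite (_ : delta_mx i i = (delta_mx 0 i : 'rV[R]_N)^T *m delta_mx 0 i); last first.
  by rewrite trmx_delta mul_delta_mx.
by rewrite qf_rank1 trmx_delta -colE mxE.
Qed.

(* A quasilinear equation solved for the derivative with respect to the first
   variable, whose principal part is the rank-one form [al * nu^T nu]. *)
Definition parabolic (E : diffeq R N) (al : 'rV[R]_N.+1 -> R)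
    (nu : 'rV[R]_N.+1 -> 'rV[R]_N) (G : 'rV[R]_N.+1 -> 'rV[R]_N -> R) : Prop :=
  forall j, E j <-> jd1 j 0 0 = al (jpt j) * qf (nu (jpt j)) (jd2 j) + G (jpt j) (jd1 j).

Section Pointwise.
Variables (phi : 'rV[R]_N.+1 -> 'rV[R]_N.+1) (y : 'rV[R]_N.+1).
Variables (E E' : diffeq R N) (al al' : 'rV[R]_N.+1 -> R)
  (nu nu' : 'rV[R]_N.+1 -> 'rV[R]_N) (G G' : 'rV[R]_N.+1 -> 'rV[R]_N -> R).
Hypotheses (parE : parabolic E al nu G) (parE' : parabolic E' al' nu' G').
Hypotheses (al0 : al y != 0) (al0' : al' (phi y) != 0).

(* [p'] is the first-order part of the image of a jet with first-order part [p].
   The first clause matches the quadratic forms in the second-order part, the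
   second one everything else. *)
Definition par_cond p (p' : 'rV[R]_N) :=
  nu y *m tdZ phi y p = (nu y *m tdZ phi y p) 0 1 *: nu' (phi y) /\
  tdL phi y p' * (p 0 0 - G y p) + al y * qf (nu y) (tdN phi y p p') =
  al y * (nu y *m tdZ phi y p) 0 1 ^+ 2 * ((p' 0 0 - G' (phi y) p') / al' (phi y)).

Lemma parabolic_necessary : nu' (phi y) 0 1 = 1 ->
  (forall k, analytic_at (fun z => phi z 0 k) y) -> \det (pdJ phi y) != 0 ->
  (forall j j', jpt j = y -> prolong phi j j' -> (E j <-> E' j')) ->
  forall p p', \det (tdZ phi y p) != 0 -> tdW phi y p = p' *m (tdZ phi y p)^T ->
  par_cond p p'.
Proof.
move=> nu1 an J0 H p p' Z0 WZ.
set b := (p' 0 0 - G' (phi y) p') / al' (phi y).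
set a := nu y *m tdZ phi y p; set L := tdL phi y p'.
have key (q' : 'M[R]_N) : q'^T = q' -> qf (nu' (phi y)) q' = b ->
    L * (p 0 0 - G y p) + al y * qf (nu y) (tdN phi y p p') = al y * qf a q'.
  move=> qs qb; have [j [j' [jy jp jp' jq' pr]]] := jet_exists an J0 Z0 qs WZ.
  have [jy' _ _] := (prolongP _ _ _).1 pr.
  rewrite jy jp jp' jq' -/L => e.
  have : E' j'.
    by apply/parE'; rewrite jy' jy jp' jq' qb /b mulrC mulfVK // subrK.
  move/(H j j' jy pr)/parE; rewrite jy jp => ->; rewrite addrK -qf_mul -e.
  by rewrite qfD qfZ; ring.
have sym (c : 'rV[R]_N) : (b *: delta_mx 1 1 + c^T *m c)^T = b *: delta_mx 1 1 + c^T *m c.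
  by rewrite linearD linearZ /= trmx_delta trmx_mul trmxK.
have qfc v c : qf v (b *: delta_mx 1 1 + c^T *m c) = b * v 0 1 ^+ 2 + (v *m c^T) 0 0 ^+ 2.
  by rewrite qfD qfZ qf_delta qf_rank1.
have e0 : L * (p 0 0 - G y p) + al y * qf (nu y) (tdN phi y p p') = al y * (b * a 0 1 ^+ 2).
  have sym0 : (b *: delta_mx 1 1)^T = b *: delta_mx 1 1 :> 'M[R]_N.
    by rewrite linearZ /= trmx_delta.
  by rewrite (key _ sym0) qfZ qf_delta // nu1 expr1n mulr1.
split; last by rewrite -/L e0 -/a -/b; ring.
apply/rowP => k; rewrite -/a [RHS]mxE.
(* This [c] is orthogonal to [nu'] because of the normalization [nu' 0 1 = 1]. Adding [c^T *m c] to
   [q'] keeps its value on [nu'], so [a] must be orthogonal to [c] as well; over all [k] this makes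
   [a] proportional to [nu']. *)
pose c : 'rV[R]_N := delta_mx 0 k - nu' (phi y) 0 k *: delta_mx 0 1.
have vc v : (v *m c^T) 0 0 = v 0 k - nu' (phi y) 0 k * v 0 1.
  rewrite /c linearB linearZ /= mulmxBr -scalemxAr !trmx_delta -!colE.
  by rewrite !mxE.
have : b * a 0 1 ^+ 2 + (a *m c^T) 0 0 ^+ 2 = b * a 0 1 ^+ 2.
  apply: (mulfI al0); rewrite -e0 (key _ (sym c)) ?qfc //.
  by rewrite vc nu1 mulr1 subrr expr0n /= expr1n mulr1 addr0.
move/eqP; rewrite -subr_eq0 addrAC subrr add0r sqrf_eq0 vc subr_eq0 => /eqP ->.
by rewrite mulrC.
Qed.

Lemma parabolic_sufficient j j' : \det (pdJ phi y) != 0 ->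
  jpt j = y -> prolong phi j j' ->
  (nu y *m tdZ phi y (jd1 j)) 0 1 != 0 -> par_cond (jd1 j) (jd1 j') -> (E j <-> E' j').
Proof.
move=> J0 jy /prolongP[jy']; rewrite jy => Z0 WZ e s0 [ea eb].
have L0 := tdL_neq0 J0 WZ.
have qe : tdL phi y (jd1 j') * qf (nu y) (jd2 j) = (nu y *m tdZ phi y (jd1 j)) 0 1 ^+ 2 *
   qf (nu' (phi y)) (jd2 j') - qf (nu y) (tdN phi y (jd1 j) (jd1 j')).
  by rewrite -qf_scale -ea -qf_mul -e qfD qfZ addrAC subrr add0r.
rewrite parE parE' jy' jy.
set s := (nu y *m _) 0 1 in s0 ea eb qe *.
set L := tdL _ _ _ in L0 eb qe *; set q := qf (nu y) (jd2 j) in qe *.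
set q' := qf _ (jd2 j') in qe *; set p0 := jd1 j 0 0 in eb *; set p0' := jd1 j' 0 0 in eb *.
(* The defects of the two equations are proportional, with nonzero factors on both sides. *)
have e1 : L * (p0 - (al y * q + G y (jd1 j))) =
    al y * s ^+ 2 / al' (phi y) * (p0' - (al' (phi y) * q' + G' (phi y) (jd1 j'))).
  have -> : L * (p0 - (al y * q + G y (jd1 j))) = L * (p0 - G y (jd1 j)) - al y * (L * q) by ring.
  have -> : al y * s ^+ 2 / al' (phi y) * (p0' - (al' (phi y) * q' + G' (phi y) (jd1 j'))) =
     al y * s ^+ 2 * ((p0' - G' (phi y) (jd1 j')) / al' (phi y)) - al y * s ^+ 2 * q' by field.
  by rewrite -eb qe; ring.
have c0 : al y * s ^+ 2 / al' (phi y) != 0.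
  by rewrite !mulf_neq0 ?invr_eq0 // sqrf_eq0.
split=> h; apply/eqP; rewrite -subr_eq0.
  by move: e1; rewrite h subrr mulr0 => /esym/eqP; rewrite mulf_eq0 (negPf c0).
by move: e1; rewrite h subrr mulr0 => /eqP; rewrite mulf_eq0 (negPf L0).
Qed.

(* Changing [p] in its first entry only moves [p'] along its first entry. *)
Lemma par_cond_time p (e : R) :
  nu y 0 0 = 0 ->
  pd ord_max (zc phi 0) y = 0 ->
  (forall i, i != 0 -> pd (lift ord_max i) (zc phi 0) y = 0) ->
  (forall q i l, i != 0 -> l != 0 -> td2 (zc phi 0) y q i l = 0) ->
  (forall q (x : R), G y (q + x *: delta_mx 0 0) = G y q) ->
  (forall q (x : R), G' (phi y) (q + x *: delta_mx 0 0) = G' (phi y) q) ->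
  e != 0 -> \det (pdJ phi y) != 0 ->
  \det (tdZ phi y p) != 0 ->
  \det (tdZ phi y (p + e *: delta_mx 0 0)) != 0 ->
  (forall q q', \det (tdZ phi y q) != 0 -> tdW phi y q = q' *m (tdZ phi y q)^T ->
     par_cond q q') ->
  pd (lift ord_max 0) (zc phi 0) y * al' (phi y) =
  al y * (nu y *m tdZ phi y p) 0 1 ^+ 2.
Proof.
move=> nu0 Tw Tx Txx Gt Gt' e0 J0 Z0 Z0' H.
have [p1 WZ] := tdW_solve Z0; have L0 := tdL_neq0 J0 WZ.
set Tt := pd (lift ord_max 0) (zc phi 0) y.
have Zi0 q i : tdZ phi y q i 0 = (i == 0)%:R * Tt.
  rewrite mxE /td1 Tw mulr0 addr0; case: eqP => [->|/eqP i0]; first by rewrite mul1r.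
  by rewrite Tx // mul0r.
have Tt0 : Tt != 0.
  apply/negP => /eqP T0; case/negP: Z0; rewrite (expand_det_col _ 0) big1 // => i _.
  by rewrite Zi0 T0 mulr0 mul0r.
set L := tdL phi y p1 in L0.
(* The change of [p'] that keeps the contact condition when the time entry of [p] grows by [e]:
   [c * Tt = L * e]. *)
pose c := L * e / Tt; pose p2 : 'rV[R]_N := p1 + c *: delta_mx 0 0.
have pE i : (p + e *: delta_mx 0 0) 0 i = p 0 i + e * (i == 0)%:R.
  by rewrite !mxE eqxx.
have p2E k : p2 0 k = p1 0 k + c * (k == 0)%:R.
  by rewrite /p2 !mxE eqxx.
have sumE (F : 'I_N -> R) : \sum_k p2 0 k * F k = \sum_k p1 0 k * F k + c * F 0.
  under eq_bigr do rewrite p2E mulrDl; rewrite big_split /=; congr (_ + _).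
  rewrite (bigD1 0) // eqxx mulr1 /= big1 ?addr0 // => k /negPf ->.
  by rewrite mulr0 mul0r.
have ZE i k : tdZ phi y (p + e *: delta_mx 0 0) i k =
    tdZ phi y p i k + e * (i == 0)%:R * pd ord_max (zc phi k) y.
  by rewrite mxE [tdZ _ _ _ _ _]mxE /td1 pE; gen_pd; ring.
have L2 : tdL phi y p2 = L by rewrite /tdL sumE Tw mulr0 addr0.
have W2 : tdW phi y (p + e *: delta_mx 0 0) = p2 *m (tdZ phi y (p + e *: delta_mx 0 0))^T.
  apply/rowP => i; have := congr1 (fun A : 'rV[R]_N => A 0 i) WZ.
  rewrite [LHS]mxE [RHS]mxE => WZi; rewrite [LHS]mxE [RHS]mxE.
  under [RHS]eq_bigr do rewrite [X in _ * X]mxE ZE; rewrite sumE Zi0 Tw mulr0 addr0.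
  under [X in _ = X + _]eq_bigr do rewrite mulrDr; rewrite big_split /=.
  have {}WZi : td1 (oc phi) y p i = \sum_k p1 0 k * tdZ phi y p i k.
    by rewrite WZi; apply: eq_bigr => k _; rewrite [X in _ * X]mxE.
  rewrite /td1 pE mulrDl addrA -/(td1 _ y p i) WZi.
  rewrite -addrA; congr (_ + _).
  rewrite (eq_bigr (fun k => e * (i == 0)%:R * (p1 0 k * pd ord_max (zc phi k) y))); last first.
    by move=> k _; rewrite mulrCA.
  rewrite -mulr_sumr; have cT : c * Tt = L * e by rewrite /c mulfVK.
  rewrite [c * _]mulrCA cT /L /tdL; set B := \sum_k _.
  by gen_pd; ring.
have aE : nu y *m tdZ phi y (p + e *: delta_mx 0 0) = nu y *m tdZ phi y p.
  apply/rowP => k; rewrite !mxE; apply: eq_bigr => i _; rewrite ZE.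
  by case: eqP => [->|_]; rewrite ?nu0 ?mul0r ?mulr0 ?mul0r ?addr0.
have qE : qf (nu y) (tdN phi y (p + e *: delta_mx 0 0) p2) = qf (nu y) (tdN phi y p p1).
  rewrite !qfE; apply: eq_bigr => i _; apply: eq_bigr => l _.
  have [->|i0] := eqVneq i 0; first by rewrite nu0 !mul0r.
  have [->|l0] := eqVneq l 0; first by rewrite nu0 mulr0 !mul0r.
  have tE f : td2 f y (p + e *: delta_mx 0 0) i l = td2 f y p i l.
    by rewrite /td2 !pE (negPf i0) (negPf l0) mulr0 !addr0.
  congr (_ * _); rewrite !mxE tE sumE Txx // mulr0 addr0; congr (_ - _).
  by apply: eq_bigr => k _; rewrite tE.
have [_ b1] := H _ _ Z0 WZ; have [_ b2] := H _ _ Z0' W2.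
move: b2; rewrite L2 aE qE Gt Gt' pE p2E eqxx !mulr1 -/L.
move: b1; rewrite -/L; set X := al y * qf _ _; set K := al y * _ ^+ 2 => b1 b2.
(* In the difference of the two conditions only the time derivatives survive. *)
have e1 : L * e = K * (c / al' (phi y)).
  transitivity ((L * (p 0 0 + e - G y p) + X) - (L * (p 0 0 - G y p) + X)); first by ring.
  by rewrite b1 b2; ring.
have Le : L * e != 0 by rewrite mulf_neq0.
apply: (mulfI Le); rewrite {1}e1 /c; field.
by rewrite Tt0 al0'.
Qed.
End Pointwise.
End Parabolic.

(** * The two classes of equations *)

Section Coordinates.
Context {R : realType}.

Lemma ord2_0 : (0 : 'I_2) = lift ord_max 0. Proof. exact: val_inj. Qed.
Lemma ord2_1 : (1 : 'I_2) = ord_max. Proof. exact: val_inj. Qed.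
Lemma ord3_0 : (0 : 'I_3) = lift ord_max 0. Proof. exact: val_inj. Qed.
Lemma ord3_1 : (1 : 'I_3) = lift ord_max 1. Proof. exact: val_inj. Qed.

Lemma sum2 (V : nmodType) (F : 'I_2 -> V) : \sum_i F i = F 0 + F 1.
Proof. by rewrite big_ord_recl big_ord1; congr (_ + F _); exact: val_inj. Qed.

Lemma sum3 (V : nmodType) (F : 'I_3 -> V) : \sum_i F i = F 0 + F 1 + F ord_max.
Proof.
rewrite 2!big_ord_recl big_ord1 addrA.
by congr (_ + F _ + F _); exact: val_inj.
Qed.

Lemma ord2P (P : 'I_2 -> Prop) : P 0 -> P 1 -> forall i, P i.
Proof.
move=> P0 P1 [[|[|//]] lti].
- by rewrite (_ : Ordinal lti = 0) //; exact: val_inj.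
- by rewrite (_ : Ordinal lti = 1) //; exact: val_inj.
Qed.

Lemma ord3P (P : 'I_3 -> Prop) : P 0 -> P 1 -> P ord_max -> forall i, P i.
Proof.
move=> P0 P1 P2 [[|[|[|//]]] lti].
- by rewrite (_ : Ordinal lti = 0) //; exact: val_inj.
- by rewrite (_ : Ordinal lti = 1) //; exact: val_inj.
- by rewrite (_ : Ordinal lti = ord_max) //; exact: val_inj.
Qed.

(** [T] as a function of both variables, so that the calculus of [pd] applies to it. *)
Definition time (T : R -> R) : 'rV[R]_2 -> R := fun p => T (p 0 0).

Lemma pd0_time T (p : 'rV[R]_2) : pd 0 (time T) p = (T^`())%classic (p 0 0).
Proof.
rewrite derive1E /pd /derive; have -> : (fun h : R => h^-1 *: ((time T \o shift p) (h *: delta_mx 0 0) - time T p))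
  = (fun h : R => h^-1 *: ((T \o shift (p 0 0)) (h *: 1) - T (p 0 0))).
  by apply/funext => h; rewrite /time /= !mxE !eqxx [h *: 1]/(h * 1).
by [].
Qed.

Lemma pd1_time T (p : 'rV[R]_2) : pd 1 (time T) p = 0.
Proof.
rewrite -[RHS](@pd_cst _ 2 (time T p) p 1).
by apply: derive_line => h; rewrite /time !mxE mulr0 add0r.
Qed.

Definition img (T : R -> R) (X : 'rV[R]_2 -> R) (p : 'rV[R]_2) : 'rV[R]_2 :=
  \row_(i < 2) [:: T (p 0 0); X p]`_i.

(** Here and in [phiD] the last components are arbitrary functions: these are the forms reached
    before [U] is known to be affine in u. *)
Definition phiL T X (U : 'rV[R]_3 -> R) : 'rV[R]_3 -> 'rV[R]_3 :=
  fun y => adjoin (img T X (base y)) (U y).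

Definition phiD T X U (om : 'rV[R]_4 -> R) : 'rV[R]_4 -> 'rV[R]_4 :=
  fun y => adjoin (phiL T X U (base y)) (om y).

Definition aff n (a b : 'rV[R]_n -> R) : 'rV[R]_n.+1 -> R :=
  fun y => a (base y) * fiber y + b (base y).

Lemma trLE T X U1 U0 : trL T X U1 U0 = phiL T X (aff U1 U0).
Proof. by []. Qed.

Definition omD (X U1 U0 : 'rV[R]_2 -> R) : 'rV[R]_4 -> R := fun y =>
  let z := base y in let p := base z in
  U1 p / pd 1 X p * fiber y + pd 1 U1 p / pd 1 X p * fiber z
     + pd 1 U0 p / pd 1 X p.

Lemma trDE0E T X U1 U0 : trDE0 T X U1 U0 = phiD T X (aff U1 U0) (omD X U1 U0).
Proof. by []. Qed.

Lemma img0 T X p : img T X p 0 0 = T (p 0 0). Proof. by rewrite mxE. Qed.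
Lemma img1 T X p : img T X p 0 1 = X p. Proof. by rewrite mxE. Qed.

Lemma zcL0 T X U : zc (phiL T X U) 0 = time T \o base.
Proof. by apply/funext => y; rewrite /zc /phiL adjoin_lift img0. Qed.
Lemma zcL1 T X U : zc (phiL T X U) 1 = X \o base.
Proof. by apply/funext => y; rewrite /zc /phiL adjoin_lift img1. Qed.
Lemma ocL T X U : oc (phiL T X U) = U.
Proof. by apply/funext => y; rewrite /oc /phiL adjoin_max. Qed.

Lemma zcD0 T X U om : zc (phiD T X U om) 0 = time T \o base \o base.
Proof. by apply/funext => y; rewrite /zc /phiD adjoin_lift {1}ord3_0 adjoin_lift img0. Qed.
Lemma zcD1 T X U om : zc (phiD T X U om) 1 = X \o base \o base.
Proof. by apply/funext => y; rewrite /zc /phiD adjoin_lift {1}ord3_1 adjoin_lift img1. Qed.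
Lemma zcDm T X U om : zc (phiD T X U om) ord_max = U \o base.
Proof. by apply/funext => y; rewrite /zc /phiD adjoin_lift adjoin_max. Qed.
Lemma ocD T X U om : oc (phiD T X U om) = om.
Proof. by apply/funext => y; rewrite /oc /phiD adjoin_max. Qed.

Lemma pd_lift_baseF n (f : 'rV[R]_n -> R) k :
  pd (lift ord_max k) (f \o base) = pd k f \o base.
Proof. by apply/funext => y; exact: pd_lift_base. Qed.

Lemma pd_max_baseF n (f : 'rV[R]_n -> R) : pd ord_max (f \o base) = fun=> 0.
Proof. by apply/funext => y; exact: pd_max_base. Qed.

Lemma td1_base n (f : 'rV[R]_n -> R) y p i : td1 (f \o base) y p i = pd i f (base y).
Proof. by rewrite /td1 pd_lift_base pd_max_base mulr0 addr0. Qed.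

Lemma td2_base n (f : 'rV[R]_n -> R) y p i l :
  td2 (f \o base) y p i l = pd l (pd i f) (base y).
Proof.
rewrite /td2 !pd_lift_baseF !pd_max_baseF !pd_cst /=.
by rewrite !mulr0 !addr0.
Qed.

(** The components of [Phi] do not depend on the last variable, so the last row of the Jacobian has
    at most one nonzero entry. *)
Lemma det_pdJ_adjoin n (Phi : 'rV[R]_n -> 'rV[R]_n) (om : 'rV[R]_n.+1 -> R) y :
  \det (pdJ (fun y => adjoin (Phi (base y)) (om y)) y) =
  pd ord_max om y * \det (pdJ Phi (base y)).
Proof.
rewrite (expand_det_row _ ord_max) (bigD1_ord ord_max) //= big1 ?addr0.
  rewrite mxE; congr (_ * _).
    by congr (pd _ _ _); apply/funext => z; rewrite adjoin_max.
  rewrite /cofactor addnn -signr_odd odd_double expr0 mul1r; congr (\det _).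
  apply/matrixP => i k; rewrite !mxE -pd_lift_base; congr (pd _ _ _).
  by apply/funext => z; rewrite adjoin_lift.
move=> k _; rewrite mxE (_ : (fun z => _) = (fun z => Phi z 0 k) \o base).
  by rewrite pd_max_base mul0r.
by apply/funext => z; rewrite adjoin_lift.
Qed.

Lemma det_pdJ_img T X p : \det (pdJ (img T X) p) = pd 1 X p * pd 0 (time T) p.
Proof.
rewrite -(_ : (fun p => adjoin (\row_(_ < 1) T (base p 0 0)) (X p)) = img T X).
  rewrite (@det_pdJ_adjoin _ (fun s : 'rV[R]_1 => \row_(_ < 1) T (s 0 0))) ord2_1.
  rewrite det_mx11 mxE; congr (_ * _); rewrite -pd_lift_base -ord2_0; congr (pd _ _ _).
  by apply/funext => q; rewrite /= !mxE -ord2_0.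
apply/funext => q; apply/rowP; apply: ord2P.
  by rewrite img0 ord2_0 adjoin_lift !mxE -ord2_0.
by rewrite img1 ord2_1 adjoin_max.
Qed.

Lemma det_pdJ_L T X U y : \det (pdJ (phiL T X U) y) =
  pd ord_max U y * (pd 1 X (base y) * pd 0 (time T) (base y)).
Proof. by rewrite det_pdJ_adjoin det_pdJ_img. Qed.

Lemma det_pdJ_D T X U om y : \det (pdJ (phiD T X U om) y) =
  pd ord_max om y * (pd ord_max U (base y) *
    (pd 1 X (base (base y)) * pd 0 (time T) (base (base y)))).
Proof. by rewrite det_pdJ_adjoin det_pdJ_L. Qed.

End Coordinates.

(** * The first-order conditions in coordinates *)

Section Conditions.
Context {R : realType}.
Implicit Types (th : coefs R) (T : R -> R) (X : 'rV[R]_2 -> R) (U : 'rV[R]_3 -> R)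
  (om : 'rV[R]_4 -> R).

Definition alL th (y : 'rV[R]_3) : R := cA th (base y).
Definition nuL (y : 'rV[R]_3) : 'rV[R]_2 := delta_mx 0 1.
Definition GL th (y : 'rV[R]_3) (p : 'rV[R]_2) : R :=
  cB th (base y) * p 0 1 + cC th (base y) * fiber y.

Definition alD th (y : 'rV[R]_4) : R := cA th (base (base y)).
Definition nuD (y : 'rV[R]_4) : 'rV[R]_3 := delta_mx 0 1 + fiber y *: delta_mx 0 ord_max.
Definition GD th (y : 'rV[R]_4) (p : 'rV[R]_3) : R :=
  let q := base (base y) in let u := fiber (base y) in let w := fiber y in
  pd 1 (cA th) q * (p 0 1 + w * p 0 ord_max)
  + (pd 1 (cB th) q * w + cB th q * p 0 1)
  + cC th q * (w - u * p 0 ord_max) + pd 1 (cC th) q * u.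

Lemma nuL_mul y (Z : 'M[R]_2) k : (nuL y *m Z) 0 k = Z 1 k.
Proof. by rewrite -rowE mxE. Qed.

Lemma nuD_mul y (Z : 'M[R]_3) k :
  (nuD y *m Z) 0 k = Z 1 k + fiber y * Z ord_max k.
Proof. by rewrite mulmxDl -scalemxAl -!rowE !mxE. Qed.

Lemma qfL y (M : 'M[R]_2) : qf (nuL y) M = M 1 1.
Proof. by rewrite /qf -rowE trmx_delta -colE !mxE. Qed.

Lemma qfD3 y (M : 'M[R]_3) : qf (nuD y) M =
  M 1 1 + fiber y * (M 1 ord_max + M ord_max 1) + fiber y ^+ 2 * M ord_max ord_max.
Proof.
rewrite /qf linearD linearZ /= mulmxDr -scalemxAr !trmx_delta -!colE.
rewrite mxE [X in _ + X]mxE [X in X + _]mxE [X in _ + _ * X]mxE !nuD_mul.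
ring.
Qed.

Lemma parabolicL th : parabolic (eqL th) (alL th) nuL (GL th).
Proof. by move=> j; rewrite qfL /eqL /= addrA. Qed.

Lemma parabolicD th : parabolic (eqDE0 th) (alD th) nuD (GD th).
Proof.
move=> j; rewrite qfD3 /eqDE0 /alD /GD /=.
have -> : jd2 j ord_max 1 = jd2 j 1 ord_max.
  by case: j => y p q qs /=; rewrite -[in LHS]qs mxE.
set L := jd1 j 0 0; set Rh := (X in L = X <-> _); set Rh' := (X in _ <-> L = X).
suff -> : Rh = Rh' by [].
by rewrite /Rh /Rh'; gen_pd; ring.
Qed.

Lemma nuL1 y : nuL y 0 1 = 1. Proof. by rewrite mxE. Qed.
Lemma nuL0 y : nuL y 0 0 = 0. Proof. by rewrite mxE. Qed.
Lemma nuD1 y : nuD y 0 1 = 1. Proof. by rewrite !mxE /= mulr0 addr0. Qed.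
Lemma nuD0 y : nuD y 0 0 = 0. Proof. by rewrite !mxE /= mulr0 addr0. Qed.
Lemma nuDm y : nuD y 0 ord_max = fiber y. Proof. by rewrite !mxE /= mulr1 add0r. Qed.

Definition condL th th' phi y p p' :=
  par_cond phi y (alL th) (alL th') nuL nuL (GL th) (GL th') p p'.
Definition condD th th' phi y p p' :=
  par_cond phi y (alD th) (alD th') nuD nuD (GD th) (GD th') p p'.

Section L.
Variables (th th' : coefs R) (T : R -> R) (X : 'rV[R]_2 -> R) (U : 'rV[R]_3 -> R).
Variables (y : 'rV[R]_3) (p p' : 'rV[R]_2).
Let q := base y.

Lemma tdZL : [/\ tdZ (phiL T X U) y p 0 0 = pd 0 (time T) q,
  tdZ (phiL T X U) y p 1 0 = 0, tdZ (phiL T X U) y p 0 1 = pd 0 X q &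
  tdZ (phiL T X U) y p 1 1 = pd 1 X q].
Proof. by split; rewrite mxE ?zcL0 ?zcL1 td1_base // pd1_time. Qed.

Lemma det_tdZL : \det (tdZ (phiL T X U) y p) = pd 0 (time T) q * pd 1 X q.
Proof.
have [z00 z10 z01 z11] := tdZL.
rewrite (expand_det_col _ 0) sum2 z00 z10 mul0r addr0 /cofactor det_mx11.
rewrite addn0 expr0 mul1r 2!mxE; congr (_ * _).
by rewrite -z11; congr (tdZ _ _ _ _ _); exact: val_inj.
Qed.

Lemma tdWL : tdW (phiL T X U) y p = p' *m (tdZ (phiL T X U) y p)^T <->
  td1 U y p 0 = p' 0 0 * pd 0 (time T) q + p' 0 1 * pd 0 X q /\
  td1 U y p 1 = p' 0 1 * pd 1 X q.
Proof.
have [z00 z10 z01 z11] := tdZL.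
split=> [e|[e0 e1]].
  have := congr1 (fun A : 'rV[R]_2 => A 0 0) e; have := congr1 (fun A : 'rV[R]_2 => A 0 1) e.
  rewrite !mxE !sum2 ![_^T _ _]mxE z00 z10 z01 z11 ocL => -> ->.
  by rewrite mulr0 add0r.
apply/rowP; apply: ord2P; rewrite !mxE !sum2 ![_^T _ _]mxE ?z00 ?z10 ?z01 ?z11 ocL //.
by rewrite mulr0 add0r.
Qed.

Lemma condLE : condL th th' (phiL T X U) y p p' <->
  pd ord_max U y * (p 0 0 - GL th y p)
   + cA th q * (td2 U y p 1 1 - p' 0 1 * pd 1 (pd 1 X) q)
  = cA th q * pd 1 X q ^+ 2 * ((p' 0 0 - (cB th' (img T X q) * p' 0 1 + cC th' (img T X q) * U y))
      / cA th' (img T X q)).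
Proof.
have [z00 z10 z01 z11] := tdZL.
have LE : tdL (phiL T X U) y p' = pd ord_max U y.
  rewrite /tdL sum2 ocL zcL0 zcL1 !pd_max_baseF !mulr0 addr0 subr0 //.
have NE : tdN (phiL T X U) y p p' 1 1 = td2 U y p 1 1 - p' 0 1 * pd 1 (pd 1 X) q.
  rewrite mxE sum2 ocL zcL0 zcL1 !td2_base.
  have -> : pd 1 (time T) = fun=> 0 by apply/funext => z; exact: pd1_time.
  by rewrite pd_cst mulr0 add0r.
rewrite /condL /par_cond LE qfL NE nuL_mul z11 /alL /GL.
rewrite /phiL base_adjoin fiber_adjoin -/(phiL T X U) -/q.
split=> [[]//|e]; split=> //; apply/rowP; apply: ord2P.
  by rewrite nuL_mul z10 [RHS]mxE nuL0 mulr0.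
by rewrite nuL_mul z11 [RHS]mxE nuL1 mulr1.
Qed.
End L.

Lemma pd0_base2 (f : 'rV[R]_2 -> R) : pd (0 : 'I_3) (f \o base) = pd 0 f \o base.
Proof. by rewrite {1}ord3_0 pd_lift_baseF. Qed.
Lemma pd1_base2 (f : 'rV[R]_2 -> R) : pd (1 : 'I_3) (f \o base) = pd 1 f \o base.
Proof. by rewrite {1}ord3_1 pd_lift_baseF. Qed.

Section D.
Variables (th th' : coefs R) (T : R -> R) (X : 'rV[R]_2 -> R) (U : 'rV[R]_3 -> R)
  (om : 'rV[R]_4 -> R).
Variables (y : 'rV[R]_4) (p p' : 'rV[R]_3).
Let z := base y.
Let q := base z.
Let phi := phiD T X U om.

Lemma tdZD i : [/\ tdZ phi y p i 0 = pd i (time T \o base) z,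
  tdZ phi y p i 1 = pd i (X \o base) z & tdZ phi y p i ord_max = pd i U z].
Proof. by split; rewrite mxE ?zcD0 ?zcD1 ?zcDm td1_base. Qed.

Lemma tdZD0 : [/\ tdZ phi y p 0 0 = pd 0 (time T) q, tdZ phi y p 1 0 = 0 & tdZ phi y p ord_max 0 = 0].
Proof.
split; first by have [-> _ _] := tdZD 0; rewrite pd0_base2.
- by have [-> _ _] := tdZD 1; rewrite pd1_base2 /= pd1_time.
- by have [-> _ _] := tdZD ord_max; rewrite pd_max_baseF.
Qed.

Lemma tdZD1 : [/\ tdZ phi y p 0 1 = pd 0 X q, tdZ phi y p 1 1 = pd 1 X q & tdZ phi y p ord_max 1 = 0].
Proof.
split; first by have [_ -> _] := tdZD 0; rewrite pd0_base2.
- by have [_ -> _] := tdZD 1; rewrite pd1_base2.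
- by have [_ -> _] := tdZD ord_max; rewrite pd_max_baseF.
Qed.

Lemma tdWD : tdW phi y p = p' *m (tdZ phi y p)^T <->
  [/\ td1 om y p 0 = p' 0 0 * pd 0 (time T) q + p' 0 1 * pd 0 X q + p' 0 ord_max * pd 0 U z,
      td1 om y p 1 = p' 0 1 * pd 1 X q + p' 0 ord_max * pd 1 U z &
      td1 om y p ord_max = p' 0 ord_max * pd ord_max U z].
Proof.
have [a0 a1 a2] := tdZD0; have [b0 b1 b2] := tdZD1.
have [_ _ c0] := tdZD 0; have [_ _ c1] := tdZD 1; have [_ _ c2] := tdZD ord_max.
have E i : (p' *m (tdZ phi y p)^T) 0 i = p' 0 0 * tdZ phi y p i 0 + p' 0 1 * tdZ phi y p i 1
   + p' 0 ord_max * tdZ phi y p i ord_max.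
  by rewrite mxE sum3 ![_^T _ _]mxE.
have W i : tdW phi y p 0 i = td1 om y p i by rewrite mxE ocD.
split=> [e|[e0 e1 e2]].
  by rewrite -!W e !E a0 a1 a2 b0 b1 b2 c0 c1 c2 !mulr0 !add0r.
by apply/rowP; apply: ord3P; rewrite W E ?a0 ?a1 ?a2 ?b0 ?b1 ?b2 ?c0 ?c1 ?c2 ?mulr0 ?add0r.
Qed.

(** Of the three entries of the direction condition the first two hold automatically for this form
    of [phi]; the last one is [D_x U = X_x om]. *)
Lemma condDE : condD th th' phi y p p' <->
  pd 1 U z + fiber y * pd ord_max U z = pd 1 X q * om y /\
  pd ord_max om y * (p 0 0 - GD th y p)
   + cA th q * (td2 om y p 1 1 - p' 0 1 * pd 1 (pd 1 X) q - p' 0 ord_max * pd 1 (pd 1 U) z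
     + fiber y * (td2 om y p 1 ord_max + td2 om y p ord_max 1
         - p' 0 ord_max * (pd ord_max (pd 1 U) z + pd 1 (pd ord_max U) z))
     + fiber y ^+ 2 * (td2 om y p ord_max ord_max - p' 0 ord_max * pd ord_max (pd ord_max U) z))
  = cA th q * pd 1 X q ^+ 2 * ((p' 0 0 - GD th' (phi y) p') / cA th' (img T X q)).
Proof.
have [a0 a1 a2] := tdZD0; have [b0 b1 b2] := tdZD1.
have [_ _ c0] := tdZD 0; have [_ _ c1] := tdZD 1; have [_ _ c2] := tdZD ord_max.
have LE : tdL phi y p' = pd ord_max om y.
  by rewrite /tdL sum3 ocD zcD0 zcD1 zcDm !pd_max_baseF !mulr0 !addr0 subr0.
have NE i l : i != 0 -> tdN phi y p p' i l = td2 om y p i l - p' 0 1 * pd l (pd i (X \o base)) z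
    - p' 0 ord_max * pd l (pd i U) z.
  move=> i0; rewrite mxE sum3 ocD zcD0 zcD1 zcDm !td2_base.
  have -> : pd i (time T \o base) = fun=> 0.
    move: i i0; apply: ord3P => // _; last exact: pd_max_baseF.
    by rewrite pd1_base2; apply/funext => x; exact: pd1_time.
  by rewrite pd_cst mulr0 add0r opprD addrA.
rewrite /condD /par_cond LE qfD3 !NE // nuD_mul b1 b2 mulr0 addr0.
rewrite !pd1_base2 !pd_max_baseF !pd_cst /= -/q !mulr0 !subr0.
rewrite /alD -/z -/q.
have -> : base (base (phi y)) = img T X q by rewrite /phi /phiD /phiL !base_adjoin.
set N1 := (X in cA th q * X); set N2 := (X in _ <-> _ /\ _ + _ * X = _).
have -> : N1 = N2 by rewrite /N1 /N2; gen_pd; ring.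
have Fp : fiber (phi y) = om y by rewrite /phi /phiD fiber_adjoin.
split=> [[e1 ->]|[e1 ->]]; split=> //.
  have := congr1 (fun A : 'rV[R]_3 => A 0 ord_max) e1.
  by rewrite nuD_mul c1 c2 mxE nuDm Fp.
apply/rowP; apply: ord3P; rewrite nuD_mul [RHS]mxE.
- by rewrite a1 a2 nuD0 !mulr0 addr0.
- by rewrite b1 b2 nuD1 mulr0 addr0 mulr1.
- by rewrite c1 c2 nuDm Fp.
Qed.
End D.

End Conditions.

(** * The transformation rules as identities in a field *)

Section ScalarL.
Context {F : fieldType}.
Variables (A B C A' B' C' Tt Xt Xx Xxx U1 U1x U Ut Ux Uxx u : F).
Hypotheses (A0 : A != 0) (A0' : A' != 0) (T0 : Tt != 0) (X0 : Xx != 0) (U10 : U1 != 0).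

(** Values of functions and of their derivatives become independent field elements, so that only
    rational identities remain. *)
Definition eqL_scalar p0 p1 P0 P1 :=
  U1 * (p0 - (B * p1 + C * u)) + A * (Uxx + 2 * p1 * U1x - P1 * Xxx)
  = A * Xx ^+ 2 * ((P0 - (B' * P1 + C' * U)) / A').

(* The rules for A and B with denominators cleared.  For [(U, u) = (U1, 1)] the
   third formula is the rule for C, and for [(U, u) = (U0, 0)] it says that
   [U0 / U1] solves the initial equation. *)
Definition fml1 := Xx ^+ 2 * A = Tt * A'.
Definition fml2 := U1 * Tt * B' = U1 * Xx * B - 2 * Xx * U1x * A - U1 * Xt + U1 * A * Xxx.
Definition fml3 :=
  U1 * (Ut - Tt * C' * U - A * Uxx - B * Ux + C * U1 * u) + 2 * A * U1x * Ux = 0.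

Lemma fml1_solve : fml1 -> A' = Xx ^+ 2 * A / Tt.
Proof. by move=> ->; rewrite mulrC mulKf. Qed.

Lemma fml2_solve : fml2 ->
  B' = (U1 * Xx * B - 2 * Xx * U1x * A - U1 * Xt + U1 * A * Xxx) / (U1 * Tt).
Proof. by move=> <-; rewrite mulrC mulKf // mulf_neq0. Qed.

Lemma fml3_solve : fml3 ->
  Ut = Tt * C' * U + A * Uxx + B * Ux - C * U1 * u - 2 * A * U1x * Ux / U1.
Proof. move=> e; apply: (mulfI U10); apply/eqP; rewrite -subr_eq0 -[X in _ == X]e; apply/eqP; field. exact: U10. Qed.

Lemma eqL_scalarI p0 p1 P0 P1 : fml1 -> fml2 -> fml3 ->
  Ut + p0 * U1 = P0 * Tt + P1 * Xt -> Ux + p1 * U1 = P1 * Xx ->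
  eqL_scalar p0 p1 P0 P1.
Proof.
move=> /fml1_solve f1 /fml2_solve f2 /fml3_solve f3 e0 e1.
have P1E : P1 = (Ux + p1 * U1) / Xx by rewrite e1 mulfK.
have P0E : P0 = (Ut + p0 * U1 - P1 * Xt) / Tt by rewrite e0 addrK mulfK.
rewrite /eqL_scalar P0E P1E f1 f2 f3; field.
by rewrite U10 T0 X0 A0.
Qed.

(** With [P0] and [P1] solved from the contact conditions, the equation is affine in [p0] and [p1].
    Its slopes give the rules for A and B, and its constant term gives [fml3]. *)
Lemma eqL_scalarE : (forall p0 p1 P0 P1,
    Ut + p0 * U1 = P0 * Tt + P1 * Xt -> Ux + p1 * U1 = P1 * Xx -> eqL_scalar p0 p1 P0 P1) ->
  [/\ fml1, fml2 & fml3].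
Proof.
move=> H.
have H' p0 p1 : eqL_scalar p0 p1 ((Ut + p0 * U1 - (Ux + p1 * U1) / Xx * Xt) / Tt) ((Ux + p1 * U1) / Xx).
  by apply: H; rewrite mulfVK // subrK.
have h00 := H' 0 0; have h10 := H' 1 0; have h01 := H' 0 1; rewrite /eqL_scalar in h00 h10 h01.
have f1 : fml1.
  have : U1 = A * Xx ^+ 2 * (U1 / Tt) / A'.
    transitivity ((U1 * (1 - (B * 0 + C * u)) + A * (Uxx + 2 * 0 * U1x - (Ux + 0 * U1) / Xx * Xxx))
       - (U1 * (0 - (B * 0 + C * u)) + A * (Uxx + 2 * 0 * U1x - (Ux + 0 * U1) / Xx * Xxx))); first by ring.
    by rewrite h10 h00; field; rewrite A0' T0 X0.
  move=> e; rewrite /fml1; apply: (mulfI U10); rewrite {2}e; field; by rewrite A0' T0.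
have AE := fml1_solve f1.
have f2 : fml2.
  have e : 2 * A * U1x - A * U1 / Xx * Xxx - U1 * B = A * Xx ^+ 2 * (- (U1 / Xx * Xt) / Tt - B' * U1 / Xx) / A'.
    transitivity ((U1 * (0 - (B * 1 + C * u)) + A * (Uxx + 2 * 1 * U1x - (Ux + 1 * U1) / Xx * Xxx))
       - (U1 * (0 - (B * 0 + C * u)) + A * (Uxx + 2 * 0 * U1x - (Ux + 0 * U1) / Xx * Xxx))); first by field.
    by rewrite h01 h00; field; rewrite A0' T0 X0.
  rewrite AE in e.
  rewrite /fml2; transitivity (- Xx * (2 * A * U1x - A * U1 / Xx * Xxx - U1 * B) - U1 * Xt).
    by rewrite e; field; rewrite A0 T0 X0.
  by field.
split=> //.
have BE := fml2_solve f2.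
have e : U1 * ((U1 * (0 - (B * 0 + C * u)) + A * (Uxx + 2 * 0 * U1x - (Ux + 0 * U1) / Xx * Xxx))
   - A * Xx ^+ 2 * (((Ut + 0 * U1 - (Ux + 0 * U1) / Xx * Xt) / Tt - (B' * ((Ux + 0 * U1) / Xx) + C' * U)) / A')) = 0.
  by rewrite h00 subrr mulr0.
rewrite /fml3 -[RHS]oppr0 -[in RHS]e AE BE; field.
by rewrite A0 T0 X0 U10.
Qed.

End ScalarL.

Section ScalarD.
Context {F : fieldType}.
Variables (A B C Ax Bx Cx A' B' C' Ax' Bx' Cx' : F).
Variables (Tt Xt Xx Xxx Xxt Xxxx U1 U1t U1x U1xx U Ut Ux Uxx Uxt Uxxx u w : F).
(* [al * w + ps] is the new value of eta, where [ps] stands for the affine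
   function [(U1_x / X_x) u + U0_x / X_x] of u, with slope [be]. *)
Variables (al alx alt alxx be bex ps psx pst psxx : F).
Hypotheses (A0 : A != 0) (A0' : A' != 0) (T0 : Tt != 0) (X0 : Xx != 0) (U10 : U1 != 0).
Hypotheses (alE : al * Xx = U1) (alxE : alx * Xx + al * Xxx = U1x)
  (altE : alt * Xx + al * Xxt = U1t)
  (alxxE : alxx * Xx + 2 * alx * Xxx + al * Xxxx = U1xx)
  (beE : be * Xx = U1x) (bexE : bex * Xx + be * Xxx = U1xx)
  (psE : ps * Xx = Ux) (psxE : psx * Xx + ps * Xxx = Uxx)
  (pstE : pst * Xx + ps * Xxt = Uxt)
  (psxxE : psxx * Xx + 2 * psx * Xxx + ps * Xxxx = Uxxx).

Definition eqD_scalar p0 p1 p2 P0 P1 P2 :=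
  al * (p0 - (Ax * (p1 + w * p2) + (Bx * w + B * p1) + C * (w - u * p2) + Cx * u))
  + A * (alxx * w + psxx + 2 * p1 * alx - P1 * Xxx - P2 * Uxx
         + w * (2 * (bex + p2 * alx) - P2 * (2 * U1x)))
  = A * Xx ^+ 2 * ((P0 - (Ax' * (P1 + (al * w + ps) * P2) + (Bx' * (al * w + ps) + B' * P1)
                          + C' * ((al * w + ps) - U * P2) + Cx' * U)) / A').

Let f1 := fml1 A A' Tt Xx.
Let f2 := fml2 A B B' Tt Xt Xx Xxx U1 U1x.
Let f34 := fml3 A B C C' Tt U1 U1x U Ut Ux Uxx u.

(* [fml1], [fml2] and [fml3] differentiated with respect to x. *)
Definition fml1x := 2 * Xx * Xxx * A + Xx ^+ 2 * Ax = Tt * (Ax' * Xx).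
Definition fml2x := U1x * Tt * B' + U1 * Tt * (Bx' * Xx) =
  U1x * Xx * B + U1 * Xxx * B + U1 * Xx * Bx
  - 2 * (Xxx * U1x * A + Xx * U1xx * A + Xx * U1x * Ax)
  - U1x * Xt - U1 * Xxt + U1x * A * Xxx + U1 * Ax * Xxx + U1 * A * Xxxx.
Definition fml30 := U1 * (U1t - Tt * C' * U1 - A * U1xx - B * U1x + C * U1) + 2 * A * U1x * U1x = 0.
Definition fml3x :=
  U1x * (Ut - Tt * C' * U - A * Uxx - B * Ux + C * U1 * u)
  + U1 * (Uxt - Tt * (Cx' * Xx) * U - Tt * C' * Ux - Ax * Uxx - A * Uxxx - Bx * Ux - B * Uxx
          + Cx * U1 * u + C * U1x * u)
  + 2 * (Ax * U1x * Ux + A * U1xx * Ux + A * U1x * Uxx) = 0.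

Lemma fml1x_solve : fml1x -> Ax' = (2 * Xx * Xxx * A + Xx ^+ 2 * Ax) / (Tt * Xx).
Proof. by move=> ->; field; rewrite T0 X0. Qed.

Lemma fml2x_solve : fml2x -> Bx' = (U1x * Xx * B + U1 * Xxx * B + U1 * Xx * Bx
  - 2 * (Xxx * U1x * A + Xx * U1xx * A + Xx * U1x * Ax)
  - U1x * Xt - U1 * Xxt + U1x * A * Xxx + U1 * Ax * Xxx + U1 * A * Xxxx - U1x * Tt * B') / (U1 * Tt * Xx).
Proof. by move=> <-; field; rewrite T0 X0 U10. Qed.

Lemma fml30_solve : fml30 -> U1t = Tt * C' * U1 + A * U1xx + B * U1x - C * U1 - 2 * A * U1x * U1x / U1.
Proof.
move=> e; apply: (mulfI U10); apply/eqP; rewrite -subr_eq0 -[X in _ == X]e; apply/eqP.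
by field.
Qed.

Lemma fml3x_solve : fml3x -> Uxt = - (U1x * (Ut - Tt * C' * U - A * Uxx - B * Ux + C * U1 * u)
    + 2 * (Ax * U1x * Ux + A * U1xx * Ux + A * U1x * Uxx)) / U1
  + Tt * (Cx' * Xx) * U + Tt * C' * Ux + Ax * Uxx + A * Uxxx + Bx * Ux + B * Uxx
          - Cx * U1 * u - C * U1x * u.
Proof.
move=> e; apply: (mulfI U10); apply/eqP; rewrite -subr_eq0 -[X in _ == X]e; apply/eqP.
by field.
Qed.

(** Everything is expressed through the source coefficients and the derivatives of X and U. The
    rules also eliminate the time derivatives [Ut], [U1t] and [Uxt]; what is left is a rational
    identity. *)
Lemma eqD_scalarI p0 p1 p2 P0 P1 P2 :
  f1 -> f2 -> f34 -> fml1x -> fml2x -> fml30 -> fml3x ->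
  alt * w + pst + p0 * al = P0 * Tt + P1 * Xt + P2 * Ut ->
  alx * w + psx + p1 * al = P1 * Xx + P2 * Ux -> be + p2 * al = P2 * U1 ->
  eqD_scalar p0 p1 p2 P0 P1 P2.
Proof.
move=> /(fml1_solve T0) g1 /(fml2_solve T0 U10) g2 /(fml3_solve U10) g3 /fml1x_solve g4 /fml2x_solve g5
  /fml30_solve g6 /fml3x_solve g7 e0 e1 e2.
have P2E : P2 = (be + p2 * al) / U1 by rewrite e2 mulfK.
have P1E : P1 = (alx * w + psx + p1 * al - P2 * Ux) / Xx by rewrite e1 addrK mulfK.
have P0E : P0 = (alt * w + pst + p0 * al - P2 * Ut - P1 * Xt) / Tt.
  by rewrite e0 addrK addrK mulfK.
have h1 : al = U1 / Xx by rewrite -alE mulfK.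
have h2 : alx = (U1x - al * Xxx) / Xx by rewrite -alxE addrK mulfK.
have h3 : alt = (U1t - al * Xxt) / Xx by rewrite -altE addrK mulfK.
have h4 : alxx = (U1xx - al * Xxxx - 2 * alx * Xxx) / Xx by rewrite -alxxE addrK addrK mulfK.
have h5 : be = U1x / Xx by rewrite -beE mulfK.
have h6 : bex = (U1xx - be * Xxx) / Xx by rewrite -bexE addrK mulfK.
have h7 : ps = Ux / Xx by rewrite -psE mulfK.
have h8 : psx = (Uxx - ps * Xxx) / Xx by rewrite -psxE addrK mulfK.
have h9 : pst = (Uxt - ps * Xxt) / Xx by rewrite -pstE addrK mulfK.
have h10 : psxx = (Uxxx - ps * Xxxx - 2 * psx * Xxx) / Xx by rewrite -psxxE addrK addrK mulfK.
rewrite /eqD_scalar P0E P1E P2E h10 h9 h8 h7 h6 h5 h4 h3 h2 h1 g7 g6 g5 g4 g3 g2 g1.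
field.
by rewrite A0 T0 X0 U10.
Qed.

Hypothesis eqD : forall p0 p1 p2 P0 P1 P2,
  alt * w + pst + p0 * al = P0 * Tt + P1 * Xt + P2 * Ut ->
  alx * w + psx + p1 * al = P1 * Xx + P2 * Ux -> be + p2 * al = P2 * U1 ->
  eqD_scalar p0 p1 p2 P0 P1 P2.

Let P2 p2 := (be + p2 * al) / U1.
Let P1 p1 p2 := (alx * w + psx + p1 * al - P2 p2 * Ux) / Xx.
Let P0 p0 p1 p2 := (alt * w + pst + p0 * al - P2 p2 * Ut - P1 p1 p2 * Xt) / Tt.

Lemma eqD_solved p0 p1 p2 : eqD_scalar p0 p1 p2 (P0 p0 p1 p2) (P1 p1 p2) (P2 p2).
Proof.
by apply: eqD; rewrite /P0 /P1 /P2 !mulfVK //; ring.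
Qed.

(* The gap between the two sides of the equation, an affine function of
   [p0, p1, p2] whose coefficients yield the formulas. *)
Let gap p0 p1 p2 :=
  al * (p0 - (Ax * (p1 + w * p2) + (Bx * w + B * p1) + C * (w - u * p2) + Cx * u))
  + A * (alxx * w + psxx + 2 * p1 * alx - P1 p1 p2 * Xxx - P2 p2 * Uxx
         + w * (2 * (bex + p2 * alx) - P2 p2 * (2 * U1x)))
  - A * Xx ^+ 2 * ((P0 p0 p1 p2 - (Ax' * (P1 p1 p2 + (al * w + ps) * P2 p2) + (Bx' * (al * w + ps) + B' * P1 p1 p2)
                          + C' * ((al * w + ps) - U * P2 p2) + Cx' * U)) / A').

Lemma gap0 p0 p1 p2 : gap p0 p1 p2 = 0.
Proof. by rewrite /gap (eqD_solved p0 p1 p2) subrr. Qed.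

Let h1 : al = U1 / Xx. Proof. by rewrite -alE mulfK. Qed.
Let h2 : alx = (U1x - al * Xxx) / Xx. Proof. by rewrite -alxE addrK mulfK. Qed.
Let h5 : be = U1x / Xx. Proof. by rewrite -beE mulfK. Qed.
Let h7 : ps = Ux / Xx. Proof. by rewrite -psE mulfK. Qed.

Lemma eqD_scalarE1 : f1.
Proof.
have e : (gap 1 0 0 - gap 0 0 0) * (Xx * Tt * A' / U1) = 0 by rewrite !gap0 subrr mul0r.
rewrite /f1 /fml1; apply/eqP; rewrite -subr_eq0 -oppr_eq0 -[X in _ == X]e; apply/eqP.
rewrite /gap /P0 /P1 /P2 h5 h1; field.
by rewrite A0' T0 X0 U10.
Qed.

(** The slope of [gap] in [p1] contains both [Ax] and [Ax']. A relation between them does not follow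
    from conditions at a single point, so it is a premise. *)
Lemma eqD_scalarE2 : fml1x -> f2.
Proof.
move=> /fml1x_solve g4; have g1 := fml1_solve T0 eqD_scalarE1.
have e : (gap 0 1 0 - gap 0 0 0) * Xx ^+ 2 = 0 by rewrite !gap0 subrr mul0r.
rewrite /f2 /fml2; apply/eqP; rewrite -subr_eq0 -[X in _ == X]e; apply/eqP.
rewrite /gap /P0 /P1 /P2 h5 h2 h1 g4 g1; field.
by rewrite A0 T0 X0 U10.
Qed.

(** The slope of [gap] in [p2] is where C enters undifferentiated and multiplied by u, through the
    term [C (eta - u eta_u)]. *)
Lemma eqD_scalarE3 : fml1x -> f34.
Proof.
move=> fx; have /(fml2_solve T0 U10) g2 := eqD_scalarE2 fx.
have /fml1x_solve g4 := fx; have g1 := fml1_solve T0 eqD_scalarE1.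
have e : (gap 0 0 1 - gap 0 0 0) * (Xx * U1) = 0 by rewrite !gap0 subrr mul0r.
rewrite /f34 /fml3; apply/eqP; rewrite -[X in _ == X]e; apply/eqP.
rewrite /gap /P0 /P1 /P2 h7 h5 h2 h1 g4 g2 g1; field.
by rewrite A0 T0 X0 U10.
Qed.

End ScalarD.

(* Otherwise unification of derivatives unfolds limits. *)
Opaque pd.

(** * Germs of transformations *)

Section Germs.
Context {R : realType}.

Lemma near_near m (y : 'rV[R]_m) (P : 'rV[R]_m -> Prop) :
  (\forall z \near y, P z) -> \forall z \near y, \forall x \near z, P x.
Proof. by move/near_join. Qed.

Lemma near2 m (y : 'rV[R]_m) (P Q S : 'rV[R]_m -> Prop) :
  (forall z, P z -> Q z -> S z) ->
  (\forall z \near y, P z) -> (\forall z \near y, Q z) -> \forall z \near y, S z.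
Proof. by move=> H; exact: filterS2. Qed.

Section Prolong.
Context {n : nat}.
Implicit Types (y : 'rV[R]_n.+1) (f g : 'rV[R]_n.+1 -> R) (phi psi : 'rV[R]_n.+1 -> 'rV[R]_n.+1).

Lemma near_pd_eq f g y i : (\forall z \near y, f z = g z) ->
  \forall z \near y, pd i f z = pd i g z.
Proof. by move=> /near_near E; apply: filterS E => z; exact: pd_near_eq. Qed.

Lemma td1_near_eq f g y p i : (\forall z \near y, f z = g z) -> td1 f y p i = td1 g y p i.
Proof. by move=> fg; rewrite /td1 !(pd_near_eq _ fg). Qed.

Lemma td2_near_eq f g y p i k : (\forall z \near y, f z = g z) -> td2 f y p i k = td2 g y p i k.
Proof.
move=> fg; have e a b : pd a (pd b f) y = pd a (pd b g) y by apply/pd_near_eq/near_pd_eq.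
exact: (congr2 +%R (congr2 +%R (congr2 +%R (e _ _) (congr1 _ (e _ _))) (congr1 _ (e _ _))) (congr1 _ (e _ _))).
Qed.

Lemma near_coord_eq phi psi y (k : 'I_n.+1) : (\forall z \near y, phi z = psi z) ->
  \forall z \near y, phi z 0 k = psi z 0 k.
Proof. by apply: filterS => z ->. Qed.

(** Prolongation involves only the value and derivatives at the base point, so a transformation may
    be replaced by its normal form on a neighbourhood. *)
Lemma prolong_near_eq phi psi j j' : (\forall z \near jpt j, phi z = psi z) ->
  prolong phi j j' -> prolong psi j j'.
Proof.
move=> E /prolongP[e0 e1 e2 e3]; apply/prolongP.
have oE : \forall z \near jpt j, oc phi z = oc psi z := near_coord_eq _ E.
have zE k : \forall z \near jpt j, zc phi k z = zc psi k z := near_coord_eq _ E.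
have ZE : tdZ phi (jpt j) (jd1 j) = tdZ psi (jpt j) (jd1 j).
  by apply/matrixP => i k; rewrite !mxE (td1_near_eq _ _ (zE k)).
have WE : tdW phi (jpt j) (jd1 j) = tdW psi (jpt j) (jd1 j).
  by apply/rowP => i; rewrite !mxE (td1_near_eq _ _ oE).
have LE : tdL phi (jpt j) (jd1 j') = tdL psi (jpt j) (jd1 j').
  rewrite /tdL (pd_near_eq _ oE); congr (_ - _); apply: eq_bigr => k _.
  by rewrite (pd_near_eq _ (zE k)).
have NE : tdN phi (jpt j) (jd1 j) (jd1 j') = tdN psi (jpt j) (jd1 j) (jd1 j').
  have td i l := td2_near_eq (jd1 j) i l oE.
  have tz k i l := td2_near_eq (jd1 j) i l (zE k).
  apply/matrixP => i l.
  have sE : \sum_k jd1 j' 0 k * td2 (zc phi k) (jpt j) (jd1 j) i l =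
      \sum_k jd1 j' 0 k * td2 (zc psi k) (jpt j) (jd1 j) i l.
    apply: eq_bigr => k _; rewrite tz; reflexivity.
  by rewrite [LHS]mxE [RHS]mxE; exact: (congr2 (fun a b => a - b) (td i l) sE).
split; first by rewrite e0; exact: nbhs_singleton E.
- by rewrite -ZE.
- by rewrite -WE -ZE.
- by rewrite -NE -LE -ZE.
Qed.

Lemma pdJ_near_eq phi psi y : (\forall z \near y, phi z = psi z) -> pdJ phi y = pdJ psi y.
Proof.
move=> E; apply/matrixP => i k; rewrite [LHS]mxE [RHS]mxE.
exact: pd_near_eq (near_coord_eq k E).
Qed.

Lemma point_transformationP phi y : point_transformation phi y <->
  (forall i, analytic_near (fun y => phi y 0 i) y) /\ \det (pdJ phi y) != 0.
Proof.
by split=> -[an J]; split=> //; move: J; rewrite jacobianE // => k;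
  apply: analytic_near_at.
Qed.

Lemma point_transformation_germ phi psi y : (\forall z \near y, phi z = psi z) ->
  point_transformation phi y -> point_transformation psi y.
Proof.
move=> E /point_transformationP[an J]; apply/point_transformationP.
rewrite -(pdJ_near_eq E); split=> // i.
exact: analytic_near_eq (near_coord_eq i E) (an i).
Qed.

Lemma near_forall_ord m (Q : 'I_m -> 'rV[R]_n.+1 -> Prop) y :
  (forall i, \forall z \near y, Q i z) -> \forall z \near y, forall i, Q i z.
Proof. by move=> H; exact: (@filter_forall _ _ Q (nbhs y) _ H). Qed.

Lemma point_transformation_open phi y : point_transformation phi y ->
  \forall z \near y, point_transformation phi z.
Proof.
move=> /point_transformationP[an J].
have an0 k : analytic_at (fun y => phi y 0 k) y := analytic_near_at (an k).
have h1 := near_forall_ord (fun i => near_near (an i)).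
apply: near2 h1 (near_det_pdJ an0 J) => z a b.
by apply/point_transformationP.
Qed.

Lemma near_point_transformation phi y (P : 'rV[R]_n.+1 -> Prop) :
  point_transformation phi y -> (\forall z \near phi y, P z) -> \forall z \near y, P (phi z).
Proof.
move=> [an _] H; apply: (continuous_row _ H) => k.
exact: analytic_differentiable (analytic_near_at (an k)).
Qed.

Lemma maps_diffeq_germ phi psi y (E E' : diffeq R n) : (\forall z \near y, phi z = psi z) ->
  maps_diffeq phi y E E' -> maps_diffeq psi y E E'.
Proof.
move=> /near_near e H; apply: near2 e H => z ez H j j' jz pr.
apply: (H j j' jz); apply: prolong_near_eq pr; rewrite jz.
by apply: filterS ez => x ->.
Qed.

End Prolong.

Lemma admissible_coefs_open (th : coefs R) (p : 'rV[R]_2) : admissible_coefs th p ->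
  \forall q \near p, admissible_coefs th q.
Proof.
move=> [a b c A0].
have h := near_continuous_neq0 (analytic_differentiable (analytic_near_at a)) A0.
by near=> q; split; near: q => //; exact: near_near.
Unshelve. all: by end_near. Qed.

Section Connects.
Context {n : nat}.
Variables (tx : 'rV[R]_n.+1 -> 'rV[R]_2) (E : coefs R -> diffeq R n).
Implicit Types (y : 'rV[R]_n.+1) (phi psi : 'rV[R]_n.+1 -> 'rV[R]_n.+1).
Hypothesis tx_near : forall y (P : 'rV[R]_2 -> Prop),
  (\forall p \near tx y, P p) -> \forall z \near y, P (tx z).

(** Identities derived at the base point therefore hold on a neighbourhood, where they can be
    differentiated or compared at several points. *)
Lemma connects_open y th th' phi : connects tx E y th th' phi ->
  \forall z \near y, connects tx E z th th' phi.
Proof.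
move=> [a a' pt m].
near=> z; split; near: z.
- exact: tx_near (admissible_coefs_open a).
- exact: (near_point_transformation pt (tx_near (admissible_coefs_open a'))).
- exact: point_transformation_open.
- exact: near_near.
Unshelve. all: by end_near. Qed.

Lemma connects_germ y th th' phi psi : (\forall z \near y, phi z = psi z) ->
  connects tx E y th th' phi -> connects tx E y th th' psi.
Proof.
move=> e [a a' pt m]; split.
- exact: a.
- by rewrite -(nbhs_singleton e); exact: a'.
- exact: point_transformation_germ e pt.
- exact: maps_diffeq_germ e m.
Qed.

Lemma triple_germ y th th' phi psi : (\forall z \near y, phi z = psi z) ->
  triple E y th th' phi = triple E y th th' psi.
Proof.
move=> e; rewrite /triple (nbhs_singleton e); congr (_, _, _).
by apply/seteqP; split=> f /= fe; apply: near2 e fe => z -> ->.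
Qed.

End Connects.

Lemma near_base2 (y : 'rV[R]_4) (P : 'rV[R]_2 -> Prop) :
  (\forall p \near base (base y), P p) -> \forall z \near y, P (base (base z)).
Proof. by move=> H; apply: (near_base (P := fun z => P (base z))); exact: near_base. Qed.

Lemma connectsL_open (y : 'rV[R]_3) th th' phi : connectsL y th th' phi ->
  \forall z \near y, @connectsL R z th th' phi.
Proof. by apply: connects_open => *; exact: near_base. Qed.

Lemma connectsD_open (y : 'rV[R]_4) th th' phi : connectsDE0 y th th' phi ->
  \forall z \near y, @connectsDE0 R z th th' phi.
Proof. by apply: connects_open => *; exact: near_base2. Qed.

Lemma connectsL_cond y th th' phi : @connectsL R y th th' phi -> forall p p',
  \det (tdZ phi y p) != 0 -> tdW phi y p = p' *m (tdZ phi y p)^T ->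
  condL th th' phi y p p'.
Proof.
move=> [[_ _ _ A0] [_ _ _ A0'] /point_transformationP[an J] m] p p'.
apply: (parabolic_necessary (parabolicL th) (parabolicL th') A0 A0' (nuL1 _)) => //.
- by move=> k; apply: analytic_near_at.
- exact: nbhs_singleton m.
Qed.

Lemma connectsD_cond y th th' phi : @connectsDE0 R y th th' phi -> forall p p',
  \det (tdZ phi y p) != 0 -> tdW phi y p = p' *m (tdZ phi y p)^T ->
  condD th th' phi y p p'.
Proof.
move=> [[_ _ _ A0] [_ _ _ A0'] /point_transformationP[an J] m] p p'.
apply: (parabolic_necessary (parabolicD th) (parabolicD th') A0 A0' (nuD1 _)) => //.
- by move=> k; apply: analytic_near_at.
- exact: nbhs_singleton m.
Qed.

End Germs.

(** * Functions affine in the last variable *)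

Section Affine.
Context {R : realType}.

Lemma analytic_near_base n (f : 'rV[R]_n -> R) (y : 'rV[R]_n.+1) :
  analytic_near f (base y) -> analytic_near (f \o base) y.
Proof. by move=> /near_base; apply: filterS => z; exact: analytic_base. Qed.

Lemma analytic_near_slice n (f : 'rV[R]_n.+1 -> R) z (w : R) :
  analytic_near f (adjoin z w) -> analytic_near (fun z => f (adjoin z w)) z.
Proof. by move=> /near_adjoin; apply: filterS => x; exact: analytic_slice. Qed.

Lemma analytic_near_pd n (f : 'rV[R]_n -> R) z i : analytic_near f z -> analytic_near (pd i f) z.
Proof. by apply: filterS => x; exact: analytic_pd. Qed.

Lemma analytic_near_add n (f g : 'rV[R]_n -> R) z : analytic_near f z -> analytic_near g z ->
  analytic_near (fun x => f x + g x) z.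
Proof. by apply: filterS2 => x; exact: analytic_add. Qed.

Lemma analytic_near_mul n (f g : 'rV[R]_n -> R) z : analytic_near f z -> analytic_near g z ->
  analytic_near (fun x => f x * g x) z.
Proof. by apply: filterS2 => x; exact: analytic_mul. Qed.

Lemma analytic_near_scale n (c : R) (f : 'rV[R]_n -> R) z : analytic_near f z ->
  analytic_near (fun x => c * f x) z.
Proof. by apply: filterS => x; exact: analytic_scale. Qed.

Lemma analytic_near_coord n (z : 'rV[R]_n) i : analytic_near (fun x => x 0 i) z.
Proof. by apply: filterE => x; exact: analytic_coord. Qed.

Lemma analytic_near_open n (f : 'rV[R]_n -> R) z : analytic_near f z ->
  \forall x \near z, analytic_near f x.
Proof. exact: near_near. Qed.

Lemma analytic_near_div n (f g : 'rV[R]_n -> R) z : analytic_near f z -> analytic_near g z ->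
  g z != 0 -> analytic_near (fun x => f x / g x) z.
Proof.
move=> af ag g0; apply: analytic_near_mul => //.
have := near_continuous_neq0 (analytic_differentiable (analytic_near_at ag)) g0.
by apply: filterS2 ag => x; exact: analytic_inv.
Qed.

Lemma analytic_near_aff n (a b : 'rV[R]_n -> R) (y : 'rV[R]_n.+1) :
  analytic_near a (base y) -> analytic_near b (base y) -> analytic_near (aff a b) y.
Proof.
move=> aa ab; apply: analytic_near_add; last exact: analytic_near_base.
by apply: analytic_near_mul; [exact: analytic_near_base | exact: analytic_near_coord].
Qed.

Lemma analytic_near_diff n (f : 'rV[R]_n -> R) z : analytic_near f z -> differentiable f z.
Proof. by move=> /analytic_near_at; exact: analytic_differentiable. Qed.

Section Pd.
Context {n : nat}.
Implicit Types (a b : 'rV[R]_n -> R) (y : 'rV[R]_n.+1).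

Lemma pd_max_aff a b y : differentiable a (base y) -> differentiable b (base y) ->
  pd ord_max (aff a b) y = a (base y).
Proof.
move=> da db.
have dc f : differentiable f (base y) -> differentiable (f \o @base R n) y.
  move=> df; apply: differentiable_comp => //; apply: differentiable_row => k.
  by under eq_fun do rewrite mxE; exact: differentiable_coord.
have df := @differentiable_fiber R n y.
have dm : differentiable ((a \o base) * @fiber R n) y.
  by apply: differentiableM; [exact: dc | exact: df].
rewrite /aff pd_add; [|exact: dm|exact: dc].
rewrite pd_mul; [|exact: dc|exact: df].
by rewrite pd_max_fiber !pd_max_base mul0r add0r mulr1 addr0.
Qed.

Lemma pd_lift_aff a b y k : differentiable a (base y) -> differentiable b (base y) ->
  pd (lift ord_max k) (aff a b) y = aff (pd k a) (pd k b) y.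
Proof.
move=> da db.
have dc f : differentiable f (base y) -> differentiable (f \o @base R n) y.
  move=> df; apply: differentiable_comp => //; apply: differentiable_row => i.
  by under eq_fun do rewrite mxE; exact: differentiable_coord.
have df := @differentiable_fiber R n y.
have dm : differentiable ((a \o base) * @fiber R n) y.
  by apply: differentiableM; [exact: dc | exact: df].
rewrite /aff pd_add; [|exact: dm|exact: dc].
rewrite pd_mul; [|exact: dc|exact: df].
by rewrite pd_lift_fiber !pd_lift_base mulr0 addr0.
Qed.

Lemma td1_aff a b y p i : differentiable a (base y) -> differentiable b (base y) ->
  td1 (aff a b) y p i = pd i a (base y) * fiber y + pd i b (base y) + p 0 i * a (base y).
Proof. by move=> da db; rewrite /td1 pd_lift_aff // pd_max_aff. Qed.

Variables (a b : 'rV[R]_n -> R) (y : 'rV[R]_n.+1).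
Hypotheses (ana : analytic_near a (base y)) (anb : analytic_near b (base y)).

Lemma near_pd_max_aff : \forall x \near y, pd ord_max (aff a b) x = (a \o base) x.
Proof.
move: (near_base ana) (near_base anb); apply: filterS2 => x ax bx.
by rewrite pd_max_aff //; exact: analytic_differentiable.
Qed.

Lemma near_pd_lift_aff k : \forall x \near y, pd (lift ord_max k) (aff a b) x = aff (pd k a) (pd k b) x.
Proof.
move: (near_base ana) (near_base anb); apply: filterS2 => x ax bx.
by rewrite pd_lift_aff //; exact: analytic_differentiable.
Qed.

Lemma pd2_aff_ll k l : pd (lift ord_max l) (pd (lift ord_max k) (aff a b)) y =
  aff (pd l (pd k a)) (pd l (pd k b)) y.
Proof.
rewrite (pd_near_eq _ (near_pd_lift_aff k)) pd_lift_aff //;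
  exact: analytic_near_diff (analytic_near_pd _ _).
Qed.

Lemma pd2_aff_ml k : pd ord_max (pd (lift ord_max k) (aff a b)) y = pd k a (base y).
Proof.
rewrite (pd_near_eq _ (near_pd_lift_aff k)) pd_max_aff //;
  exact: analytic_near_diff (analytic_near_pd _ _).
Qed.

Lemma pd2_aff_lm l : pd (lift ord_max l) (pd ord_max (aff a b)) y = pd l a (base y).
Proof. by rewrite (pd_near_eq _ near_pd_max_aff) pd_lift_base. Qed.

Lemma pd2_aff_mm : pd ord_max (pd ord_max (aff a b)) y = 0.
Proof. by rewrite (pd_near_eq _ near_pd_max_aff) pd_max_base. Qed.

Lemma td2_aff p i l : td2 (aff a b) y p i l =
  pd l (pd i a) (base y) * fiber y + pd l (pd i b) (base y)
  + p 0 l * pd i a (base y) + p 0 i * pd l a (base y).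
Proof.
rewrite /td2 pd2_aff_ll pd2_aff_ml pd2_aff_lm pd2_aff_mm /aff.
by rewrite mulr0 addr0.
Qed.
End Pd.

Section Params.
Variables (T : R -> R) (X U1 U0 : 'rV[R]_2 -> R).

(** Stated through functions of [(t, x)] only, which makes it an open condition on the base
    point. *)
Definition tr_ok p := [/\ analytic_near (time T) p, analytic_near X p, analytic_near U1 p,
  analytic_near U0 p & [/\ pd 0 (time T) p != 0, pd 1 X p != 0 & U1 p != 0]].

Lemma base1 (p : 'rV[R]_2) : base p = const_mx (p 0 0).
Proof. by apply/rowP => i; rewrite !mxE (ord1 i) -ord2_0. Qed.

Lemma tr_paramsP p : tr_params T X U1 U0 p <->
  analytic_near (fun s : 'rV[R]_1 => T (s 0 0)) (const_mx (p 0 0)) /\ tr_ok p.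
Proof.
have aT : analytic_near (fun s : 'rV[R]_1 => T (s 0 0)) (const_mx (p 0 0)) -> analytic_near (time T) p.
  rewrite -base1 => /analytic_near_base; apply: analytic_near_eq; apply: filterE => q.
  by rewrite /= base1 mxE.
rewrite /tr_ok pd0_time; split=> [[a b c d]|[a [_ b c d []]]].
  rewrite mulf_eq0 mulf_eq0 !negb_or => /andP[/andP[x y] z].
  by split=> //; split=> //; exact: aT.
by move=> x y z; split=> //; rewrite !mulf_neq0.
Qed.

Lemma tr_ok_open p : tr_ok p -> \forall q \near p, tr_ok q.
Proof.
move=> [aT aX a1 a0 [t x u]].
have h1 := near_continuous_neq0 (analytic_near_diff (analytic_near_pd 0 aT)) t.
have h2 := near_continuous_neq0 (analytic_near_diff (analytic_near_pd 1 aX)) x.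
have h3 := near_continuous_neq0 (analytic_near_diff a1) u.
near=> q; split; [..|split]; near: q; by [exact: h1|exact: h2|exact: h3|exact: analytic_near_open].
Unshelve. all: by end_near. Qed.

End Params.
End Affine.

(** * The transformation rules and the linear equations *)

Section FormulasL.
Context {R : realType}.
Implicit Types (th : coefs R) (T : R -> R) (X : 'rV[R]_2 -> R) (p : 'rV[R]_2).

(** The common criterion: admissibility in either class is equivalent to these identities near the
    base point, given the regularity conditions. *)
Definition formulas th th' T X (U1 U0 : 'rV[R]_2 -> R) p : Prop :=
  let q := img T X p in
  let Tt := pd 0 (time T) p in let Xx := pd 1 X p in
  [/\ fml1 (cA th p) (cA th' q) Tt Xx,
      fml2 (cA th p) (cB th p) (cB th' q) Tt (pd 0 X p) Xx (pd 1 (pd 1 X) p) (U1 p) (pd 1 U1 p),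
      fml3 (cA th p) (cB th p) (cC th p) (cC th' q) Tt (U1 p) (pd 1 U1 p)
        (U1 p) (pd 0 U1 p) (pd 1 U1 p) (pd 1 (pd 1 U1) p) 1 &
      fml3 (cA th p) (cB th p) (cC th p) (cC th' q) Tt (U1 p) (pd 1 U1 p)
        (U0 p) (pd 0 U0 p) (pd 1 U0 p) (pd 1 (pd 1 U0) p) 0].

(** [fml3] is linear in [U], its derivatives and [u] taken together, and
    [(U1 u + U0, u) = u (U1, 1) + (U0, 0)]. *)
Lemma fml3_aff (A B C C' Tt U1 U1t U1x U1xx U0 U0t U0x U0xx u : R) :
  fml3 A B C C' Tt U1 U1x U1 U1t U1x U1xx 1 -> fml3 A B C C' Tt U1 U1x U0 U0t U0x U0xx 0 ->
  fml3 A B C C' Tt U1 U1x (U1 * u + U0) (U1t * u + U0t) (U1x * u + U0x) (U1xx * u + U0xx) u.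
Proof.
rewrite /fml3 => e1 e0; rewrite -[RHS](addr0 0) -[X in _ = _ + X]e0 -[X in _ = X + _](mulr0 u) -[X in u * X]e1.
ring.
Qed.

Lemma fml3_aff_inv (A B C C' Tt U1 U1t U1x U1xx U0 U0t U0x U0xx u u' : R) : u != u' ->
  fml3 A B C C' Tt U1 U1x (U1 * u + U0) (U1t * u + U0t) (U1x * u + U0x) (U1xx * u + U0xx) u ->
  fml3 A B C C' Tt U1 U1x (U1 * u' + U0) (U1t * u' + U0t) (U1x * u' + U0x) (U1xx * u' + U0xx) u' ->
  fml3 A B C C' Tt U1 U1x U1 U1t U1x U1xx 1 /\ fml3 A B C C' Tt U1 U1x U0 U0t U0x U0xx 0.
Proof.
rewrite -subr_eq0 /fml3 => d0 e e'; split; apply: (mulfI d0); rewrite [RHS]mulr0.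
  by rewrite -[RHS](subrr 0) -[X in _ = X - _]e -[X in _ = _ - X]e'; ring.
have z : u * 0 - u' * 0 = 0 :> R by rewrite !mulr0 subrr.
by rewrite -[RHS]z -[X in _ = u * X - _]e' -[X in _ = _ - u' * X]e; ring.
Qed.

(** One increment [d] serves all nearby base points. Two heights suffice to split a relation affine
    in the last variable into its coefficients. *)
Lemma near_two_fibers n (y0 : 'rV[R]_n.+1) (P : 'rV[R]_n.+1 -> Prop) :
  (\forall y \near y0, P y) -> exists2 d, d != 0 &
  \forall z \near base y0, P (adjoin z (fiber y0)) /\ P (adjoin z (fiber y0 + d)).
Proof.
move=> /nbhs_shiftP[r r0 H]; exists (r / 2); first by rewrite gt_eqF // divr_gt0.
apply/nbhs_shiftP; exists r => // h hr.
have E d : adjoin (base y0 + h) (fiber y0 + d) = y0 + adjoin h d.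
  by rewrite adjoinD adjoin_base.
split; last by rewrite E; apply: H; apply: norm_adjoin_lt => //; rewrite ger0_norm; lra.
by rewrite -[fiber y0]addr0 E; apply: H; apply: norm_adjoin_lt => //; rewrite normr0.
Qed.

Lemma row2E (a b : R) : exists p : 'rV[R]_2, p 0 0 = a /\ p 0 1 = b.
Proof. by exists (\row_i [:: a; b]`_i); rewrite !mxE. Qed.

Section At.
Variables (th th' : coefs R) (T : R -> R) (X U1 U0 : 'rV[R]_2 -> R) (y : 'rV[R]_3).
Let p := base y.
Let u := fiber y.
Hypothesis ok : tr_ok T X U1 U0 p.
Hypotheses (A0 : cA th p != 0) (A0' : cA th' (img T X p) != 0).

Let a1 : analytic_near U1 p. Proof. by case: ok. Qed.
Let a0 : analytic_near U0 p. Proof. by case: ok. Qed.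
Let T0 : pd 0 (time T) p != 0. Proof. by case: ok => _ _ _ _ []. Qed.
Let X0 : pd 1 X p != 0. Proof. by case: ok => _ _ _ _ []. Qed.
Let U10 : U1 p != 0. Proof. by case: ok => _ _ _ _ []. Qed.

Let Ut := pd 0 U1 p * u + pd 0 U0 p.
Let Ux := pd 1 U1 p * u + pd 1 U0 p.
Let Uxx := pd 1 (pd 1 U1) p * u + pd 1 (pd 1 U0) p.

Lemma condL_scalar v v' : condL th th' (trL T X U1 U0) y v v' <->
  eqL_scalar (cA th p) (cB th p) (cC th p) (cA th' (img T X p)) (cB th' (img T X p))
    (cC th' (img T X p)) (pd 1 X p) (pd 1 (pd 1 X) p) (U1 p) (pd 1 U1 p)
    (U1 p * u + U0 p) Uxx u (v 0 0) (v 0 1) (v' 0 0) (v' 0 1).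
Proof.
have d1 := analytic_near_diff a1; have d0 := analytic_near_diff a0.
rewrite trLE condLE pd_max_aff // (td2_aff a1 a0).
rewrite -/p -/u -/Uxx /eqL_scalar /GL /aff -/p -/u.
have -> : Uxx + v 0 1 * pd 1 U1 p + v 0 1 * pd 1 U1 p = Uxx + 2 * v 0 1 * pd 1 U1 p.
  by move: (pd 1 U1 p) => k; ring.
exact: iff_refl.
Qed.

Lemma tdWL_scalar v v' :
  tdW (trL T X U1 U0) y v = v' *m (tdZ (trL T X U1 U0) y v)^T <->
  Ut + v 0 0 * U1 p = v' 0 0 * pd 0 (time T) p + v' 0 1 * pd 0 X p /\
  Ux + v 0 1 * U1 p = v' 0 1 * pd 1 X p.
Proof.
have d1 := analytic_near_diff a1; have d0 := analytic_near_diff a0.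
by rewrite trLE tdWL !td1_aff.
Qed.

Lemma det_tdZ_trL v : \det (tdZ (trL T X U1 U0) y v) != 0.
Proof. by rewrite trLE det_tdZL mulf_neq0. Qed.

Lemma condL_formulas :
  (forall v v', \det (tdZ (trL T X U1 U0) y v) != 0 ->
     tdW (trL T X U1 U0) y v = v' *m (tdZ (trL T X U1 U0) y v)^T ->
     condL th th' (trL T X U1 U0) y v v') ->
  [/\ fml1 (cA th p) (cA th' (img T X p)) (pd 0 (time T) p) (pd 1 X p),
      fml2 (cA th p) (cB th p) (cB th' (img T X p)) (pd 0 (time T) p) (pd 0 X p)
        (pd 1 X p) (pd 1 (pd 1 X) p) (U1 p) (pd 1 U1 p) &
      fml3 (cA th p) (cB th p) (cC th p) (cC th' (img T X p)) (pd 0 (time T) p) (U1 p)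
        (pd 1 U1 p) (U1 p * u + U0 p) Ut Ux Uxx u].
Proof.
move=> H; apply: eqL_scalarE => // p0 p1 P0 P1 e0 e1.
have [v [v0 v1]] := row2E p0 p1; have [v' [v0' v1']] := row2E P0 P1.
rewrite -v0 -v1 -v0' -v1' in e0 e1 *.
apply/condL_scalar; apply: H; first exact: det_tdZ_trL.
by apply/tdWL_scalar.
Qed.

Lemma formulas_condL : formulas th th' T X U1 U0 p -> forall v v',
  tdW (trL T X U1 U0) y v = v' *m (tdZ (trL T X U1 U0) y v)^T ->
  condL th th' (trL T X U1 U0) y v v'.
Proof.
move=> [f1 f2 f3 f4] v v' /tdWL_scalar[e0 e1]; apply/condL_scalar.
by apply: eqL_scalarI f1 f2 (fml3_aff u f3 f4) e0 e1.
Qed.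
End At.

Lemma base_trL T X U1 U0 (y : 'rV[R]_3) : base (trL T X U1 U0 y) = img T X (base y).
Proof. by rewrite trLE /phiL base_adjoin. Qed.

Lemma connectsL_formulas (y0 : 'rV[R]_3) th th' T X U1 U0 :
  tr_ok T X U1 U0 (base y0) -> connectsL y0 th th' (trL T X U1 U0) ->
  \forall p \near base y0, formulas th th' T X U1 U0 p.
Proof.
move=> ok /connectsL_open/near_two_fibers[d d0 H].
move: (tr_ok_open ok) H; apply: filterS2 => p okp [c0 c1].
have A0 : cA th p != 0 by case: c0 => [[]]; rewrite base_adjoin.
have A0' : cA th' (img T X p) != 0 by case: c0 => [_ []]; rewrite base_trL base_adjoin.
have k0 := @condL_formulas th th' T X U1 U0 (adjoin p (fiber y0)).
have k1 := @condL_formulas th th' T X U1 U0 (adjoin p (fiber y0 + d)).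
rewrite !base_adjoin !fiber_adjoin in k0 k1.
have [f1 f2 g0] := k0 okp A0 A0' (connectsL_cond c0).
have [_ _ g1] := k1 okp A0 A0' (connectsL_cond c1).
have dd : fiber y0 + d != fiber y0 by rewrite -subr_eq0 addrAC subrr add0r.
by have [f3 f4] := fml3_aff_inv dd g1 g0.
Qed.

Lemma tr_ok_phiL T X U1 U0 (y : 'rV[R]_3) : tr_ok T X U1 U0 (base y) ->
  point_transformation (trL T X U1 U0) y.
Proof.
move=> [aT aX a1 a0 [t x u]]; apply/point_transformationP; split.
  move=> i; case: (unliftP ord_max i) => [k ->|->].
    move: k; apply: ord2P.
      by rewrite -[fun y => _]/(zc (phiL T X (aff U1 U0)) 0) zcL0; exact: analytic_near_base.
    by rewrite -[fun y => _]/(zc (phiL T X (aff U1 U0)) 1) zcL1; exact: analytic_near_base.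
  rewrite -[fun y => _]/(oc (phiL T X (aff U1 U0))) ocL; exact: analytic_near_aff.
rewrite trLE det_pdJ_L pd_max_aff; [|exact: analytic_near_diff a1|exact: analytic_near_diff a0].
by rewrite !mulf_neq0.
Qed.

Lemma formulas_connectsL (y0 : 'rV[R]_3) th th' T X U1 U0 :
  tr_ok T X U1 U0 (base y0) -> admissible_coefs th (base y0) ->
  admissible_coefs th' (img T X (base y0)) ->
  (\forall p \near base y0, formulas th th' T X U1 U0 p) ->
  connectsL y0 th th' (trL T X U1 U0).
Proof.
move=> ok ad ad' F; have pt := tr_ok_phiL ok.
split=> //; first by rewrite base_trL.
have ad'y : admissible_coefs th' (base (trL T X U1 U0 y0)) by rewrite base_trL.
have n1 := near_base (admissible_coefs_open ad).
have n2 := near_point_transformation pt (near_base (admissible_coefs_open ad'y)).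
have n3 := near_base F; have n4 := near_base (tr_ok_open ok).
have n5 := point_transformation_open pt.
rewrite /maps_diffeq; near=> y => j j' jy pr.
have oky : tr_ok T X U1 U0 (base y) by near: y; exact: n4.
have A0 : cA th (base y) != 0.
  have : admissible_coefs th (base y) by near: y; exact: n1.
  by case.
have A0' : cA th' (base (trL T X U1 U0 y)) != 0.
  have : admissible_coefs th' (base (trL T X U1 U0 y)) by near: y; exact: n2.
  by case.
have Fy : formulas th th' T X U1 U0 (base y) by near: y; exact: n3.
have J0 : \det (pdJ (trL T X U1 U0) y) != 0.
  have /point_transformationP[//] : point_transformation (trL T X U1 U0) y.
  by near: y; exact: n5.
have /prolongP[_ Z0 W _] := pr; rewrite jy in W.
apply: (parabolic_sufficient (parabolicL th) (parabolicL th') A0 A0' J0 jy pr).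
  rewrite nuL_mul trLE; have [_ _ _ ->] := tdZL T X (aff U1 U0) y (jd1 j).
  by case: oky => _ _ _ _ [].
apply: formulas_condL => //; by rewrite -base_trL.
Unshelve. all: by end_near. Qed.

End FormulasL.

(** * Transformations of the linear equations *)

Section StructureTools.
Context {R : realType}.

(** Three equally spaced points, the fewest that determine the leading coefficient of a quadratic
    function; conditions on slopes hold only on open sets. *)
Lemma near_line n (p : 'rV[R]_n) (P : 'rV[R]_n -> Prop) i : (\forall q \near p, P q) ->
  exists2 d : R, d != 0 & [/\ P p, P (p + d *: delta_mx 0 i) & P (p + (2 * d) *: delta_mx 0 i)].
Proof.
move=> /nbhs_shiftP[r r0 H]; exists (r / 4); first by rewrite gt_eqF // divr_gt0.
have K (c : R) : `|c| < r -> P (p + c *: delta_mx 0 i).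
  move=> cr; apply: H; apply: rV_norm_lt => // j; rewrite !mxE normrM /=.
  apply: le_lt_trans cr; rewrite ler_piMr //; case: (j == i); rewrite /= ?normr1 ?normr0 //.
split; first by rewrite -[p]addr0 -(scale0r (delta_mx 0 i)); apply: K; rewrite normr0.
- by apply: K; rewrite ger0_norm; lra.
- by apply: K; rewrite ger0_norm; lra.
Qed.

Lemma lineE n (p : 'rV[R]_n) (d : R) i : (p + d *: delta_mx 0 i) 0 i = p 0 i + d.
Proof. by rewrite !mxE !eqxx mulr1. Qed.

Lemma lineN n (p : 'rV[R]_n) (d : R) i j : j != i -> (p + d *: delta_mx 0 i) 0 j = p 0 j.
Proof. by move=> /negPf ji; rewrite !mxE ji andbF mulr0 addr0. Qed.

Lemma base_line_maxr n (y : 'rV[R]_n.+1) (d : R) :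
  base (y + d *: delta_mx 0 ord_max) = base y.
Proof. by rewrite addrC base_line_max. Qed.

(** The second difference of the square is [2 (d b)^2]. *)
Lemma sq_const_slope (a b d K : R) : d != 0 -> a ^+ 2 = K -> (a + d * b) ^+ 2 = K ->
  (a + 2 * d * b) ^+ 2 = K -> b = 0.
Proof.
move=> d0 e0 e1 e2.
have : 2 * (d * b) ^+ 2 = 0.
  have -> : 2 * (d * b) ^+ 2 = (a + 2 * d * b) ^+ 2 - 2 * (a + d * b) ^+ 2 + a ^+ 2 by ring.
  by rewrite e0 e1 e2; ring.
by move/eqP; rewrite mulf_eq0 sqrf_eq0 mulf_eq0 (negPf d0) pnatr_eq0 => /eqP.
Qed.

Lemma near_base_form n (f : 'rV[R]_n.+1 -> R) (y0 : 'rV[R]_n.+1) :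
  (\forall y \near y0, differentiable f y /\ pd ord_max f y = 0) ->
  \forall y \near y0, f y = ((fun z => f (adjoin z (fiber y0))) \o base) y.
Proof.
by move=> H; have := @pd_max_const R n f (base y0) (fiber y0); rewrite adjoin_base; apply.
Qed.

Lemma near_slice n (y0 : 'rV[R]_n.+1) (P : 'rV[R]_n.+1 -> Prop) : (\forall y \near y0, P y) ->
  \forall z \near base y0, P (adjoin z (fiber y0)).
Proof. by move=> H; apply: near_adjoin; rewrite adjoin_base. Qed.

Lemma near_time_form (f : 'rV[R]_2 -> R) (p0 : 'rV[R]_2) :
  (\forall p \near p0, differentiable f p /\ pd 1 f p = 0) ->
  exists T, \forall p \near p0, f p = time T p.
Proof.
rewrite ord2_1 => /near_base_form H; exists (fun s => f (adjoin (const_mx s) (fiber p0))).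
by apply: filterS H => p ->; rewrite /= base1.
Qed.

Lemma near_affine_form n (f : 'rV[R]_n.+1 -> R) (y0 : 'rV[R]_n.+1) :
  analytic_near f y0 -> (\forall y \near y0, pd ord_max (pd ord_max f) y = 0) ->
  exists a b : 'rV[R]_n -> R, [/\ analytic_near a (base y0), analytic_near b (base y0) &
    \forall y \near y0, f y = aff a b y].
Proof.
move=> af H.
have h1 : \forall y \near y0, differentiable (pd ord_max f) y /\ pd ord_max (pd ord_max f) y = 0.
  by move: (analytic_near_pd ord_max af) H; apply: filterS2 => y /analytic_differentiable.
have {}h1 := near_base_form h1.
pose a z := pd ord_max f (adjoin z (fiber y0)).
have aa : analytic_near a (base y0).
  by apply: analytic_near_slice; rewrite adjoin_base; exact: analytic_near_pd.
(* [g] is [f] minus its linear part in the last variable; its derivative there vanishes because the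
   slope of [f] is independent of the height. *)
pose m y := - 1 * aff a (fun=> 0) y; pose g y := f y + m y.
have ac0 : analytic_near (fun=> 0 : R) (base y0) by apply: filterE => x; exact: analytic_cst.
have h2 : \forall y \near y0, differentiable g y /\ pd ord_max g y = 0.
  have am := near_base aa.
  near=> y.
  have afy : analytic_at f y by near: y.
  have aay : analytic_at a (base y) by near: y.
  have ey : pd ord_max f y = a (base y) by near: y.
  have df := analytic_differentiable afy.
  have dA : differentiable (aff a (fun=> 0)) y.
    apply: analytic_differentiable; apply: analytic_add; last exact: analytic_cst.
    by apply: analytic_mul; [exact: analytic_base | exact: analytic_coord].
  have dm : differentiable m y.
    apply: differentiableM; [exact: differentiable_cst | exact: dA].
  have mE : pd ord_max m y = - 1 * a (base y).
    rewrite /m pd_mul; [|exact: differentiable_cst|exact: dA].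
    have da : differentiable a (base y) := analytic_differentiable aay.
    rewrite pd_cst mul0r add0r (pd_max_aff da (differentiable_cst _ _)).
    exact: erefl.
  split; first by apply: differentiableD; [exact: df | exact: dm].
  rewrite /g pd_add; [|exact: df|exact: dm].
  by rewrite mE ey; ring.
exists a, (fun z => g (adjoin z (fiber y0))); split; first exact: aa.
  apply: analytic_near_slice; rewrite adjoin_base; apply: analytic_near_add; first exact: af.
  by apply: analytic_near_scale; exact: analytic_near_aff.
apply: filterS (near_base_form h2) => y e; rewrite /aff -[g _]/(((fun z => g (adjoin z (fiber y0))) \o base) y).
by rewrite -e /g /m /aff; ring.
Unshelve. all: by end_near. Qed.

End StructureTools.

Section StructureL.
Context {R : realType}.
Implicit Types (th : coefs R).

Lemma trL_params (y0 : 'rV[R]_3) T X U1 U0 :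
  point_transformation (trL T X U1 U0) y0 -> tr_params T X U1 U0 (base y0).
Proof.
move=> pt; have /point_transformationP[an J] := pt.
have aT : analytic_near (time T \o base) y0.
  by rewrite -(zcL0 T X (aff U1 U0)); exact: an.
have aX : analytic_near (X \o base) y0.
  by rewrite -(zcL1 T X (aff U1 U0)); exact: an.
have aU : analytic_near (aff U1 U0) y0.
  by rewrite -(ocL T X (aff U1 U0)); exact: an.
have sl (f : 'rV[R]_2 -> R) : analytic_near (f \o base) y0 -> analytic_near f (base y0).
  rewrite -{1}[y0]adjoin_base => /analytic_near_slice; apply: analytic_near_eq.
  by apply: filterE => z; rewrite /= base_adjoin.
(* Analyticity of the map passes to its parameters: [U1] is a difference quotient of two slices of
   [U], and [U0] is what remains of one slice. *)
have [d d0 aU2] := near_two_fibers aU.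
have a1 : analytic_near U1 (base y0).
  apply: filterS aU2 => z [/analytic_slice b0 /analytic_slice b1].
  have := analytic_scale d^-1 (analytic_add b1 (analytic_scale (-1) b0)).
  apply: analytic_at_near_eq; apply: filterE => x.
  by rewrite /aff !base_adjoin !fiber_adjoin; field.
have a0 : analytic_near U0 (base y0).
  move: a1 aU2; apply: filterS2 => z b1 [/analytic_slice b0 _].
  have := analytic_add b0 (analytic_scale (- fiber y0) b1).
  apply: analytic_at_near_eq; apply: filterE => x.
  by rewrite /aff !base_adjoin !fiber_adjoin; ring.
have aT1 : analytic_near (fun s : 'rV[R]_1 => T (s 0 0)) (const_mx (base y0 0 0)).
  have := sl _ aT; rewrite -{1}[base y0]adjoin_base base1 => /analytic_near_slice.
  apply: analytic_near_eq; apply: filterE => s; rewrite /time {1}ord2_0 adjoin_lift //.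
apply/tr_paramsP; split=> //; split; [exact: sl|exact: sl|exact: a1|exact: a0|].
move: J; rewrite trLE det_pdJ_L pd_max_aff;
  [|exact: analytic_near_diff a1|exact: analytic_near_diff a0].
by rewrite !mulf_eq0 !negb_or => /andP[? /andP[]].
Qed.

(** The direction [nuL] has no time entry, so the direction condition says
    [D_x T = T_x + u_x T_u = 0] for all slopes in an open set. *)
Lemma structL_time (y : 'rV[R]_3) th th' phi : connectsL y th th' phi ->
  pd ord_max (zc phi 0) y = 0 /\ pd (lift ord_max 1) (zc phi 0) y = 0.
Proof.
move=> c; have [_ _ /point_transformationP[_ J] _] := c.
have [p np] := det_tdZ_near J.
have key q : \det (tdZ phi y q) != 0 ->
    pd (lift ord_max 1) (zc phi 0) y + q 0 1 * pd ord_max (zc phi 0) y = 0.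
  move=> Z0; have [q' W] := tdW_solve Z0.
  have [e _] := connectsL_cond c Z0 W.
  have : tdZ phi y q 1 0 = 0 by rewrite -(nuL_mul y) e [LHS]mxE nuL0 mulr0.
  by rewrite mxE.
have [d d0 [/key e0 /key e1 _]] := near_line 1 np.
move: e0 e1; rewrite lineE.
move: (pd ord_max _ _) (pd (lift _ _) _ _) => b a e0 e1.
have db : d * b = 0.
  transitivity ((a + (p 0 1 + d) * b) - (a + p 0 1 * b)); first by ring.
  by rewrite e0 e1 subrr.
have b0 : b = 0 by apply/eqP; move/eqP: db; rewrite mulf_eq0 (negPf d0).
by move: e0; rewrite b0 mulr0 addr0.
Qed.

(** In [A (X_x + u_x X_u)^2 = T_t A'] the slope [u_x] occurs only on the left. The time form of the
    first component is needed to vary the time derivative alone. *)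
Lemma structL_space (y : 'rV[R]_3) th th' phi T : connectsL y th th' phi ->
  (\forall z \near y, zc phi 0 z = (time T \o base) z) ->
  pd ord_max (zc phi 1) y = 0.
Proof.
move=> c zT; have [ad ad' /point_transformationP[an J] _] := c.
have [Tw Tx] := structL_time c.
have [p np] := det_tdZ_near J.
have key : nbhs p (fun q : 'rV[R]_2 => cA th (base y) *
    (pd (lift ord_max 1) (zc phi 1) y + q 0 1 * pd ord_max (zc phi 1) y) ^+ 2 =
    pd (lift ord_max 0) (zc phi 0) y * cA th' (base (phi y))).
  move: (near_near np); apply: filterS => q nq; have Zq := nbhs_singleton nq.
  have [e e0 [_ Zqe _]] := near_line 0 nq.
  have := @par_cond_time R 0 phi y (alL th) (alL th') nuL nuL (GL th) (GL th') _ q e (nuL0 y) Tw.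
  rewrite nuL_mul [tdZ _ _ _ _ _]mxE /td1 => H; apply/esym/H => //.
  - by case: ad'.
  - by move=> i; move: i; apply: ord2P.
  - move=> r i l; move: i l; apply: ord2P => // ; apply: ord2P => // _ _.
    rewrite (td2_near_eq _ _ _ zT) td2_base.
    have -> : pd 1 (time T) = fun=> 0 by apply/funext => x; exact: pd1_time.
    by rewrite pd_cst.
  - by move=> r x; rewrite /GL lineN.
  - by move=> r x; rewrite /GL lineN.
  - by move=> r r'; exact: connectsL_cond.
have A0 : cA th (base y) != 0 by case: ad.
have [d d0 [e0 e1 e2]] := near_line 1 key.
move: e0 e1 e2; cbv beta; rewrite !lineE.
generalize (pd (lift ord_max 0) (zc phi 0) y * cA th' (base (phi y))) => K.
generalize (pd ord_max (zc phi 1) y) => b.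
generalize (pd (lift ord_max 1) (zc phi 1) y) => a e0 e1 e2.
have sq x : cA th (base y) * x ^+ 2 = K -> x ^+ 2 = K / cA th (base y).
  by move=> <-; rewrite mulrC mulKf.
apply: (@sq_const_slope _ (a + p 0 1 * b) b d _ d0 (sq _ e0)).
  by rewrite -(sq _ e1); congr (_ ^+ 2); ring.
by rewrite -(sq _ e2); congr (_ ^+ 2); ring.
Qed.

(** On jets with zero time derivative, [E] is quadratic in the slope [p1], and [U_uu] is its only
    quadratic contribution; the second difference over -1, 0, 1 isolates it. *)
Lemma structL_affine (y : 'rV[R]_3) th th' T X U : connectsL y th th' (phiL T X U) ->
  pd ord_max (pd ord_max U) y = 0.
Proof.
move=> c; have [ad ad' /point_transformationP[an J] _] := c.
have A0 : cA th (base y) != 0 by case: ad.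
have A0' : cA th' (img T X (base y)) != 0 by case: ad'; rewrite /phiL base_adjoin.
move: J; rewrite det_pdJ_L !mulf_eq0 !negb_or => /andP[Uu0 /andP[X0 T0]].
pose P1 (p1 : R) := (pd (lift ord_max 1) U y + p1 * pd ord_max U y) / pd 1 X (base y).
pose P0 (p1 : R) := (pd (lift ord_max 0) U y - P1 p1 * pd 0 X (base y)) / pd 0 (time T) (base y).
pose E (p1 : R) := pd ord_max U y * (0 - (cB th (base y) * p1 + cC th (base y) * fiber y))
  + cA th (base y) * (pd (lift ord_max 1) (pd (lift ord_max 1) U) y
     + p1 * pd ord_max (pd (lift ord_max 1) U) y + p1 * pd (lift ord_max 1) (pd ord_max U) y
     + p1 * p1 * pd ord_max (pd ord_max U) y - P1 p1 * pd 1 (pd 1 X) (base y))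
  - cA th (base y) * pd 1 X (base y) ^+ 2 * ((P0 p1 - (cB th' (img T X (base y)) * P1 p1
      + cC th' (img T X (base y)) * U y)) / cA th' (img T X (base y))).
have E0 p1 : E p1 = 0.
  have [p [p00 p01]] := row2E 0 p1; have [p' [p00' p01']] := row2E (P0 p1) (P1 p1).
  have W : tdW (phiL T X U) y p = p' *m (tdZ (phiL T X U) y p)^T.
    apply/tdWL; rewrite /td1 p00 p01 p00' p01'; split; last by rewrite /P1 mulfVK.
    by rewrite mul0r addr0 /P0 mulfVK // subrK.
  have Z0 : \det (tdZ (phiL T X U) y p) != 0 by rewrite det_tdZL mulf_neq0.
  have /condLE := connectsL_cond c Z0 W; rewrite /GL /td2 p00 p01 p00' p01' => e.
  by apply/eqP; rewrite subr_eq0; apply/eqP; exact: e.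
have e : E 1 + E (-1) - 2 * E 0 = 0 by rewrite !E0; ring.
have : 2 * cA th (base y) * pd ord_max (pd ord_max U) y = 0.
  rewrite -[RHS]e /E /P0 /P1; move: X0 T0 A0'; gen_pd => X0 T0 A0'.
  by field; rewrite X0 T0 A0'.
by move/eqP; rewrite !mulf_eq0 (negPf A0) pnatr_eq0 /= => /eqP.
Qed.

Lemma connectsL_structure (y0 : 'rV[R]_3) th th' phi : connectsL y0 th th' phi ->
  exists T X U1 U0, \forall y \near y0, phi y = trL T X U1 U0 y.
Proof.
move=> c; have nc := connectsL_open c.
have [_ _ /point_transformationP[an _] _] := c.
have h0 : \forall y \near y0, differentiable (zc phi 0) y /\ pd ord_max (zc phi 0) y = 0.
  move: nc (an (lift ord_max 0)); apply: filterS2 => y cy ay.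
  by split; [exact: analytic_differentiable | have [] := structL_time cy].
(* A component that does not depend on u equals its restriction to the slice at the height of [y0],
   which is a function of [(t, x)]. *)
pose g0 z := zc phi 0 (adjoin z (fiber y0)).
have [T hT] : exists T, \forall p \near base y0, g0 p = time T p.
  apply: near_time_form; move: (near_slice nc) (near_slice (an (lift ord_max 0))).
  apply: filterS2 => p cp ap; split.
    by apply: analytic_differentiable; exact: analytic_slice.
  by rewrite pd_slice; have [] := structL_time cp.
have zT : \forall y \near y0, zc phi 0 y = (time T \o base) y.
  by move: (near_base_form h0) (near_base hT); apply: filterS2 => y ->; exact.
have h1 : \forall y \near y0, differentiable (zc phi 1) y /\ pd ord_max (zc phi 1) y = 0.
  near=> y; split.
    by apply: analytic_differentiable; near: y; exact: an (lift ord_max 1).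
  have cy : connectsL y th th' phi by near: y.
  by apply: (structL_space cy (T := T)); near: y; exact: near_near.
have zX := near_base_form h1.
pose X := fun z => zc phi 1 (adjoin z (fiber y0)).
have e1 : \forall y \near y0, phi y = phiL T X (oc phi) y.
  move: zT zX; apply: filterS2 => y eT eX; apply/rowP => i.
  rewrite /phiL; case: (unliftP ord_max i) => [k ->|->]; last by rewrite adjoin_max.
  rewrite adjoin_lift; move: k; apply: ord2P.
    by rewrite img0; exact: eT.
  by rewrite img1; exact: eX.
have nc1 := connectsL_open (connects_germ e1 c).
have hU : \forall y \near y0, pd ord_max (pd ord_max (oc phi)) y = 0.
  by apply: filterS nc1 => y; exact: structL_affine.
have [U1 [U0 [_ _ hA]]] := near_affine_form (an ord_max) hU.
exists T, X, U1, U0; move: e1 hA; apply: filterS2 => y e3 e2; rewrite e3.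
by rewrite trLE /phiL; congr adjoin; exact: e2.
Unshelve. all: by end_near. Qed.

End StructureL.

(** * Extension to the determining equations *)

Section DifferentiatedFormulas.
Context {R : realType} {n : nat} (i : 'I_n) (p : 'rV[R]_n).
Implicit Types (f g : 'rV[R]_n -> R) (a b : R).

(** Differentiability and the derivative's value in one predicate, so that the rules can be
    differentiated by recursion on their syntax. *)
Definition has_pd f a := differentiable f p /\ pd i f p = a.

Lemma has_pd_add f g a b : has_pd f a -> has_pd g b -> has_pd (fun x => f x + g x) (a + b).
Proof.
move=> [df <-] [dg <-]; split; last exact: pd_add.
by apply: differentiableD; [exact: df | exact: dg].
Qed.

Lemma has_pd_opp f a : has_pd f a -> has_pd (fun x => - f x) (- a).
Proof.
by move=> [df <-]; split; [apply: differentiableN; exact: df | exact: pd_opp].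
Qed.

Lemma has_pd_mul f g a b : has_pd f a -> has_pd g b ->
  has_pd (fun x => f x * g x) (a * g p + f p * b).
Proof.
move=> [df <-] [dg <-]; split; last exact: pd_mul.
by apply: differentiableM; [exact: df | exact: dg].
Qed.

Lemma has_pd_sqr f a : has_pd f a -> has_pd (fun x => f x ^+ 2) (a * f p + f p * a).
Proof. by move=> hf; apply: (has_pd_mul hf hf). Qed.

Lemma has_pd_cst a : has_pd (fun=> a) 0.
Proof. by split; [exact: differentiable_cst | exact: pd_cst]. Qed.

Lemma has_pd_eq f g a b : has_pd f a -> has_pd g b ->
  (\forall x \near p, f x = g x) -> a = b.
Proof. by move=> [_ <-] [_ <-]; exact: pd_near_eq. Qed.

Lemma has_pd_an f : analytic_near f p -> has_pd f (pd i f p).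
Proof. by move=> /analytic_near_diff. Qed.

(** Subtractions are presented to it as sums with opposites, so sums, opposites, products and
    squares cover all the rules. *)
Ltac has_pd_tac := lazymatch goal with
  | |- has_pd (fun x => _ + _) _ => apply: has_pd_add; has_pd_tac
  | |- has_pd (fun x => - _) _ => apply: has_pd_opp; has_pd_tac
  | |- has_pd (fun x => _ * _) _ => apply: has_pd_mul; has_pd_tac
  | |- has_pd (fun x => _ ^+ 2) _ => apply: has_pd_sqr; has_pd_tac
  | |- _ => first [eassumption | apply: has_pd_cst]
  end.

Variables (A B C A' B' C' Tt Xt Xx Xxx W Wx V Vt Vx Vxx : 'rV[R]_n -> R).
Variables (dA dB dC dA' dB' dC' dXt dXx dXxx dW dWx dV dVt dVx dVxx c : R).
Hypotheses (hA : has_pd A dA) (hB : has_pd B dB) (hC : has_pd C dC) (hA' : has_pd A' dA')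
  (hB' : has_pd B' dB') (hC' : has_pd C' dC') (hT : has_pd Tt 0) (hXt : has_pd Xt dXt)
  (hXx : has_pd Xx dXx) (hXxx : has_pd Xxx dXxx) (hW : has_pd W dW) (hWx : has_pd Wx dWx)
  (hV : has_pd V dV) (hVt : has_pd Vt dVt) (hVx : has_pd Vx dVx) (hVxx : has_pd Vxx dVxx).

Lemma has_pd_fml1 : (\forall x \near p, fml1 (A x) (A' x) (Tt x) (Xx x)) ->
  2 * Xx p * dXx * A p + Xx p ^+ 2 * dA = Tt p * dA'.
Proof.
move=> H.
have h1 : has_pd (fun x => Xx x ^+ 2 * A x) ((dXx * Xx p + Xx p * dXx) * A p + Xx p ^+ 2 * dA).
  by has_pd_tac.
have h2 : has_pd (fun x => Tt x * A' x) (0 * A' p + Tt p * dA') by has_pd_tac.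
have := has_pd_eq h1 h2 H; rewrite mul0r add0r => <-; ring.
Qed.

Lemma has_pd_fml2 :
  (\forall x \near p, fml2 (A x) (B x) (B' x) (Tt x) (Xt x) (Xx x) (Xxx x) (W x) (Wx x)) ->
  dW * Tt p * B' p + W p * Tt p * dB' =
  dW * Xx p * B p + W p * dXx * B p + W p * Xx p * dB
  - 2 * (dXx * Wx p * A p + Xx p * dWx * A p + Xx p * Wx p * dA)
  - dW * Xt p - W p * dXt + dW * A p * Xxx p + W p * dA * Xxx p + W p * A p * dXxx.
Proof.
move=> H.
have h1 : has_pd (fun x => W x * Tt x * B' x) ((dW * Tt p + W p * 0) * B' p + W p * Tt p * dB').
  by has_pd_tac.
have h2 : has_pd (fun x => W x * Xx x * B x + - (2 * Xx x * Wx x * A x) + - (W x * Xt x) + W x * A x * Xxx x)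
  ((dW * Xx p + W p * dXx) * B p + W p * Xx p * dB
   + - (((0 * Xx p + 2 * dXx) * Wx p + 2 * Xx p * dWx) * A p + 2 * Xx p * Wx p * dA)
   + - (dW * Xt p + W p * dXt) + ((dW * A p + W p * dA) * Xxx p + W p * A p * dXxx)).
  by has_pd_tac.
have := has_pd_eq h1 h2 H; rewrite mulr0 addr0 => ->; ring.
Qed.

(** The constant [c] stands for the entry u of [fml3]: the pair [(V, c)] will be [(U1, 1)] and
    [(U0, 0)]. *)
Lemma has_pd_fml3 :
  (\forall x \near p, fml3 (A x) (B x) (C x) (C' x) (Tt x) (W x) (Wx x) (V x) (Vt x) (Vx x) (Vxx x) c) ->
  dW * (Vt p - Tt p * C' p * V p - A p * Vxx p - B p * Vx p + C p * W p * c)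
  + W p * (dVt - Tt p * dC' * V p - Tt p * C' p * dV - dA * Vxx p - A p * dVxx - dB * Vx p
           - B p * dVx + dC * W p * c + C p * dW * c)
  + 2 * (dA * Wx p * Vx p + A p * dWx * Vx p + A p * Wx p * dVx) = 0.
Proof.
move=> H.
have h1 : has_pd (fun x => W x * (Vt x + - (Tt x * C' x * V x) + - (A x * Vxx x) + - (B x * Vx x) + C x * W x * c)
    + 2 * A x * Wx x * Vx x)
  (dW * (Vt p + - (Tt p * C' p * V p) + - (A p * Vxx p) + - (B p * Vx p) + C p * W p * c)
   + W p * (dVt + - ((0 * C' p + Tt p * dC') * V p + Tt p * C' p * dV) + - (dA * Vxx p + A p * dVxx)
      + - (dB * Vx p + B p * dVx) + ((dC * W p + C p * dW) * c + C p * W p * 0))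
   + (((0 * A p + 2 * dA) * Wx p + 2 * A p * dWx) * Vx p + 2 * A p * Wx p * dVx)).
  by has_pd_tac.
rewrite -(has_pd_eq h1 (has_pd_cst 0) H); ring.
Qed.

End DifferentiatedFormulas.

(** * Derivatives of the transformation rules with respect to x *)

Section FormulasD.
Context {R : realType}.

(** Derivatives of a quotient [f = h / g] are obtained by differentiating [f g = h], which
    introduces no denominators. *)
Lemma pd_quot n (f g h : 'rV[R]_n -> R) p i :
  analytic_near f p -> analytic_near g p -> (\forall x \near p, f x * g x = h x) ->
  pd i f p * g p + f p * pd i g p = pd i h p.
Proof.
move=> af ag e; rewrite -(pd_near_eq i e) pd_mul //; exact: analytic_near_diff.
Qed.

Lemma pd2_quot n (f g h : 'rV[R]_n -> R) p i j :
  analytic_near f p -> analytic_near g p -> (\forall x \near p, f x * g x = h x) ->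
  pd j (pd i f) p * g p + pd i f p * pd j g p + (pd j f p * pd i g p + f p * pd j (pd i g) p)
  = pd j (pd i h) p.
Proof.
move=> af ag e.
have e1 : \forall x \near p, pd i f x * g x + f x * pd i g x = pd i h x.
  near=> x; apply: pd_quot; near: x; [exact: analytic_near_open af|exact: analytic_near_open ag|].
  exact: near_near e.
have dm (a b : 'rV[R]_n -> R) : analytic_near a p -> analytic_near b p ->
    differentiable (fun x => a x * b x) p.
  by move=> aa ab; exact: analytic_near_diff (analytic_near_mul aa ab).
have afi := analytic_near_pd i af; have agi := analytic_near_pd i ag.
rewrite -(pd_near_eq j e1) (pd_add _ (dm _ _ afi ag) (dm _ _ af agi)).
have d := @analytic_near_diff R n.
by rewrite (pd_mul _ (d _ _ afi) (d _ _ ag)) (pd_mul _ (d _ _ af) (d _ _ agi)).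
Unshelve. all: by end_near. Qed.

Lemma analytic_near_pdC n (f : 'rV[R]_n -> R) p i j : analytic_near f p ->
  pd i (pd j f) p = pd j (pd i f) p.
Proof. by move=> /analytic_near_at; exact: analytic_pdC. Qed.

Lemma pd0_aff2 (a b : 'rV[R]_2 -> R) z : differentiable a (base z) -> differentiable b (base z) ->
  pd (0 : 'I_3) (aff a b) z = pd 0 a (base z) * fiber z + pd 0 b (base z).
Proof. by move=> da db; rewrite {1}ord3_0 pd_lift_aff. Qed.

Lemma pd1_aff2 (a b : 'rV[R]_2 -> R) z : differentiable a (base z) -> differentiable b (base z) ->
  pd (1 : 'I_3) (aff a b) z = pd 1 a (base z) * fiber z + pd 1 b (base z).
Proof. by move=> da db; rewrite {1}ord3_1 pd_lift_aff. Qed.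

Lemma pd11_aff2 (a b : 'rV[R]_2 -> R) z : analytic_near a (base z) -> analytic_near b (base z) ->
  [/\ pd (1 : 'I_3) (pd (1 : 'I_3) (aff a b)) z =
        pd 1 (pd 1 a) (base z) * fiber z + pd 1 (pd 1 b) (base z),
      pd ord_max (pd (1 : 'I_3) (aff a b)) z = pd 1 a (base z),
      pd (1 : 'I_3) (pd ord_max (aff a b)) z = pd 1 a (base z) &
      pd ord_max (pd ord_max (aff a b)) z = 0].
Proof.
move=> aa ab; split.
- by rewrite ord3_1 (pd2_aff_ll aa ab).
- by rewrite ord3_1 (pd2_aff_ml aa ab).
- by rewrite ord3_1 (pd2_aff_lm aa ab).
- exact: pd2_aff_mm aa ab.
Qed.

(** The new eta is affine in eta, with a constant term that is affine in u; the lemmas on [aff] thus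
    apply at both levels. *)
Lemma omDE (X U1 U0 : 'rV[R]_2 -> R) : omD X U1 U0 =
  aff ((fun p => U1 p / pd 1 X p) \o base)
    (aff (fun p => pd 1 U1 p / pd 1 X p) (fun p => pd 1 U0 p / pd 1 X p)).
Proof. by apply/funext => y; rewrite /omD /aff /= addrA. Qed.

Lemma row3E (a b c : R) : exists p : 'rV[R]_3, [/\ p 0 0 = a, p 0 1 = b & p 0 ord_max = c].
Proof. by exists (\row_i [:: a; b; c]`_i); rewrite !mxE. Qed.

(** Since [T] does not depend on x, the chain rule leaves a single term. *)
Lemma pd1_comp_img (f : 'rV[R]_2 -> R) T (X : 'rV[R]_2 -> R) p :
  analytic_near (time T) p -> analytic_near X p -> analytic_near f (img T X p) ->
  has_pd 1 p (f \o img T X) (pd 1 f (img T X p) * pd 1 X p).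
Proof.
move=> aT aX af.
have iE k : (fun q => img T X q 0 k) = if k == 0 then time T else X.
  by apply/funext => q; move: k; apply: ord2P; rewrite ?img0 ?img1.
have [|d e] := @pd_comp _ _ _ f (img T X) p 1 _ (analytic_near_diff af).
  move=> k; rewrite iE; case: (k == 0); exact: analytic_near_diff.
split; first exact: d.
by rewrite e sum2 !iE /= pd1_time mul0r add0r mulrC.
Qed.

Section At.
Variables (th th' : coefs R) (T : R -> R) (X U1 U0 : 'rV[R]_2 -> R) (p : 'rV[R]_2).
Hypothesis ok : tr_ok T X U1 U0 p.
Hypotheses (ad : admissible_coefs th p) (ad' : admissible_coefs th' (img T X p)).

Let aT : analytic_near (time T) p. Proof. by case: ok. Qed.
Let aX : analytic_near X p. Proof. by case: ok. Qed.
Let a1 : analytic_near U1 p. Proof. by case: ok. Qed.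
Let a0 : analytic_near U0 p. Proof. by case: ok. Qed.
Let T0 : pd 0 (time T) p != 0. Proof. by case: ok => _ _ _ _ []. Qed.
Let X0 : pd 1 X p != 0. Proof. by case: ok => _ _ _ _ []. Qed.
Let U10 : U1 p != 0. Proof. by case: ok => _ _ _ _ []. Qed.
Let A0 : cA th p != 0. Proof. by case: ad. Qed.
Let A0' : cA th' (img T X p) != 0. Proof. by case: ad'. Qed.
Let aA : analytic_near (cA th) p. Proof. by case: ad. Qed.
Let aB : analytic_near (cB th) p. Proof. by case: ad. Qed.
Let aC : analytic_near (cC th) p. Proof. by case: ad. Qed.
Let aA' : analytic_near (cA th') (img T X p). Proof. by case: ad'. Qed.
Let aB' : analytic_near (cB th') (img T X p). Proof. by case: ad'. Qed.
Let aC' : analytic_near (cC th') (img T X p). Proof. by case: ad'. Qed.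
Let aXx := analytic_near_pd 1 aX.

Let hT : has_pd 1 p (pd 0 (time T)) 0.
Proof.
split; first exact: analytic_near_diff (analytic_near_pd _ aT).
rewrite (analytic_near_pdC 1 0 aT) (_ : pd 1 (time T) = fun=> 0) ?pd_cst //.
by apply/funext => q; exact: pd1_time.
Qed.

Let hXt : has_pd 1 p (pd 0 X) (pd 0 (pd 1 X) p).
Proof.
split; first exact: analytic_near_diff (analytic_near_pd _ aX).
exact: analytic_near_pdC aX.
Qed.

(** Assumes the first rule alone: starting from DE_0, its derivative is needed before the other
    rules are available. *)
Lemma formulas_x1 : (\forall q \near p, fml1 (cA th q) (cA th' (img T X q)) (pd 0 (time T) q) (pd 1 X q)) ->
  fml1x (cA th p) (pd 1 (cA th) p) (pd 1 (cA th') (img T X p)) (pd 0 (time T) p)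
    (pd 1 X p) (pd 1 (pd 1 X) p).
Proof.
move=> H; have hA' := pd1_comp_img aT aX aA'.
by have := has_pd_fml1 (has_pd_an 1 aA) hA' hT (has_pd_an 1 aXx) H.
Qed.

Lemma formulas_x2 : (\forall q \near p, formulas th th' T X U1 U0 q) ->
  fml2x (cA th p) (cB th p) (pd 1 (cA th) p) (pd 1 (cB th) p) (cB th' (img T X p))
    (pd 1 (cB th') (img T X p)) (pd 0 (time T) p) (pd 0 X p) (pd 1 X p) (pd 1 (pd 1 X) p)
    (pd 0 (pd 1 X) p) (pd 1 (pd 1 (pd 1 X)) p) (U1 p) (pd 1 U1 p) (pd 1 (pd 1 U1) p).
Proof.
move=> H; have hB' := pd1_comp_img aT aX aB'.
have H2 : \forall q \near p, fml2 (cA th q) (cB th q) ((cB th' \o img T X) q) (pd 0 (time T) q)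
    (pd 0 X q) (pd 1 X q) (pd 1 (pd 1 X) q) (U1 q) (pd 1 U1 q).
  by apply: filterS H => q [].
exact: (has_pd_fml2 (has_pd_an 1 aA) (has_pd_an 1 aB) hB' hT hXt (has_pd_an 1 aXx)
  (has_pd_an 1 (analytic_near_pd 1 aXx)) (has_pd_an 1 a1) (has_pd_an 1 (analytic_near_pd 1 a1)) H2).
Qed.

Lemma formulas_x3 (V : 'rV[R]_2 -> R) (c : R) : analytic_near V p ->
  (\forall q \near p, fml3 (cA th q) (cB th q) (cC th q) ((cC th' \o img T X) q) (pd 0 (time T) q)
    (U1 q) (pd 1 U1 q) (V q) (pd 0 V q) (pd 1 V q) (pd 1 (pd 1 V) q) c) ->
  fml3x (cA th p) (cB th p) (cC th p) (pd 1 (cA th) p) (pd 1 (cB th) p) (pd 1 (cC th) p)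
    (cC th' (img T X p)) (pd 1 (cC th') (img T X p)) (pd 0 (time T) p) (pd 1 X p)
    (U1 p) (pd 1 U1 p) (pd 1 (pd 1 U1) p) (V p) (pd 0 V p) (pd 1 V p) (pd 1 (pd 1 V) p)
    (pd 0 (pd 1 V) p) (pd 1 (pd 1 (pd 1 V)) p) c.
Proof.
move=> aV H; have hC' := pd1_comp_img aT aX aC'.
have hVt : has_pd 1 p (pd 0 V) (pd 0 (pd 1 V) p).
  split; first exact: analytic_near_diff (analytic_near_pd _ aV).
  exact: analytic_near_pdC aV.
have aVx := analytic_near_pd 1 aV.
have := has_pd_fml3 (has_pd_an 1 aA) (has_pd_an 1 aB) (has_pd_an 1 aC) hC' hT
  (has_pd_an 1 a1) (has_pd_an 1 (analytic_near_pd 1 a1)) (has_pd_an 1 aV) hVt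
  (has_pd_an 1 aVx) (has_pd_an 1 (analytic_near_pd 1 aVx)) H.
by rewrite /fml3x [pd 1 (cC th') _ * _]mulrC.
Qed.

End At.
End FormulasD.

(** * The transformation rules and the determining equations *)

Section EquivalenceD.
Context {R : realType}.

Lemma fml3x_aff (A B C Ax Bx Cx C' Cx' Tt Xx U1 U1t U1x U1xx U1xt U1xxx U0 U0t U0x U0xx U0xt U0xxx u : R) :
  fml3x A B C Ax Bx Cx C' Cx' Tt Xx U1 U1x U1xx U1 U1t U1x U1xx U1xt U1xxx 1 ->
  fml3x A B C Ax Bx Cx C' Cx' Tt Xx U1 U1x U1xx U0 U0t U0x U0xx U0xt U0xxx 0 ->
  fml3x A B C Ax Bx Cx C' Cx' Tt Xx U1 U1x U1xx (U1 * u + U0) (U1t * u + U0t) (U1x * u + U0x)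
    (U1xx * u + U0xx) (U1xt * u + U0xt) (U1xxx * u + U0xxx) u.
Proof.
rewrite /fml3x => e1 e0; rewrite -[RHS](addr0 0) -[X in _ = _ + X]e0 -[X in _ = X + _](mulr0 u) -[X in u * X]e1.
ring.
Qed.

Lemma aff_comb (b bx bxx g gx gxx x x1 x2 u : R) :
  (bxx * u + gxx) * x + 2 * (bx * u + gx) * x1 + (b * u + g) * x2 =
  (bxx * x + 2 * bx * x1 + b * x2) * u + (gxx * x + 2 * gx * x1 + g * x2).
Proof. ring. Qed.

Lemma det_upper3 (M : 'M[R]_3) : M 1 0 = 0 -> M ord_max 0 = 0 -> M ord_max 1 = 0 ->
  \det M = M 0 0 * M 1 1 * M ord_max ord_max.
Proof.
move=> m10 m20 m21; rewrite -det_tr det_trig.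
  rewrite 2!big_ord_recl big_ord1 !mxE mulrA.
  by congr (M _ _ * M _ _ * M _ _); exact: val_inj.
by apply/is_trig_mxP => i j; rewrite mxE; move: i j; apply: ord3P; apply: ord3P.
Qed.

Section AtD.
Variables (th th' : coefs R) (T : R -> R) (X U1 U0 : 'rV[R]_2 -> R) (y : 'rV[R]_4).
Let z := base y.
Let p := base z.
Let u := fiber z.
Let w := fiber y.
Hypothesis ok : tr_ok T X U1 U0 p.
Hypotheses (ad : admissible_coefs th p) (ad' : admissible_coefs th' (img T X p)).

Let aX : analytic_near X p. Proof. by case: ok. Qed.
Let a1 : analytic_near U1 p. Proof. by case: ok. Qed.
Let a0 : analytic_near U0 p. Proof. by case: ok. Qed.
Let T0 : pd 0 (time T) p != 0. Proof. by case: ok => _ _ _ _ []. Qed.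
Let X0 : pd 1 X p != 0. Proof. by case: ok => _ _ _ _ []. Qed.
Let U10 : U1 p != 0. Proof. by case: ok => _ _ _ _ []. Qed.
Let A0 : cA th p != 0. Proof. by case: ad. Qed.
Let A0' : cA th' (img T X p) != 0. Proof. by case: ad'. Qed.
Let aXx := analytic_near_pd 1 aX.

Let al q := U1 q / pd 1 X q.
Let be q := pd 1 U1 q / pd 1 X q.
Let ga q := pd 1 U0 q / pd 1 X q.
Let aal : analytic_near al p := analytic_near_div a1 aXx X0.
Let abe : analytic_near be p := analytic_near_div (analytic_near_pd 1 a1) aXx X0.
Let aga : analytic_near ga p := analytic_near_div (analytic_near_pd 1 a0) aXx X0.

Let ps := be p * u + ga p.
Let psx := pd 1 be p * u + pd 1 ga p.
Let pst := pd 0 be p * u + pd 0 ga p.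
Let psxx := pd 1 (pd 1 be) p * u + pd 1 (pd 1 ga) p.
Let Ut := pd 0 U1 p * u + pd 0 U0 p.
Let Ux := pd 1 U1 p * u + pd 1 U0 p.
Let Uxx := pd 1 (pd 1 U1) p * u + pd 1 (pd 1 U0) p.
Let Uxt := pd 0 (pd 1 U1) p * u + pd 0 (pd 1 U0) p.
Let Uxxx := pd 1 (pd 1 (pd 1 U1)) p * u + pd 1 (pd 1 (pd 1 U0)) p.

Let nX : \forall q \near p, pd 1 X q != 0.
Proof. exact: near_continuous_neq0 (analytic_near_diff aXx) X0. Qed.

Let quotE f : \forall q \near p, (f q / pd 1 X q) * pd 1 X q = f q.
Proof. by apply: filterS nX => q x0; rewrite mulfVK. Qed.

Let da := analytic_near_diff a1.
Let d0 := analytic_near_diff a0.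
Let aalz : analytic_near (al \o base) z := analytic_near_base aal.
Let affz : analytic_near (aff be ga) z := analytic_near_aff abe aga.
Let omE : omD X U1 U0 = aff (al \o base) (aff be ga) := omDE X U1 U0.

Let omD_val : omD X U1 U0 y = al p * w + ps.
Proof. by rewrite omE. Qed.

Let pd_max_om : pd ord_max (omD X U1 U0) y = al p.
Proof. by rewrite omE pd_max_aff //; exact: analytic_near_diff. Qed.

Let td1_om v : [/\ td1 (omD X U1 U0) y v 0 = pd 0 al p * w + pst + v 0 0 * al p,
  td1 (omD X U1 U0) y v 1 = pd 1 al p * w + psx + v 0 1 * al p &
  td1 (omD X U1 U0) y v ord_max = be p + v 0 ord_max * al p].
Proof.
have dal := analytic_near_diff aalz; have daf := analytic_near_diff affz.
have dbe := analytic_near_diff abe; have dga := analytic_near_diff aga.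
rewrite omE; split; rewrite td1_aff //.
- by rewrite pd0_base2 pd0_aff2.
- by rewrite pd1_base2 pd1_aff2.
- by rewrite pd_max_base pd_max_aff // mul0r add0r.
Qed.

Let td2_om v : [/\
  td2 (omD X U1 U0) y v 1 1 = pd 1 (pd 1 al) p * w + psxx + v 0 1 * pd 1 al p + v 0 1 * pd 1 al p,
  td2 (omD X U1 U0) y v 1 ord_max = pd 1 be p + v 0 ord_max * pd 1 al p,
  td2 (omD X U1 U0) y v ord_max 1 = pd 1 be p + v 0 ord_max * pd 1 al p &
  td2 (omD X U1 U0) y v ord_max ord_max = 0].
Proof.
have [b11 bm1 b1m bmm] := pd11_aff2 abe aga.
rewrite omE; split; rewrite (td2_aff aalz affz).
- by rewrite b11 !pd1_base2.
- rewrite bm1 !pd1_base2 pd_max_baseF pd_max_base /=.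
  by rewrite mul0r mulr0 add0r addr0.
- rewrite b1m !pd1_base2 pd_max_baseF pd_cst /=.
  by rewrite mul0r mulr0 add0r addr0.
- rewrite bmm pd_max_baseF pd_cst mul0r !mulr0 !addr0 //.
Qed.

Lemma condD_scalar v v' : condD th th' (trDE0 T X U1 U0) y v v' <->
  eqD_scalar (cA th p) (cB th p) (cC th p) (pd 1 (cA th) p) (pd 1 (cB th) p) (pd 1 (cC th) p)
    (cA th' (img T X p)) (cB th' (img T X p)) (cC th' (img T X p))
    (pd 1 (cA th') (img T X p)) (pd 1 (cB th') (img T X p)) (pd 1 (cC th') (img T X p))
    (pd 1 X p) (pd 1 (pd 1 X) p) (pd 1 U1 p) (U1 p * u + U0 p) Uxx u w
    (al p) (pd 1 al p) (pd 1 (pd 1 al) p) (pd 1 be p) ps psxx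
    (v 0 0) (v 0 1) (v 0 ord_max) (v' 0 0) (v' 0 1) (v' 0 ord_max).
Proof.
have [t11 t1m tm1 tmm] := td2_om v.
have [c11 cm1 c1m cmm] := pd11_aff2 a1 a0.
rewrite trDE0E condDE t11 t1m tm1 tmm c11 cm1 c1m cmm pd_max_om.
rewrite pd1_aff2 // pd_max_aff // omD_val -/p -/u -/Ux -/Uxx.
(* The contact clause holds identically: the formula for the new eta is its solution. *)
have first : Ux + fiber y * U1 p = pd 1 X p * (al p * w + ps).
  by rewrite /Ux /ps /al /be /ga -/w; move: X0; gen_pd => X0'; field.
have -> : GD th y v = pd 1 (cA th) p * (v 0 1 + w * v 0 ord_max)
    + (pd 1 (cB th) p * w + cB th p * v 0 1) + cC th p * (w - u * v 0 ord_max) + pd 1 (cC th) p * u by [].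
have -> : GD th' (phiD T X (aff U1 U0) (omD X U1 U0) y) v' =
    pd 1 (cA th') (img T X p) * (v' 0 1 + (al p * w + ps) * v' 0 ord_max)
    + (pd 1 (cB th') (img T X p) * (al p * w + ps) + cB th' (img T X p) * v' 0 1)
    + cC th' (img T X p) * ((al p * w + ps) - (U1 p * u + U0 p) * v' 0 ord_max)
    + pd 1 (cC th') (img T X p) * (U1 p * u + U0 p).
  by rewrite /GD /phiD base_adjoin fiber_adjoin /phiL base_adjoin fiber_adjoin omD_val.
rewrite /eqD_scalar -/w; set S1 := (X in _ /\ _ + cA th p * X = _); set S2 := (X in _ <-> _ + cA th p * X = _).
have -> : S1 = S2 by rewrite /S1 /S2; gen_pd; ring.
by split=> [[]|e].
Qed.

Lemma tdWD_scalar v v' :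
  tdW (trDE0 T X U1 U0) y v = v' *m (tdZ (trDE0 T X U1 U0) y v)^T <->
  [/\ pd 0 al p * w + pst + v 0 0 * al p =
        v' 0 0 * pd 0 (time T) p + v' 0 1 * pd 0 X p + v' 0 ord_max * Ut,
      pd 1 al p * w + psx + v 0 1 * al p = v' 0 1 * pd 1 X p + v' 0 ord_max * Ux &
      be p + v 0 ord_max * al p = v' 0 ord_max * U1 p].
Proof.
have [e0 e1 em] := td1_om v.
by rewrite trDE0E tdWD e0 e1 em pd0_aff2 // pd1_aff2 // pd_max_aff.
Qed.

Let alE : al p * pd 1 X p = U1 p. Proof. exact: nbhs_singleton (quotE U1). Qed.
Let beE : be p * pd 1 X p = pd 1 U1 p. Proof. exact: nbhs_singleton (quotE (pd 1 U1)). Qed.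
Let gaE : ga p * pd 1 X p = pd 1 U0 p. Proof. exact: nbhs_singleton (quotE (pd 1 U0)). Qed.
Let alxE := pd_quot 1 aal aXx (quotE U1).
Let altE := pd_quot 0 aal aXx (quotE U1).
Let bexE := pd_quot 1 abe aXx (quotE (pd 1 U1)).
Let betE := pd_quot 0 abe aXx (quotE (pd 1 U1)).
Let gaxE := pd_quot 1 aga aXx (quotE (pd 1 U0)).
Let gatE := pd_quot 0 aga aXx (quotE (pd 1 U0)).

Let xx2 (a b c d e f : R) : a * b + c * d + (c * d + e * f) = a * b + 2 * c * d + e * f.
Proof. by ring. Qed.

Let alxxE := etrans (esym (xx2 _ _ _ _ _ _)) (pd2_quot 1 1 aal aXx (quotE U1)).
Let bexxE := etrans (esym (xx2 _ _ _ _ _ _)) (pd2_quot 1 1 abe aXx (quotE (pd 1 U1))).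
Let gaxxE := etrans (esym (xx2 _ _ _ _ _ _)) (pd2_quot 1 1 aga aXx (quotE (pd 1 U0))).

Let psE : ps * pd 1 X p = Ux.
Proof. by rewrite /ps /Ux -beE -gaE; gen_pd; ring. Qed.
Let psxE : psx * pd 1 X p + ps * pd 1 (pd 1 X) p = Uxx.
Proof. by rewrite /psx /ps /Uxx -bexE -gaxE; gen_pd; ring. Qed.
Let pstE : pst * pd 1 X p + ps * pd 0 (pd 1 X) p = Uxt.
Proof. by rewrite /pst /ps /Uxt -betE -gatE; gen_pd; ring. Qed.
Let psxxE : psxx * pd 1 X p + 2 * psx * pd 1 (pd 1 X) p + ps * pd 1 (pd 1 (pd 1 X)) p = Uxxx.
Proof.
exact: (etrans (aff_comb _ _ _ _ _ _ _ _ _ _) (congr2 (fun a c => a * u + c) bexxE gaxxE)).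
Qed.

Lemma formulas_condD : (\forall q \near p, formulas th th' T X U1 U0 q) -> forall v v',
  tdW (trDE0 T X U1 U0) y v = v' *m (tdZ (trDE0 T X U1 U0) y v)^T ->
  condD th th' (trDE0 T X U1 U0) y v v'.
Proof.
move=> F v v' /tdWD_scalar[e0 e1 e2]; apply/condD_scalar.
have [f1 f2 f3 f4] := nbhs_singleton F.
have F1 : \forall q \near p, fml1 (cA th q) (cA th' (img T X q)) (pd 0 (time T) q) (pd 1 X q).
  by apply: filterS F => q [].
have x1 := formulas_x1 ok ad ad' F1; have x2 := formulas_x2 ok ad ad' F.
have F3 : \forall q \near p, fml3 (cA th q) (cB th q) (cC th q) ((cC th' \o img T X) q) (pd 0 (time T) q)
    (U1 q) (pd 1 U1 q) (U1 q) (pd 0 U1 q) (pd 1 U1 q) (pd 1 (pd 1 U1) q) 1.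
  by apply: filterS F => q [].
have F4 : \forall q \near p, fml3 (cA th q) (cB th q) (cC th q) ((cC th' \o img T X) q) (pd 0 (time T) q)
    (U1 q) (pd 1 U1 q) (U0 q) (pd 0 U0 q) (pd 1 U0 q) (pd 1 (pd 1 U0) q) 0.
  by apply: filterS F => q [].
have x3 := formulas_x3 ok ad ad' a1 F3; have x4 := formulas_x3 ok ad ad' a0 F4.
have f30 : fml30 (cA th p) (cB th p) (cC th p) (cC th' (img T X p)) (pd 0 (time T) p)
    (U1 p) (pd 0 U1 p) (pd 1 U1 p) (pd 1 (pd 1 U1) p).
  by move: f3; rewrite /fml3 mulr1; exact.
have x34 := fml3x_aff u x3 x4.
exact: (eqD_scalarI A0 T0 X0 U10 alE alxE altE alxxE beE bexE psE psxE pstE psxxE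
  f1 f2 (fml3_aff u f3 f4) x1 x2 f30 x34 e0 e1 e2).
Qed.

Lemma det_tdZ_trDE0 v : \det (tdZ (trDE0 T X U1 U0) y v) != 0.
Proof.
rewrite trDE0E; have [a00 a10 a20] := tdZD0 T X (aff U1 U0) (omD X U1 U0) y v.
have [b0 b1 b2] := tdZD1 T X (aff U1 U0) (omD X U1 U0) y v.
have [_ _ c2] := tdZD T X (aff U1 U0) (omD X U1 U0) y v ord_max.
by rewrite det_upper3 // a00 b1 c2 pd_max_aff // !mulf_neq0.
Qed.

Hypothesis condD_all : forall v v', \det (tdZ (trDE0 T X U1 U0) y v) != 0 ->
  tdW (trDE0 T X U1 U0) y v = v' *m (tdZ (trDE0 T X U1 U0) y v)^T ->
  condD th th' (trDE0 T X U1 U0) y v v'.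

Let eqD_all p0 p1 p2 P0 P1 P2 :
  pd 0 al p * w + pst + p0 * al p = P0 * pd 0 (time T) p + P1 * pd 0 X p + P2 * Ut ->
  pd 1 al p * w + psx + p1 * al p = P1 * pd 1 X p + P2 * Ux ->
  be p + p2 * al p = P2 * U1 p ->
  eqD_scalar (cA th p) (cB th p) (cC th p) (pd 1 (cA th) p) (pd 1 (cB th) p) (pd 1 (cC th) p)
    (cA th' (img T X p)) (cB th' (img T X p)) (cC th' (img T X p))
    (pd 1 (cA th') (img T X p)) (pd 1 (cB th') (img T X p)) (pd 1 (cC th') (img T X p))
    (pd 1 X p) (pd 1 (pd 1 X) p) (pd 1 U1 p) (U1 p * u + U0 p) Uxx u w
    (al p) (pd 1 al p) (pd 1 (pd 1 al) p) (pd 1 be p) ps psxx p0 p1 p2 P0 P1 P2.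
Proof.
have [v [<- <- <-]] := row3E p0 p1 p2; have [v' [<- <- <-]] := row3E P0 P1 P2.
move=> e0 e1 e2; apply/condD_scalar; apply: condD_all; first exact: det_tdZ_trDE0.
by apply/tdWD_scalar.
Qed.

Lemma condD_fml1 : fml1 (cA th p) (cA th' (img T X p)) (pd 0 (time T) p) (pd 1 X p).
Proof. exact: (eqD_scalarE1 A0' T0 X0 U10 alE beE eqD_all). Qed.

Lemma condD_fml23 :
  fml1x (cA th p) (pd 1 (cA th) p) (pd 1 (cA th') (img T X p)) (pd 0 (time T) p)
    (pd 1 X p) (pd 1 (pd 1 X) p) ->
  fml2 (cA th p) (cB th p) (cB th' (img T X p)) (pd 0 (time T) p) (pd 0 X p)
        (pd 1 X p) (pd 1 (pd 1 X) p) (U1 p) (pd 1 U1 p) /\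
  fml3 (cA th p) (cB th p) (cC th p) (cC th' (img T X p)) (pd 0 (time T) p) (U1 p)
        (pd 1 U1 p) (U1 p * u + U0 p) Ut Ux Uxx u.
Proof.
move=> f; split; first exact: (eqD_scalarE2 A0 A0' T0 X0 U10 alE alxE beE eqD_all f).
exact: (eqD_scalarE3 A0 A0' T0 X0 U10 alE alxE beE psE eqD_all f).
Qed.

End AtD.
End EquivalenceD.

Section ConnectsD.
Context {R : realType}.
Implicit Types (th : coefs R).

Lemma base_trDE0 T X U1 U0 (y : 'rV[R]_4) : base (trDE0 T X U1 U0 y) = trL T X U1 U0 (base y).
Proof. by rewrite trDE0E /phiD base_adjoin. Qed.

Lemma base2_trDE0 T X U1 U0 (y : 'rV[R]_4) :
  base (base (trDE0 T X U1 U0 y)) = img T X (base (base y)).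
Proof. by rewrite base_trDE0 base_trL. Qed.

Lemma analytic_near_of_base n (f : 'rV[R]_n -> R) (y : 'rV[R]_n.+1) :
  analytic_near (f \o base) y -> analytic_near f (base y).
Proof.
rewrite -{1}[y]adjoin_base => /analytic_near_slice; apply: analytic_near_eq.
by apply: filterE => z; rewrite /= base_adjoin.
Qed.

Lemma point_transformation_trDE0_trL T X U1 U0 (y : 'rV[R]_4) :
  point_transformation (trDE0 T X U1 U0) y -> point_transformation (trL T X U1 U0) (base y).
Proof.
move=> /point_transformationP[an J]; apply/point_transformationP; split.
  move=> i; apply: analytic_near_of_base; apply: analytic_near_eq (an (lift ord_max i)).
  by apply: filterE => x; rewrite trDE0E /phiD adjoin_lift.
by move: J; rewrite trDE0E det_pdJ_adjoin mulf_eq0 negb_or => /andP[].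
Qed.

Lemma tr_ok_phiD T X U1 U0 (y : 'rV[R]_4) : tr_ok T X U1 U0 (base (base y)) ->
  point_transformation (trDE0 T X U1 U0) y.
Proof.
move=> ok; have /point_transformationP[an J] := tr_ok_phiL ok.
have [aT aX a1 a0 [t x u]] := ok.
have aXx := analytic_near_pd 1 aX.
have aal := analytic_near_div a1 aXx x.
have aaf : analytic_near (aff (fun p => pd 1 U1 p / pd 1 X p) (fun p => pd 1 U0 p / pd 1 X p)) (base y).
  exact: (analytic_near_aff (analytic_near_div (analytic_near_pd 1 a1) aXx x)
    (analytic_near_div (analytic_near_pd 1 a0) aXx x)).
have aalz := analytic_near_base aal.
have aom : analytic_near (omD X U1 U0) y by rewrite omDE; exact: analytic_near_aff.
apply/point_transformationP; split.
  move=> i; case: (unliftP ord_max i) => [k ->|->].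
    apply: analytic_near_eq (analytic_near_base (an k)).
    by apply: filterE => q; rewrite trDE0E /phiD adjoin_lift.
  apply: analytic_near_eq aom; apply: filterE => q.
  by rewrite trDE0E /phiD adjoin_max.
rewrite trDE0E det_pdJ_adjoin mulf_neq0 //.
rewrite omDE pd_max_aff; [|exact: analytic_near_diff aalz|exact: analytic_near_diff aaf].
by rewrite /= mulf_neq0 // invr_eq0.
Qed.

Lemma formulas_connectsD (y0 : 'rV[R]_4) th th' T X U1 U0 :
  tr_ok T X U1 U0 (base (base y0)) -> admissible_coefs th (base (base y0)) ->
  admissible_coefs th' (img T X (base (base y0))) ->
  (\forall p \near base (base y0), formulas th th' T X U1 U0 p) ->
  connectsDE0 y0 th th' (trDE0 T X U1 U0).
Proof.
move=> ok ad ad' F; have pt := tr_ok_phiD ok.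
have ad'y : admissible_coefs th' (base (base (trDE0 T X U1 U0 y0))) by rewrite base2_trDE0.
split; [exact: ad | exact: ad'y | exact: pt |].
have n1 := near_base2 (admissible_coefs_open ad).
have n2 := near_point_transformation pt (near_base2 (admissible_coefs_open ad'y)).
have n3 := near_base2 (near_near F); have n4 := near_base2 (tr_ok_open ok).
have n5 := point_transformation_open pt.
rewrite /maps_diffeq; near=> y => j j' jy pr.
have oky : tr_ok T X U1 U0 (base (base y)) by near: y; exact: n4.
have ady : admissible_coefs th (base (base y)) by near: y; exact: n1.
have ady' : admissible_coefs th' (base (base (trDE0 T X U1 U0 y))) by near: y; exact: n2.
have ady'' : admissible_coefs th' (img T X (base (base y))) by move: ady'; rewrite base2_trDE0.
have A0 : cA th (base (base y)) != 0 by case: ady.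
have A0' : cA th' (base (base (trDE0 T X U1 U0 y))) != 0 by case: ady'.
have Fy : \forall q \near base (base y), formulas th th' T X U1 U0 q by near: y; exact: n3.
have J0 : \det (pdJ (trDE0 T X U1 U0) y) != 0.
  have /point_transformationP[_ J] : point_transformation (trDE0 T X U1 U0) y.
    by near: y; exact: n5.
  exact: J.
have /prolongP[_ Z0 W _] := pr; rewrite jy in W.
apply: (parabolic_sufficient (parabolicD th) (parabolicD th') A0 A0' J0 jy pr).
  rewrite nuD_mul trDE0E; have [_ -> ->] := tdZD1 T X (aff U1 U0) (omD X U1 U0) y (jd1 j).
  by rewrite mulr0 addr0; case: oky => _ _ _ _ [].
exact: (formulas_condD oky ady ady'' Fy W).
Unshelve. all: by end_near. Qed.

(** A bootstrap: the rule for A is obtained at every nearby point and then differentiated, which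
    unlocks the rules for B and C; two values of u split the last rule into its parts for [U1] and
    [U0]. *)
Lemma connectsD_formulas (y0 : 'rV[R]_4) th th' T X U1 U0 :
  tr_ok T X U1 U0 (base (base y0)) -> connectsDE0 y0 th th' (trDE0 T X U1 U0) ->
  \forall p \near base (base y0), formulas th th' T X U1 U0 p.
Proof.
move=> ok /connectsD_open/near_slice/near_two_fibers[d d0 H].
set w := fiber y0 in H; set u := fiber (base y0) in H.
have okn := tr_ok_open ok.
have tools q v (oq : tr_ok T X U1 U0 q) (c : connectsDE0 (adjoin (adjoin q v) w) th th' (trDE0 T X U1 U0)) :
  [/\ admissible_coefs th q, admissible_coefs th' (img T X q),
      fml1 (cA th q) (cA th' (img T X q)) (pd 0 (time T) q) (pd 1 X q) &
      fml1x (cA th q) (pd 1 (cA th) q) (pd 1 (cA th') (img T X q)) (pd 0 (time T) q)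
        (pd 1 X q) (pd 1 (pd 1 X) q) ->
      fml2 (cA th q) (cB th q) (cB th' (img T X q)) (pd 0 (time T) q) (pd 0 X q)
        (pd 1 X q) (pd 1 (pd 1 X) q) (U1 q) (pd 1 U1 q) /\
      fml3 (cA th q) (cB th q) (cC th q) (cC th' (img T X q)) (pd 0 (time T) q) (U1 q)
        (pd 1 U1 q) (U1 q * v + U0 q) (pd 0 U1 q * v + pd 0 U0 q) (pd 1 U1 q * v + pd 1 U0 q)
        (pd 1 (pd 1 U1) q * v + pd 1 (pd 1 U0) q) v].
  have cond := connectsD_cond c.
  have [a a' _ _] := c; rewrite /= !base_adjoin in a; rewrite /= base2_trDE0 !base_adjoin in a'.
  have k1 := @condD_fml1 R th th' T X U1 U0 (adjoin (adjoin q v) w).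
  have k2 := @condD_fml23 R th th' T X U1 U0 (adjoin (adjoin q v) w).
  rewrite !base_adjoin ?fiber_adjoin in k1 k2.
  by split; [exact: a | exact: a' | exact: (k1 oq a' cond) | exact: (k2 oq a a' cond)].
have F1 : \forall q \near base (base y0), fml1 (cA th q) (cA th' (img T X q)) (pd 0 (time T) q) (pd 1 X q).
  by move: okn H; apply: filterS2 => q oq [c _]; have [] := tools q u oq c.
near=> q.
have oq : tr_ok T X U1 U0 q by near: q; exact: okn.
have [c0 c1] : connectsDE0 (adjoin (adjoin q u) w) th th' (trDE0 T X U1 U0) /\
   connectsDE0 (adjoin (adjoin q (u + d)) w) th th' (trDE0 T X U1 U0) by near: q; exact: H.
have [a a' f1 g0] := tools q u oq c0; have [_ _ _ g1] := tools q (u + d) oq c1.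
have F1q : \forall q' \near q, fml1 (cA th q') (cA th' (img T X q')) (pd 0 (time T) q') (pd 1 X q').
  by near: q; exact: near_near F1.
have x1 := formulas_x1 oq a a' F1q.
have [f2 e0] := g0 x1; have [_ e1] := g1 x1.
have dd : u + d != u by rewrite -subr_eq0 addrAC subrr add0r.
have [f3 f4] := fml3_aff_inv dd e1 e0.
split; [exact: f1|exact: f2|exact: f3|exact: f4].
Unshelve. all: by end_near. Qed.

End ConnectsD.

(** * Transformations of the determining equations *)

Section StructureD.
Context {R : realType}.
Implicit Types (th : coefs R) (y : 'rV[R]_4).

Lemma fiber_line y (d : R) : fiber (y + d *: delta_mx 0 ord_max) = fiber y + d.
Proof. exact: lineE. Qed.

Lemma slope0 (a b c d : R) : d != 0 -> a + c * b = 0 -> a + (c + d) * b = 0 -> b = 0 /\ a = 0.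
Proof.
move=> d0 e0 e1.
have b0 : b = 0.
  apply: (mulfI d0); rewrite mulr0.
  transitivity ((a + (c + d) * b) - (a + c * b)); first by ring.
  by rewrite e0 e1 subrr.
by split=> //; move: e0; rewrite b0 mulr0 addr0.
Qed.

(** The time entry of the direction condition is affine in [eta_x] with slope [T_eta]. The remaining
    relation [T_x + eta T_u = 0] is split later, by varying eta. *)
Lemma structD_time y th th' phi : connectsDE0 y th th' phi ->
  pd ord_max (zc phi 0) y = 0 /\
  pd (lift ord_max 1) (zc phi 0) y + fiber y * pd (lift ord_max ord_max) (zc phi 0) y = 0.
Proof.
move=> c; have [_ _ /point_transformationP[_ J] _] := c.
have [p np] := det_tdZ_near J.
have key q : \det (tdZ phi y q) != 0 ->
    (pd (lift ord_max 1) (zc phi 0) y + fiber y * pd (lift ord_max ord_max) (zc phi 0) y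
     + fiber y * q 0 ord_max * pd ord_max (zc phi 0) y) + q 0 1 * pd ord_max (zc phi 0) y = 0.
  move=> Z0; have [q' W] := tdW_solve Z0.
  have [e _] := connectsD_cond c Z0 W.
  have : tdZ phi y q 1 0 + fiber y * tdZ phi y q ord_max 0 = 0.
    by rewrite -(nuD_mul y) e [LHS]mxE nuD0 mulr0.
  rewrite mxE [tdZ _ _ _ _ _]mxE /td1 => e0; rewrite -[RHS]e0; gen_pd; ring.
have [d d0 [/key e0 /key e1 _]] := near_line 1 np.
rewrite lineE (@lineN R 3 _ _ 1 ord_max isT) in e1.
have [b0 a0] := slope0 d0 e0 e1.
by split; [exact: b0 | rewrite -[RHS]a0 b0 mulr0 addr0].
Qed.

(** The slopes enter [D_x X] only through [X_eta], which must vanish as in the linear case. The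
    surviving relation still contains [X_u], and is returned so that it can be compared at different
    values of eta. *)
Lemma structD_space y th th' phi T : connectsDE0 y th th' phi ->
  (\forall x \near y, zc phi 0 x = (time T \o base \o base) x) ->
  pd ord_max (zc phi 1) y = 0 /\
  cA th (base (base y)) *
    (pd (lift ord_max 1) (zc phi 1) y + fiber y * pd (lift ord_max ord_max) (zc phi 1) y) ^+ 2 =
  pd (lift ord_max 0) (zc phi 0) y * cA th' (base (base (phi y))).
Proof.
move=> c zT; have [ad ad' /point_transformationP[an J] _] := c.
have [Tw _] := structD_time c.
have [p np] := det_tdZ_near J.
have zT' : \forall x \near y, zc phi 0 x = ((time T \o base) \o base) x by exact: zT.
have Tz i : i != 0 -> pd i (time T \o base) = fun=> 0 :> R.
  move: i; apply: ord3P => // _; last exact: pd_max_baseF.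
  by rewrite pd1_base2; apply/funext => x; exact: pd1_time.
have key : nbhs p (fun q : 'rV[R]_3 => cA th (base (base y)) *
    ((pd (lift ord_max 1) (zc phi 1) y + fiber y * pd (lift ord_max ord_max) (zc phi 1) y)
     + (q 0 1 + fiber y * q 0 ord_max) * pd ord_max (zc phi 1) y) ^+ 2 =
    pd (lift ord_max 0) (zc phi 0) y * cA th' (base (base (phi y)))).
  move: (near_near np); apply: filterS => q nq; have Zq := nbhs_singleton nq.
  have [e e0 [_ Zqe _]] := near_line 0 nq.
  have Tx i : i != 0 -> pd (lift ord_max i) (zc phi 0) y = 0.
    by move=> i0; rewrite (pd_near_eq _ zT') pd_lift_base Tz.
  have Txx r i l : i != 0 -> l != 0 -> td2 (zc phi 0) y r i l = 0.
    by move=> i0 _; rewrite (td2_near_eq _ _ _ zT') td2_base Tz // pd_cst.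
  have Gt th1 x r (t : R) : GD th1 x (r + t *: delta_mx 0 0) = GD th1 x r.
    by rewrite /GD !lineN.
  have A0' : alD th' (phi y) != 0 by case: ad'.
  have e1 := (@par_cond_time R 1 phi y (alD th) (alD th') nuD nuD (GD th) (GD th') A0' q e
    (nuD0 y) Tw Tx Txx (Gt th y) (Gt th' (phi y)) e0 J Zq Zqe (fun r r' Z W => connectsD_cond c Z W)).
  apply: etrans (esym e1); clear e1.
  rewrite /alD nuD_mul mxE [tdZ _ _ _ _ _]mxE /td1; congr (_ * _ ^+ 2).
  by gen_pd; ring.
have A0 : cA th (base (base y)) != 0 by case: ad.
have [d d0 [e0 e1 e2]] := near_line 1 key.
move: e0 e1 e2; cbv beta; rewrite !lineE !(@lineN R 3 _ _ 1 ord_max isT).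
generalize (pd (lift ord_max 0) (zc phi 0) y * cA th' (base (base (phi y)))) => K.
generalize (pd ord_max (zc phi 1) y) => b.
generalize (pd (lift ord_max 1) (zc phi 1) y + fiber y * pd (lift ord_max ord_max) (zc phi 1) y) => a.
move=> e0 e1 e2.
have sq x : cA th (base (base y)) * x ^+ 2 = K -> x ^+ 2 = K / cA th (base (base y)).
  by move=> <-; rewrite mulrC mulKf.
have b0 : b = 0.
  apply: (@sq_const_slope _ (a + (p 0 1 + fiber y * p 0 ord_max) * b) b d _ d0 (sq _ e0)).
    by rewrite -(sq _ e1); congr (_ ^+ 2); ring.
  by rewrite -(sq _ e2); congr (_ ^+ 2); ring.
by split; [exact: b0 | rewrite -e0 b0 mulr0 addr0].
Qed.

(** The last entry of the direction condition is [D_x U = D_x X * eta']. With [X_eta = 0] its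
    right-hand side does not depend on the slopes, while the left-hand side has slope [U_eta] in
    [eta_x]. *)
Lemma structD_contact y th th' phi : connectsDE0 y th th' phi ->
  pd ord_max (zc phi 1) y = 0 -> pd ord_max (zc phi ord_max) y = 0.
Proof.
move=> c Xw; have [_ _ /point_transformationP[_ J] _] := c.
have [p np] := det_tdZ_near J.
have key q : \det (tdZ phi y q) != 0 ->
    (pd (lift ord_max 1) (zc phi ord_max) y + fiber y * pd (lift ord_max ord_max) (zc phi ord_max) y
     + fiber y * q 0 ord_max * pd ord_max (zc phi ord_max) y
     - (pd (lift ord_max 1) (zc phi 1) y + fiber y * pd (lift ord_max ord_max) (zc phi 1) y) * fiber (phi y))
    + q 0 1 * pd ord_max (zc phi ord_max) y = 0.
  move=> Z0; have [q' W] := tdW_solve Z0.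
  have [e _] := connectsD_cond c Z0 W.
  have e0 : tdZ phi y q 1 ord_max + fiber y * tdZ phi y q ord_max ord_max
      - (tdZ phi y q 1 1 + fiber y * tdZ phi y q ord_max 1) * fiber (phi y) = 0.
    by apply/eqP; rewrite subr_eq0 -!(nuD_mul y) {1}e [X in X == _]mxE nuDm.
  rewrite -[RHS]e0 ![tdZ _ _ _ _ _]mxE /td1 Xw; gen_pd; ring.
have [d d0 [/key e0 /key e1 _]] := near_line 1 np.
rewrite lineE (@lineN R 3 _ _ 1 ord_max isT) in e1.
by have [b0 _] := slope0 d0 e0 e1.
Qed.

End StructureD.

Section StructureDForm.
Context {R : realType}.
Implicit Types (th : coefs R) (y : 'rV[R]_4).

Lemma structD_phi y1 th th' phi T : connectsDE0 y1 th th' phi ->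
  (\forall y \near y1, zc phi 0 y = (time T \o base \o base) y) ->
  exists X U om, \forall y \near y1, phi y = phiD T X U om y.
Proof.
move=> c zT; have nc := connectsD_open c; have nT := near_near zT.
have [_ _ /point_transformationP[an _] _] := c.
have diff k : \forall y \near y1, differentiable (zc phi k) y.
  by move: (an (lift ord_max k)); apply: filterS => y; exact: analytic_differentiable.
have h1 : \forall y \near y1, differentiable (zc phi 1) y /\ pd ord_max (zc phi 1) y = 0.
  move: (diff 1) nc nT => d n1 n2; near=> y; split; first by near: y.
  have cy : connectsDE0 y th th' phi by near: y.
  have nTy : \forall x \near y, zc phi 0 x = (time T \o base \o base) x by near: y.
  by have [] := structD_space cy nTy.
have h2 : \forall y \near y1, differentiable (zc phi ord_max) y /\ pd ord_max (zc phi ord_max) y = 0.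
  move: (diff ord_max) nc h1 => d n1 n2; near=> y; split; first by near: y.
  have cy : connectsDE0 y th th' phi by near: y.
  apply: (structD_contact cy).
  have [//] : differentiable (zc phi 1) y /\ pd ord_max (zc phi 1) y = 0 by near: y.
pose G k z := zc phi k (adjoin z (fiber y1)).
have f1 := near_base_form h1; have f2 := near_base_form h2.
(* The target point [(t', x')] as a function of [(t, x, u)] alone, so that the target coefficient is
   visibly independent of eta. *)
pose I z : 'rV[R]_2 := \row_(k < 2) [:: T (base z 0 0); G 1 z]`_k.
have fB : \forall y \near y1, base (base (phi y)) = I (base y).
  move: zT f1; apply: filterS2 => y e0 e1; apply/rowP; apply: ord2P; rewrite [RHS]mxE /=.
    by rewrite -[RHS]e0 mxE mxE; congr (phi y 0 (lift _ _)); exact: val_inj.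
  by rewrite -[RHS]e1 mxE mxE; congr (phi y 0 (lift _ _)); exact: val_inj.
have k1 : \forall y \near y1, cA th (base (base y)) *
    (pd 1 (G 1) (base y) + fiber y * pd ord_max (G 1) (base y)) ^+ 2 =
    pd 0 (time T \o base) (base y) * cA th' (I (base y)) /\ cA th (base (base y)) != 0.
  have nf1 := near_near f1; near=> y.
  have cy : connectsDE0 y th th' phi by near: y.
  have nTy : \forall x \near y, zc phi 0 x = (time T \o base \o base) x by near: y.
  have nfy : \forall x \near y, zc phi 1 x = (G 1 \o base) x by near: y.
  have nfB : base (base (phi y)) = I (base y) by near: y.
  have [_ e] := structD_space cy nTy.
  move: e; rewrite nfB (pd_near_eq _ nTy) !(pd_near_eq _ nfy) !pd_lift_base => e.
  by split; [exact: e | case: cy => [[]]].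
(* Vary eta over one point [(t, x, u)] in [A (X_x + eta X_u)^2 = T_t A']: only the linear function
   under the square changes. *)
have k2 : \forall y \near y1, pd ord_max (G 1) (base y) = 0.
  move: (near_near k1); apply: filterS => y ny.
  have [d d0 [[e0 A0] [e1 _] [e2 _]]] := near_line ord_max ny.
  move: e0 e1 e2 A0; rewrite !base_line_maxr !fiber_line.
  generalize (pd 0 (time T \o base) (base y) * cA th' (I (base y))) => K.
  generalize (pd 1 (G 1) (base y)) (pd ord_max (G 1) (base y)) => a b e0 e1 e2 A0.
  have sq x : cA th (base (base y)) * x ^+ 2 = K -> x ^+ 2 = K / cA th (base (base y)).
    by move=> <-; rewrite mulrC mulKf.
  apply: (@sq_const_slope _ (a + fiber y * b) b d _ d0 (sq _ e0)).
    by rewrite -(sq _ e1); congr (_ ^+ 2); ring.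
  by rewrite -(sq _ e2); congr (_ ^+ 2); ring.
have h3 : \forall z \near base y1, differentiable (G 1) z /\ pd ord_max (G 1) z = 0.
  move: (near_slice k2) (near_slice (an (lift ord_max 1))); apply: filterS2 => z e az; split.
    by apply: analytic_differentiable; exact: analytic_slice.
  by move: e; rewrite base_adjoin.
have f3 := near_base (near_base_form h3).
exists (fun p => G 1 (adjoin p (fiber (base y1)))), (G ord_max), (oc phi).
near=> y.
have e0 : zc phi 0 y = (time T \o base \o base) y by near: y.
have e1 : zc phi 1 y = (G 1 \o base) y by near: y.
have e2 : zc phi ord_max y = (G ord_max \o base) y by near: y.
have e3 : G 1 (base y) = ((fun p => G 1 (adjoin p (fiber (base y1)))) \o base) (base y) by near: y.
apply/rowP => i; rewrite /phiD; case: (unliftP ord_max i) => [k ->|->]; last by rewrite adjoin_max.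
rewrite adjoin_lift; move: k; apply: ord3P.
- by rewrite /phiL ord3_0 adjoin_lift img0 -ord3_0; exact: e0.
- by rewrite /phiL ord3_1 adjoin_lift img1 -ord3_1 -[LHS]/(zc phi 1 y) e1; exact: e3.
- by rewrite /phiL adjoin_max; exact: e2.
Unshelve. all: by end_near. Qed.

Lemma connectsD_phi y1 th th' phi : connectsDE0 y1 th th' phi ->
  exists T X U om, \forall y \near y1, phi y = phiD T X U om y.
Proof.
move=> c; have nc := connectsD_open c.
have [_ _ /point_transformationP[an _] _] := c.
have h0 : \forall y \near y1, differentiable (zc phi 0) y /\ pd ord_max (zc phi 0) y = 0.
  move: nc (an (lift ord_max 0)); apply: filterS2 => y cy ay.
  by split; [exact: analytic_differentiable | have [] := structD_time cy].
have f0 := near_base_form h0.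
pose G z := zc phi 0 (adjoin z (fiber y1)).
have k1 : \forall y \near y1, pd 1 G (base y) + fiber y * pd ord_max G (base y) = 0.
  move: nc (near_near f0); apply: filterS2 => y cy nfy.
  by have [_] := structD_time cy; rewrite !(pd_near_eq _ nfy) !pd_lift_base.
(* [G] does not depend on eta, so two values of eta separate [G_x + eta G_u = 0]. *)
have k2 : \forall y \near y1, pd 1 G (base y) = 0 /\ pd ord_max G (base y) = 0.
  move: (near_near k1); apply: filterS => y ny.
  have [d d0 [e0 e1 _]] := near_line ord_max ny.
  move: e1; rewrite base_line_maxr fiber_line => e1.
  by have [] := slope0 d0 e0 e1.
have h3 : \forall z \near base y1, [/\ differentiable G z, pd 1 G z = 0 & pd ord_max G z = 0].
  move: (near_slice k2) (near_slice (an (lift ord_max 0))); apply: filterS2 => z e az.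
  move: e; rewrite base_adjoin => -[e1 e2]; split=> //.
  by apply: analytic_differentiable; exact: analytic_slice.
have h4 : \forall z \near base y1, differentiable G z /\ pd ord_max G z = 0.
  by apply: filterS h3 => z [].
have f4 := near_base_form h4.
have [T hT] : exists T, \forall p \near base (base y1), G (adjoin p (fiber (base y1))) = time T p.
  apply: near_time_form; move: (near_slice h3) (near_slice (near_slice (an (lift ord_max 0)))).
  apply: filterS2 => p [_ e _] ap; split.
    by apply: analytic_differentiable; exact: analytic_slice (analytic_slice ap).
  by rewrite pd_slice -ord3_1.
have zT : \forall y \near y1, zc phi 0 y = (time T \o base \o base) y.
  near=> y.
  have e0 : zc phi 0 y = (G \o base) y by near: y.
  have e1 : G (base y) = ((fun p => G (adjoin p (fiber (base y1)))) \o base) (base y).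
    by near: y; exact: near_base f4.
  have e2 : G (adjoin (base (base y)) (fiber (base y1))) = time T (base (base y)).
    by near: y; exact: near_base2 hT.
  by rewrite e0 -[LHS]/(G (base y)) e1; exact: e2.
have [X [U [om H]]] := structD_phi c zT.
by exists T, X, U, om.
Unshelve. all: by end_near. Qed.
End StructureDForm.

Section StructureDAffine.
Context {R : realType}.
Implicit Types (th : coefs R) (y : 'rV[R]_4).

Lemma phiD_nonzero y T X U om : \det (pdJ (phiD T X U om) y) != 0 ->
  [/\ pd ord_max om y != 0, pd ord_max U (base y) != 0,
      pd 1 X (base (base y)) != 0 & pd 0 (time T) (base (base y)) != 0].
Proof. by rewrite det_pdJ_D !mulf_eq0 !negb_or => /and4P. Qed.

Lemma det_tdZ_phiD y T X U om v : \det (tdZ (phiD T X U om) y v) =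
  pd 0 (time T) (base (base y)) * pd 1 X (base (base y)) * pd ord_max U (base y).
Proof.
have [a0 a1 a2] := tdZD0 T X U om y v; have [b0 b1 b2] := tdZD1 T X U om y v.
have [_ _ c2] := tdZD T X U om y v ord_max.
by rewrite (det_upper3 a1 a2 b2) a0 b1 c2.
Qed.

Lemma phiD_contact y th th' T X U om : connectsDE0 y th th' (phiD T X U om) ->
  pd 1 U (base y) + fiber y * pd ord_max U (base y) = pd 1 X (base (base y)) * om y.
Proof.
move=> c; have [_ _ /point_transformationP[_ J] _] := c.
have [_ Uu0 X0 T0] := phiD_nonzero J.
have Z0 : \det (tdZ (phiD T X U om) y 0) != 0 by rewrite det_tdZ_phiD !mulf_neq0.
have [p' W] := tdW_solve Z0.
by have /condDE[] := connectsD_cond c Z0 W.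
Qed.

(** The coefficient of [eta_x] in the condition, as the difference of its values at [eta_x = 1] and
    [eta_x = 0], the other slopes being 0. It is affine in eta; the slope [2 A a_u] comes from the
    term [2 eta eta_xu] of the equation. *)
Lemma phiD_affine y th th' T X U om (a b : 'rV[R]_3 -> R) :
  connectsDE0 y th th' (phiD T X U om) ->
  analytic_near a (base y) -> analytic_near b (base y) ->
  (\forall x \near y, om x = aff a b x) ->
  let q := base (base y) in let i := img T X q in
  let d := a (base y) / pd 1 X q in
  - a (base y) * (pd 1 (cA th) q + cB th q)
  + cA th q * (2 * pd 1 a (base y) - d * pd 1 (pd 1 X) q)
  - cA th q * pd 1 X q ^+ 2 * ((- d * pd 0 X q / pd 0 (time T) q
      - (pd 1 (cA th') i + cB th' i) * d) / cA th' i)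
  + fiber y * (2 * cA th q * pd ord_max a (base y)) = 0.
Proof.
move=> c aa ab E; have [_ [_ _ _ +] /point_transformationP[_ J] _] := c.
rewrite /phiD /phiL /= !base_adjoin => A0'.
have [_ Uu0 X0 T0] := phiD_nonzero J.
have da := analytic_near_diff aa; have db := analytic_near_diff ab.
pose P2 := (pd ord_max a (base y) * fiber y + pd ord_max b (base y)) / pd ord_max U (base y).
pose P1 v := (pd 1 a (base y) * fiber y + pd 1 b (base y) + v * a (base y)
  - P2 * pd 1 U (base y)) / pd 1 X (base (base y)).
pose P0 v := (pd 0 a (base y) * fiber y + pd 0 b (base y)
  - P2 * pd 0 U (base y) - P1 v * pd 0 X (base (base y))) / pd 0 (time T) (base (base y)).
pose Ev v := a (base y) * (0 - (pd 1 (cA th) (base (base y)) * (v + fiber y * 0)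
    + (pd 1 (cB th) (base (base y)) * fiber y + cB th (base (base y)) * v)
    + cC th (base (base y)) * (fiber y - fiber (base y) * 0)
    + pd 1 (cC th) (base (base y)) * fiber (base y)))
  + cA th (base (base y)) *
   (pd 1 (pd 1 a) (base y) * fiber y + pd 1 (pd 1 b) (base y) + v * pd 1 a (base y)
       + v * pd 1 a (base y) - P1 v * pd 1 (pd 1 X) (base (base y)) - P2 * pd 1 (pd 1 U) (base y)
     + fiber y * (pd ord_max (pd 1 a) (base y) * fiber y + pd ord_max (pd 1 b) (base y) 
          + 0 * pd 1 a (base y) + v * pd ord_max a (base y)
        + (pd 1 (pd ord_max a) (base y) * fiber y + pd 1 (pd ord_max b) (base y)
          + v * pd ord_max a (base y) + 0 * pd 1 a (base y))
         - P2 * (pd ord_max (pd 1 U) (base y) + pd 1 (pd ord_max U) (base y)))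
     + fiber y ^+ 2 * (pd ord_max (pd ord_max a) (base y) * fiber y + pd ord_max (pd ord_max b) (base y)
         + 0 * pd ord_max a (base y) + 0 * pd ord_max a (base y)
         - P2 * pd ord_max (pd ord_max U) (base y)))
  - cA th (base (base y)) * pd 1 X (base (base y)) ^+ 2 *
     ((P0 v - (pd 1 (cA th') (img T X (base (base y))) * (P1 v + om y * P2)
         + (pd 1 (cB th') (img T X (base (base y))) * om y + cB th' (img T X (base (base y))) * P1 v)
         + cC th' (img T X (base (base y))) * (om y - U (base y) * P2)
         + pd 1 (cC th') (img T X (base (base y))) * U (base y))) / cA th' (img T X (base (base y)))).
have E0 v : Ev v = 0.
  have [p [p0 p1 p2]] := row3E 0 v 0; have [p' [p0' p1' p2']] := row3E (P0 v) (P1 v) P2.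
  have t1 i : td1 om y p i = pd i a (base y) * fiber y + pd i b (base y) + p 0 i * a (base y).
    by rewrite (td1_near_eq _ _ E) td1_aff.
  have W : tdW (phiD T X U om) y p = p' *m (tdZ (phiD T X U om) y p)^T.
    apply/tdWD; rewrite !t1 p0 p1 p2 p0' p1' p2'; split.
    - by rewrite mul0r addr0 /P0 mulfVK // subrK subrK.
    - by rewrite /P1 mulfVK // subrK.
    - by rewrite mul0r addr0 /P2 mulfVK.
  have Z0 : \det (tdZ (phiD T X U om) y p) != 0 by rewrite det_tdZ_phiD !mulf_neq0.
  have /condDE[_] := connectsD_cond c Z0 W; rewrite /GD.
  rewrite !(td2_near_eq _ _ _ E) !(td2_aff aa ab) (pd_near_eq _ E) (pd_max_aff da db).
  rewrite /phiD /phiL !base_adjoin !fiber_adjoin p0 p1 p2 p0' p1' p2' => e.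
  by apply/eqP; rewrite subr_eq0; apply/eqP; exact: e.
cbv zeta.
transitivity (Ev 1 - Ev 0); last by rewrite !E0 subrr.
rewrite /Ev /P0 /P1; clear Ev E0 P0 P1.
set i := img T X (base (base y)) in A0' *; set q := base (base y) in X0 T0 *.
move: X0 T0 A0'; generalize P2 (a (base y)); gen_pd.
generalize (cA th q) (cB th q) (cC th q) (cA th' i) (cB th' i) (cC th' i) (fiber y)
  (fiber (base y)) (om y) (U (base y)); clear.
by move=> *; field; apply/and3P; split.
Qed.
End StructureDAffine.

Section StructureDE0.
Context {R : realType}.
Implicit Types (th : coefs R) (y : 'rV[R]_4).

Lemma connectsD_structure y1 th th' phi : connectsDE0 y1 th th' phi ->
  exists T X U1 U0, \forall y \near y1, phi y = trDE0 T X U1 U0 y.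
Proof.
move=> c0; have [T [X [U [om E]]]] := connectsD_phi c0.
have c := connects_germ E c0; have nc := connectsD_open c.
have [_ _ /point_transformationP[an J] _] := c.
have [_ _ X0 _] := phiD_nonzero J.
have anU : analytic_near U (base y1).
  apply: analytic_near_of_base; apply: analytic_near_eq (an (lift ord_max ord_max)).
  by apply: filterE => x; rewrite -[LHS]/(zc (phiD T X U om) ord_max x) zcDm.
have anX : analytic_near X (base (base y1)).
  apply: analytic_near_of_base; apply: analytic_near_of_base.
  apply: analytic_near_eq (an (lift ord_max 1)).
  by apply: filterE => x; rewrite -[LHS]/(zc (phiD T X U om) 1 x) zcD1.
have anXx := analytic_near_pd 1 anX.
have anXx3 := analytic_near_base anXx.
(* The contact condition [U_x + eta U_u = X_x om] solved for [om], which is thus affine in eta with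
   these coefficients. *)
pose a z := pd ord_max U z / pd 1 X (base z); pose b z := pd 1 U z / pd 1 X (base z).
have aa : analytic_near a (base y1) := analytic_near_div (analytic_near_pd ord_max anU) anXx3 X0.
have ab : analytic_near b (base y1) := analytic_near_div (analytic_near_pd 1 anU) anXx3 X0.
have nX0 : \forall z \near base y1, pd 1 X (base z) != 0.
  exact: near_base (near_continuous_neq0 (analytic_near_diff anXx) X0).
have Eom : \forall y \near y1, om y = aff a b y.
  move: nc (near_base nX0); apply: filterS2 => y cy Xy.
  have := phiD_contact cy; rewrite /aff /a /b => e.
  apply: (mulfI Xy); rewrite -e; move: Xy; gen_pd => Xy.
  by field.
(* Two values of eta in the relation of [phiD_affine] give [2 A a_u = 0]. As [a = U_u / X_x] and
   [X_x] does not depend on u, this will mean [U_uu = 0]. *)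
have nA : \forall y \near y1, pd ord_max a (base y) = 0.
  have k : \forall y \near y1, [/\ connectsDE0 y th th' (phiD T X U om), analytic_near a (base y),
      analytic_near b (base y) & \forall x \near y, om x = aff a b x].
    have n1 := near_base (analytic_near_open aa); have n2 := near_base (analytic_near_open ab).
    have n3 := near_near Eom.
    have n12 := near2 (fun _ h1 h2 => conj h1 h2) n1 n2.
    move: n3; apply: near2 (near2 (fun _ h1 h2 => conj h1 h2) nc n12) => y [h [h1 h2]] h3.
    by split; [exact: h | exact: h1 | exact: h2 | exact: h3].
  move: (near_near k); apply: filterS => y ny.
  have [d d0 [[cy ay b_y Ey] [cy' ay' by' Ey'] _]] := near_line ord_max ny.
  have e0 := phiD_affine cy ay b_y Ey; have e1 := phiD_affine cy' ay' by' Ey'.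
  cbv zeta in e0, e1; rewrite base_line_maxr fiber_line in e1.
  have [b0 _] := slope0 d0 e0 e1.
  have [[_ _ _ A0] _ _ _] := cy.
  by apply/eqP; move/eqP: b0; rewrite !mulf_eq0 (negPf A0) pnatr_eq0.
have nU : \forall z \near base y1, pd ord_max (pd ord_max U) z = 0.
  have n1 := near_slice nA; have n3 := near_base (analytic_near_open anXx).
  have n4 := analytic_near_open aa; have n5 := near_near nX0.
  near=> z.
  have az : pd ord_max a z = 0.
    have : pd ord_max a (base (adjoin z (fiber y1))) = 0 by near: z.
    by rewrite base_adjoin.
  have daz : differentiable a z by apply: analytic_near_diff; near: z.
  have dX : differentiable (pd 1 X \o @base R 2) z.
    apply: analytic_near_diff; apply: analytic_near_base; near: z; exact: n3.
  have nXz : \forall x \near z, pd 1 X (base x) != 0 by near: z.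
  have e : \forall x \near z, pd ord_max U x = a x * (pd 1 X \o @base R 2) x.
    by apply: filterS nXz => x Xx; rewrite /a mulfVK.
  by rewrite (pd_near_eq _ e) pd_mul // az pd_max_base mul0r mulr0 addr0.
have [U1 [U0 [a1 a0 EU]]] := near_affine_form anU nU.
exists T, X, U1, U0.
have n1 := near_base EU; have n2 := near_base (near_near EU).
have n3 := near_base2 (analytic_near_open a1); have n4 := near_base2 (analytic_near_open a0).
near=> y.
have ey : phi y = phiD T X U om y by near: y.
have eU : U (base y) = aff U1 U0 (base y) by near: y.
have nUy : \forall z \near base y, U z = aff U1 U0 z by near: y.
have eo : om y = aff a b y by near: y.
have b1 : analytic_near U1 (base (base y)) by near: y.
have b0 : analytic_near U0 (base (base y)) by near: y.
have d1 := analytic_near_diff b1; have d0 := analytic_near_diff b0.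
have ea : pd ord_max U (base y) = U1 (base (base y)).
  by rewrite (pd_near_eq _ nUy) pd_max_aff.
have eb : pd 1 U (base y) = pd 1 U1 (base (base y)) * fiber (base y) + pd 1 U0 (base (base y)).
  by rewrite (pd_near_eq _ nUy) pd1_aff2.
rewrite ey trDE0E /phiD /phiL eU eo; congr adjoin.
rewrite /aff /a /b ea eb /omD; gen_pd.
by rewrite mulrDl addrA; congr (_ + _ + _); rewrite mulrAC.
Unshelve. all: by end_near. Qed.
End StructureDE0.

(** * Equality of germs *)

Section GermEquality.
Context {R : realType}.
Implicit Types (th : coefs R) (T : R -> R) (X : 'rV[R]_2 -> R).

Lemma diffeq_germP n (y : 'rV[R]_n.+1) (E E' : diffeq R n) :
  diffeq_germ y E = diffeq_germ y E' <->
  \forall x \near y, forall j, jpt j = x -> (E j <-> E' j).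
Proof.
split=> [e|H].
  have : diffeq_germ y E E.
    have h : \forall x \near y, forall j, jpt j = x -> (E j <-> E j) by apply: filterE.
    exact: h.
  by rewrite e.
apply/seteqP; split=> E1 /= H1; apply: near2 H H1 => x h h1 j jx.
  by rewrite (h1 j jx) (h j jx).
by rewrite (h1 j jx) (h j jx).
Qed.

Lemma map_germP n (y : 'rV[R]_n.+1) (phi psi : 'rV[R]_n.+1 -> 'rV[R]_n.+1) :
  map_germ y phi = map_germ y psi <-> \forall x \near y, phi x = psi x.
Proof.
split=> [e|H].
  have : map_germ y phi phi.
    have h : \forall x \near y, phi x = phi x by apply: filterE.
    exact: h.
  by rewrite e.
by apply/seteqP; split=> f /= H1; apply: near2 H H1 => x -> ->.
Qed.

Definition coefs_eq th th2 (p : 'rV[R]_2) := \forall q \near p,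
  [/\ cA th q = cA th2 q, cB th q = cB th2 q & cC th q = cC th2 q].

Definition params_eq T X (U1 U0 : 'rV[R]_2 -> R) T2 X2 V1 V0 (p : 'rV[R]_2) :=
  \forall q \near p,
  [/\ X q = X2 q, T (q 0 0) = T2 (q 0 0), U1 q = V1 q & U0 q = V0 q].

Lemma affine_eq (a b a' b' u d : R) : d != 0 -> a * u + b = a' * u + b' ->
  a * (u + d) + b = a' * (u + d) + b' -> a = a' /\ b = b'.
Proof.
move=> d0 e0 e1; have aa : a = a'.
  apply: (mulIf d0); transitivity ((a * (u + d) + b) - (a * u + b)); first by ring.
  by rewrite e0 e1; ring.
by split=> //; apply: (@addrI _ (a * u)); rewrite e0 aa.
Qed.

Lemma eqL_germ (y : 'rV[R]_3) th th2 :
  diffeq_germ y (eqL th) = diffeq_germ y (eqL th2) <-> coefs_eq th th2 (base y).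
Proof.
split=> [/diffeq_germP H|H]; last first.
  apply/diffeq_germP; move: (near_base H); apply: filterS => x [a b c] j jx.
  by rewrite /eqL /= jx a b c.
(* A jet with the time derivative prescribed by one equation must satisfy the other, so the
   right-hand sides agree for all values of [u_x] and [u_xx]. *)
have key x : (forall j, jpt j = x -> (eqL th j <-> eqL th2 j)) -> forall v m,
    cA th (base x) * m + cB th (base x) * v + cC th (base x) * fiber x =
    cA th2 (base x) * m + cB th2 (base x) * v + cC th2 (base x) * fiber x.
  move=> Hx v m; set K := LHS; have [p [p0 p1]] := row2E K v.
  have s : (const_mx m : 'M[R]_2)^T = const_mx m by rewrite trmx_const.
  have [h _] := Hx (Jet x p s) (erefl _).
  by move: h; rewrite /eqL /= p0 p1 !mxE; exact.
have [d d0 H2] := near_two_fibers H.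
move: H2; apply: filterS => q [/key k0 /key k1]; move: k0 k1; rewrite !base_adjoin !fiber_adjoin.
move=> k0 k1.
have c0 := k0 0 0; have c1 := k1 0 0; rewrite !mulr0 !add0r in c0 c1.
have [cC _] : cC th q = cC th2 q /\ 0 = 0 :> R.
  by apply: (affine_eq d0 (u := fiber y)); rewrite !addr0.
have := k0 0 1; have := k0 1 0; rewrite !mulr0 !mulr1 !addr0 !add0r c0 => /addIr cB /addIr cA.
by split.
Qed.

Lemma parabolic_germ (x : 'rV[R]_4) th th2 :
  (forall j, jpt j = x -> (eqDE0 th j <-> eqDE0 th2 j)) -> forall v1 vm m,
  alD th x * m + GD th x (\row_k [:: 0; v1; vm]`_k) =
  alD th2 x * m + GD th2 x (\row_k [:: 0; v1; vm]`_k).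
Proof.
move=> Hx v1 vm m.
(* The time derivative that makes the jet a solution of the first equation; the second-order part
   [m *: delta_mx 1 1] has value [m] on [nuD]. *)
pose K := alD th x * m + GD th x (\row_k [:: 0; v1; vm]`_k).
pose p : 'rV[R]_3 := \row_k [:: K; v1; vm]`_k.
have s : (m *: delta_mx 1 1 : 'M[R]_3)^T = m *: delta_mx 1 1.
  by rewrite linearZ /= trmx_delta.
have e t : eqDE0 t (Jet x p s) <-> K = alD t x * m + GD t x (\row_k [:: 0; v1; vm]`_k).
  have := parabolicD t (Jet x p s); rewrite /= qfZ qf_delta nuD1 expr1n mulr1.
  by rewrite mxE /= /GD !mxE.
have [h _] := Hx (Jet x p s) (erefl _).
by rewrite -/K; apply/e/h/e.
Qed.

Lemma eqD_germ (y : 'rV[R]_4) th th2 :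
  diffeq_germ y (eqDE0 th) = diffeq_germ y (eqDE0 th2) <-> coefs_eq th th2 (base (base y)).
Proof.
split=> [/diffeq_germP H|H]; last first.
  have HA : \forall q \near base (base y), cA th q = cA th2 q by apply: filterS H => q [].
  have HB : \forall q \near base (base y), cB th q = cB th2 q by apply: filterS H => q [].
  have HC : \forall q \near base (base y), cC th q = cC th2 q by apply: filterS H => q [].
  apply/diffeq_germP; have n0 := near_base2 H.
  have n1 := near_base2 (near_pd_eq 1 HA); have n2 := near_base2 (near_pd_eq 1 HB).
  have n3 := near_base2 (near_pd_eq 1 HC).
  move: (near2 (fun _ h1 h2 => conj h1 h2) n0 n1) (near2 (fun _ h1 h2 => conj h1 h2) n2 n3).
  apply: near2 => x [[a b c] ax] [bx cx] j jx.
  by rewrite /eqDE0 /= jx a b c ax bx cx.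
(* Subtracting the relation at zero slopes removes the terms with [B_x] and [C_x]. Of the
   derivatives of the coefficients only [A_x] is left, and it is settled once the [A] coefficients
   agree nearby. *)
have k : \forall x \near y, forall v1 vm m,
    cA th (base (base x)) * m + cB th (base (base x)) * v1 + (pd 1 (cA th) (base (base x)) * (v1 + fiber x * vm)
      - cC th (base (base x)) * fiber (base x) * vm) =
    cA th2 (base (base x)) * m + cB th2 (base (base x)) * v1 + (pd 1 (cA th2) (base (base x)) * (v1 + fiber x * vm)
      - cC th2 (base (base x)) * fiber (base x) * vm).
  apply: filterS H => x /parabolic_germ Hx v1 vm m.
  have := Hx 0 0 0; have := Hx v1 vm m; rewrite /GD /alD !mxE /=; gen_pd.
  generalize (cA th (base (base x))) (cB th (base (base x))) (cC th (base (base x))).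
  generalize (cA th2 (base (base x))) (cB th2 (base (base x))) (cC th2 (base (base x))).
  move=> a' b' c' a b c e1 e0.
  move/eqP: e1; rewrite -subr_eq0 => /eqP e1; move/eqP: e0; rewrite -subr_eq0 => /eqP e0.
  by apply/eqP; rewrite -subr_eq0; apply/eqP; rewrite -[RHS](subrr 0) -{1}e1 -e0; ring.
have [d d0 k2] := near_two_fibers (near_slice k).
have HA : \forall q \near base (base y), cA th q = cA th2 q.
  apply: filterS k2 => q [h _]; have := h 0 0 1.
  by rewrite !base_adjoin !mulr0 !addr0 !mulr0 !subr0 !addr0 !mulr1.
move: (near_pd_eq 1 HA) k2; apply: filterS2 => q e; rewrite !base_adjoin !fiber_adjoin e.
move=> [h1 h2]; have eA := h1 0 0 1; have eB := h1 1 0 0; have eC := h1 0 1 0; have eC' := h2 0 1 0.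
rewrite !mulr0 !addr0 !mulr0 !subr0 !addr0 !mulr1 in eA.
rewrite !mulr0 !addr0 !subr0 !mulr1 !add0r in eB; have {}eB := addIr _ eB.
rewrite !mulr0 !add0r !mulr1 in eC eC'; have {}eC := oppr_inj (addrI _ eC); have {}eC' := oppr_inj (addrI _ eC').
(* C occurs here only multiplied by u, which may vanish, so two values of u are compared. *)
have [cC _] : cC th q = cC th2 q /\ 0 = 0 :> R.
  by apply: (affine_eq d0 (u := fiber (base y))); rewrite !addr0.
by split.
Qed.

Lemma trL_germ (y : 'rV[R]_3) T X U1 U0 T2 X2 V1 V0 :
  (\forall x \near y, trL T X U1 U0 x = trL T2 X2 V1 V0 x) <->
  params_eq T X U1 U0 T2 X2 V1 V0 (base y).
Proof.
split=> [H|H]; last first.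
  move: (near_base H); apply: filterS => x [eX eT e1 e0].
  by rewrite /trL eX eT e1 e0.
have [d d0 H2] := near_two_fibers H; apply: filterS H2 => q [h1 h2].
have e1 := congr1 (@fiber R 2) h1; have e2 := congr1 (@fiber R 2) h2.
have ei : img T X q = img T2 X2 q.
  by have := congr1 (@base R 2) h1; rewrite !base_trL base_adjoin.
rewrite /trL !fiber_adjoin !base_adjoin in e1 e2.
have [eU1 eU0] := affine_eq d0 e1 e2.
by split=> //; [rewrite -(img1 T) ei img1 | rewrite -(img0 T X) ei img0].
Qed.

Lemma trDE0_germ (y : 'rV[R]_4) T X U1 U0 T2 X2 V1 V0 :
  (\forall x \near y, trDE0 T X U1 U0 x = trDE0 T2 X2 V1 V0 x) <->
  params_eq T X U1 U0 T2 X2 V1 V0 (base (base y)).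
Proof.
split=> [H|H].
  apply/trL_germ; move: (near_slice H); apply: filterS => z e.
  by have := congr1 (@base R 3) e; rewrite !base_trDE0 base_adjoin.
have HX : \forall q \near base (base y), X q = X2 q by apply: filterS H => q [].
have H1 : \forall q \near base (base y), U1 q = V1 q by apply: filterS H => q [].
have H0 : \forall q \near base (base y), U0 q = V0 q by apply: filterS H => q [].
have n0 := near_base2 H.
have n1 := near_base2 (near_pd_eq 1 HX); have n2 := near_base2 (near_pd_eq 1 H1).
have n3 := near_base2 (near_pd_eq 1 H0).
move: (near2 (fun _ h1 h2 => conj h1 h2) n0 n1) (near2 (fun _ h1 h2 => conj h1 h2) n2 n3).
apply: near2 => x [[eX eT e1 e0] ex] [ex1 ex0].
by rewrite /trDE0 /trL eX eT e1 e0 ex ex1 ex0.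
Qed.

Lemma tripleL_eq (y : 'rV[R]_3) th th' T X U1 U0 th2 th2' T2 X2 V1 V0 :
  tripleL y th th' (trL T X U1 U0) = tripleL y th2 th2' (trL T2 X2 V1 V0) <->
  [/\ coefs_eq th th2 (base y), coefs_eq th' th2' (img T X (base y)) &
      params_eq T X U1 U0 T2 X2 V1 V0 (base y)].
Proof.
rewrite /tripleL /triple -(base_trL T X U1 U0); split.
  move=> e; have := congr1 (fun s => s.2) e; move=> /map_germP e2.
  have e0 := congr1 (fun s => s.1.1) e; have := congr1 (fun s => s.1.2) e.
  (* The target germs are taken at the images of [y], which coincide because the transformations
     do. *)
  rewrite /= -(nbhs_singleton e2) => e1.
  by split; [apply/eqL_germ | apply/eqL_germ | apply/trL_germ].
move=> [/eqL_germ e0 /eqL_germ e1 /trL_germ e2].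
have e3 := (map_germP _ _ _).2 e2.
by rewrite e0 e1 e3 (nbhs_singleton e2).
Qed.

Lemma tripleDE0_eq (y : 'rV[R]_4) th th' T X U1 U0 th2 th2' T2 X2 V1 V0 :
  tripleDE0 y th th' (trDE0 T X U1 U0) = tripleDE0 y th2 th2' (trDE0 T2 X2 V1 V0) <->
  [/\ coefs_eq th th2 (base (base y)), coefs_eq th' th2' (img T X (base (base y))) &
      params_eq T X U1 U0 T2 X2 V1 V0 (base (base y))].
Proof.
rewrite /tripleDE0 /triple -(base2_trDE0 T X U1 U0); split.
  move=> e; have := congr1 (fun s => s.2) e; move=> /map_germP e2.
  have e0 := congr1 (fun s => s.1.1) e; have := congr1 (fun s => s.1.2) e.
  rewrite /= -(nbhs_singleton e2) => e1.
  by split; [apply/eqD_germ | apply/eqD_germ | apply/trDE0_germ].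
move=> [/eqD_germ e0 /eqD_germ e1 /trDE0_germ e2].
have e3 := (map_germP _ _ _).2 e2.
by rewrite e0 e1 e3 (nbhs_singleton e2).
Qed.
End GermEquality.

(** * The correspondence between triples of germs *)

Unset Implicit Arguments.

Theorem theorem5 (R : realType) (y0 : 'rV[R]_3) (eta0 : R) :
  [/\ (* every admissible transformation of the class L has the stated form *)
      forall s, admissibleL y0 s ->
        exists (th th' : coefs R) (T : R -> R) (X U1 U0 : 'rV[R]_2 -> R),
          [/\ tr_params T X U1 U0 (base y0),
              connectsL y0 th th' (trL T X U1 U0) &
              s = tripleL y0 th th' (trL T X U1 U0)],
      (* the extended transformations are admissible *)
      forall (th th' : coefs R) (T : R -> R) (X U1 U0 : 'rV[R]_2 -> R),
        connectsL y0 th th' (trL T X U1 U0) ->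
        connectsDE0 (adjoin y0 eta0) th th' (trDE0 T X U1 U0),
      (* the extended transformations exhaust the admissible ones *)
      forall s, admissibleDE0 (adjoin y0 eta0) s ->
        exists (th th' : coefs R) (T : R -> R) (X U1 U0 : 'rV[R]_2 -> R),
          [/\ tr_params T X U1 U0 (base y0),
              connectsL y0 th th' (trL T X U1 U0) &
              s = tripleDE0 (adjoin y0 eta0) th th' (trDE0 T X U1 U0)] &
      (* extension is a one-to-one correspondence *)
      exists F,
        set_bij (admissibleL y0) (admissibleDE0 (adjoin y0 eta0)) F /\
        forall (th th' : coefs R) (T : R -> R) (X U1 U0 : 'rV[R]_2 -> R),
          connectsL y0 th th' (trL T X U1 U0) ->
          F (tripleL y0 th th' (trL T X U1 U0))
            = tripleDE0 (adjoin y0 eta0) th th' (trDE0 T X U1 U0)].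

Proof.
have bE : base (adjoin y0 eta0) = y0 by rewrite base_adjoin.
have extend (th th' : coefs R) T (X U1 U0 : 'rV[R]_2 -> R) :
    connectsL y0 th th' (trL T X U1 U0) -> connectsDE0 (adjoin y0 eta0) th th' (trDE0 T X U1 U0).
  move=> c; have [ad ad' pt _] := c.
  have [_ ok] := (tr_paramsP _ _ _ _ _).1 (trL_params pt).
  have F := connectsL_formulas ok c; rewrite /= base_trL in ad'.
  by apply: formulas_connectsD; rewrite bE.
have formL s : admissibleL y0 s -> exists (th th' : coefs R) (T : R -> R) (X U1 U0 : 'rV[R]_2 -> R),
    [/\ tr_params T X U1 U0 (base y0), connectsL y0 th th' (trL T X U1 U0) &
        s = tripleL y0 th th' (trL T X U1 U0)].
  move=> [th [th' [phi [c ->]]]]; have [T [X [U1 [U0 E]]]] := connectsL_structure c.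
  have c' := connects_germ E c; exists th, th', T, X, U1, U0; split.
  - by have [_ _ pt _] := c'; exact: trL_params.
  - exact: c'.
  - exact: triple_germ.
have formD s : admissibleDE0 (adjoin y0 eta0) s -> exists (th th' : coefs R) (T : R -> R) (X U1 U0 : 'rV[R]_2 -> R),
    [/\ tr_params T X U1 U0 (base y0), connectsL y0 th th' (trL T X U1 U0) &
        s = tripleDE0 (adjoin y0 eta0) th th' (trDE0 T X U1 U0)].
  move=> [th [th' [phi [c ->]]]]; have [T [X [U1 [U0 E]]]] := connectsD_structure c.
  have c' := connects_germ E c; have [ad ad' pt _] := c'.
  have := point_transformation_trDE0_trL pt; rewrite bE => /trL_params tp.
  have [_ ok] := (tr_paramsP _ _ _ _ _).1 tp.
  have okD : tr_ok T X U1 U0 (base (base (adjoin y0 eta0))) by rewrite bE.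
  have := connectsD_formulas okD c'; rewrite bE => F.
  rewrite /= bE in ad; rewrite /= base2_trDE0 bE in ad'.
  exists th, th', T, X, U1, U0; split; first exact: tp.
  - exact: formulas_connectsL.
  - exact: triple_germ.
split; [exact: formL | exact: extend | exact: formD |].
pose Rel s s' := exists (th th' : coefs R) (T : R -> R) (X U1 U0 : 'rV[R]_2 -> R),
  [/\ connectsL y0 th th' (trL T X U1 U0), s = tripleL y0 th th' (trL T X U1 U0) &
      s' = tripleDE0 (adjoin y0 eta0) th th' (trDE0 T X U1 U0)].
have RelE th th' T X U1 U0 th2 th2' T2 X2 V1 V0 :
    tripleL y0 th th' (trL T X U1 U0) = tripleL y0 th2 th2' (trL T2 X2 V1 V0) <->
    tripleDE0 (adjoin y0 eta0) th th' (trDE0 T X U1 U0) =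
    tripleDE0 (adjoin y0 eta0) th2 th2' (trDE0 T2 X2 V1 V0).
  by split; [move=> /tripleL_eq e; apply/tripleDE0_eq | move=> /tripleDE0_eq e; apply/tripleL_eq];
     move: e; rewrite bE.
(* [F] extends some representation of the triple as a transformation of the stated form; by [RelE]
   every other representation gives the same value. *)
have /boolp.choice[F FE] : forall s, exists s', admissibleL y0 s -> Rel s s'.
  move=> s; have [a|na] := pselect (admissibleL y0 s).
    have [th [th' [T [X [U1 [U0 [_ c e]]]]]]] := formL s a.
    by eexists => _; exists th, th', T, X, U1, U0.
  (* An arbitrary value outside the set of admissible triples. *)
  by exists (set0, set0, set0) => /na.
exists F; split; last first.
  move=> th th' T X U1 U0 c.
  have a : admissibleL y0 (tripleL y0 th th' (trL T X U1 U0)) by exists th, th', (trL T X U1 U0).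
  have [th2 [th2' [T2 [X2 [V1 [V0 [_ e ->]]]]]]] := FE _ a.
  by apply/esym/RelE.
split.
- move=> s a; have [th [th' [T [X [U1 [U0 [c _ ->]]]]]]] := FE _ a.
  by exists th, th', (trDE0 T X U1 U0); split=> //; exact: extend.
- move=> s1 s2 /set_mem a1 /set_mem a2.
  have [th [th' [T [X [U1 [U0 [_ -> ->]]]]]]] := FE _ a1.
  have [th2 [th2' [T2 [X2 [V1 [V0 [_ -> ->]]]]]]] := FE _ a2.
  by move=> /RelE.
- move=> s' /formD[th [th' [T [X [U1 [U0 [_ c ->]]]]]]].
  have a : admissibleL y0 (tripleL y0 th th' (trL T X U1 U0)) by exists th, th', (trL T X U1 U0).
  exists (tripleL y0 th th' (trL T X U1 U0)) => //.
  have [th2 [th2' [T2 [X2 [V1 [V0 [_ e ->]]]]]]] := FE _ a.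
  by apply/esym/RelE.
Qed.
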